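(* Fix $\alpha>1$ and $\lambda\in\mathbb{R}$. For each fixed $t>0$, as $n\to\infty$, $$\mathbb{P}^{\alpha,\lambda/n}\left(\left(n^{-1}\underline{X}_{nL^{-1}(n t)},\,n^{-1}\overline{X}_{nL^{-1}(n t)}\right)=\left(m_{n,-}^{-1}(t),m_{n,+}^{-1}(t)\right)\right)\rightarrow 1.$$
   Context: Environment. Under $\mathbf{P}$, $\omega=(\omega_i)_{i\in\mathbb{Z}}$ are the atoms of a unit intensity homogeneous Poisson process on $\mathbb{R}$ conditioned to have an atom at $0$ (Palm distribution), labelled so that $\cdots<\omega_{-1}<\omega_0=0<\omega_1<\cdots$. Walk. For $\lambda\in\mathbb{R}$, $c^{\alpha,\lambda}(\omega_i,\omega_j)=\exp(-|\omega_i-\omega_j|^\alpha+\lambda(\omega_i+\omega_j))$ for $i\ne j$, $c^{\alpha,\lambda}(\omega_i,\omega_i)=0$, and $c^{\alpha,\lambda}(\omega_i)=\sum_{j\in\mathbb{Z}} c^{\alpha,\lambda}(\omega_i,\omega_j)$. $P^{\alpha,\lambda}_\omega$ is the quenched law of the continuous-time Markov chain $X=(X_t)_{t\ge0}$ on $\omega$ started from $0$ with generator $(L^{\alpha,\lambda}f)(\omega_i)=\sum_{j}\frac{c^{\alpha,\lambda}(\omega_i,\omega_j)}{c^{\alpha,\lambda}(\omega_i)}(f(\omega_j)-f(\omega_i))$. The annealed law is $\mathbb{P}^{\alpha,\lambda}=\int P_\omega^{\alpha,\lambda}(\cdot)\,\mathbf{P}(d\omega)$. In the $n$-th model, $\lambda$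 is replaced by $\lambda/n$. $\overline X_t=\sup_{s\le t}X_s$ and $\underline X_t=\inf_{s\le t}X_s$. $L(u)=e^{(\log u)^{1/\alpha}}$ for $u\ge1$ and $L(u)=u$ for $u\in[0,1)$; its inverse is $L^{-1}(u)=e^{(\log u)^\alpha}$ for $u\ge1$, $L^{-1}(u)=u$ for $u\in[0,1)$. With $r^{\alpha,0}(\omega_j,\omega_{j+1})=c^{\alpha,0}(\omega_j,\omega_{j+1})^{-1}$, for $x\ge0$: $m_{n,+}(x)=\max_{j:\,0\le\omega_j\le xn}\frac1n L(r^{\alpha,0}(\omega_j,\omega_{j+1}))$, $m_{n,-}(x)=\max_{j:\,-xn\le\omega_j\le0}\frac1n L(r^{\alpha,0}(\omega_{j-1},\omega_j))$; and for $t\ge 0$: $m_{n,+}^{-1}(t)=\inf\{x\ge0:m_{n,+}(x)>t\}$, $m_{n,-}^{-1}(t)=-\inf\{x\ge0:m_{n,-}(x)>t\}$. *)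

(* Defs.v *)
From HB Require Import structures.
From mathcomp Require Import all_boot all_order all_algebra.
From mathcomp Require Import all_classical all_reals all_analysis.

Set Implicit Arguments.
Unset Strict Implicit.
Unset Printing Implicit Defensive.
Import Order.TTheory GRing.Theory Num.Theory.
Import numFieldNormedType.Exports.

Local Open Scope classical_set_scope.
Local Open Scope ring_scope.

(* Locally finite sets of reals, unbounded in both directions, enumerated in
   increasing order by the integers. *)
Definition increasing_enum (R : realType) (x : int -> R) : Prop :=
  [/\ forall i, x i < x (i + 1),
      forall M, exists i, M < x i
    & forall M, exists i, x i < M].

(* Product sigma-algebra on R^Z. *)
Definition measurable_seqs (R : realType) : set (set (int -> R)) :=
  <<s [set A | exists i (B : set R),
        measurable B /\ A = [set x | B (x i)]] >>.

Definition poisson_mass (R : realType) (r : R) (k : nat) : R :=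
  expR (- r) * r ^+ k / k`!%:R.

(* The atoms y_i form a homogeneous Poisson process of intensity 1: the numbers
   of atoms in disjoint Borel sets are independent Poisson variables whose
   parameters are the Lebesgue measures of the sets.  (poisson_mass is
   used instead of poisson_pmf because the latter is 1 at rate 0.) *)
Definition unit_poisson_process (R : realType) (d : measure_display)
    (S : measurableType d) (Q : probability S R) (y : int -> S -> R) : Prop :=
  [/\ forall i, measurable_fun setT (y i),
      forall s, increasing_enum (y ^~ s)
    & forall (m : nat) (B : 'I_m -> set R) (k : 'I_m -> nat),
        (forall l, measurable (B l)) ->
        (forall l, (lebesgue_measure (B l) < +oo)%E) ->
        (forall l l', l != l' -> B l `&` B l' = set0) ->
        Q [set s | forall l,
             counting [set i | B l (y i s)] = (k l)%:R%:E :> \bar R]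
        = (\prod_(l < m) poisson_mass (fine (lebesgue_measure (B l))) (k l))%:E].

(* The labelled points w, with w_0 = 0, have under P the Palm distribution of
   the intensity 1 stationary point process y: for every Borel set B and every
   event A,
     |B| P(w \in A) = E_Q #{k : y_k \in B and the configuration y translated by
                              - y_k (and relabelled from its atom at 0) is in A}.
   This is "the law of y conditioned to have an atom at 0". *)
Definition palm_version (R : realType) (dS : measure_display)
    (S : measurableType dS) (Q : probability S R) (y : int -> S -> R)
    (d : measure_display) (T : measurableType d) (P : probability T R)
    (w : int -> T -> R) : Prop :=
  [/\ forall i, measurable_fun setT (w i),
      forall e, increasing_enum (w ^~ e) /\ w 0 e = 0
    & forall (B : set R) (A : set (int -> R)),
        measurable B -> measurable_seqs A ->
        (lebesgue_measure B * P [set e | A (w ^~ e)] =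
         \int[Q]_s counting [set k | B (y k s) /\
                               A (fun i => y (k + i)%R s - y k s)%R])%E].

Definition cadlag (R : realType) (f : R -> R) : Prop :=
  (forall t, 0 <= t -> f s @[s --> t^'+] --> f t) /\
  (forall t, 0 < t -> cvg (f s @[s --> t^'-])).

(* Q-matrix entries read off from a generator L: the jump rate from x to y != x
   is (L 1_y)(x), and the exit rate from x is - (L 1_x)(x). *)
Definition exit_rate (R : realType) (L : (R -> R) -> R -> R) (x : R) : R :=
  - L \1_[set x] x.

Definition jump_prob (R : realType) (L : (R -> R) -> R -> R) (x y : R) : R :=
  if y == x then 0 else L \1_[set y] x / exit_rate L x.

(* Under mu, the real-valued process X is a continuous-time Markov chain on the
   countable set D with generator L, started from x0: its jump chain Y is a
   Markov chain with transition probabilities jump_prob L, and, given Y, the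
   holding times H_l are independent exponential variables with parameters
   exit_rate L (Y_l).  The definition is meant for positive exit rates (no
   absorbing states) and leaves X free after an explosion; the chains considered
   here have all exit rates equal to 1, hence do not explode. *)
Definition markov_chain (R : realType) (d : measure_display)
    (O : measurableType d) (mu : {measure set O -> \bar R}) (X : R -> O -> R)
    (D : set R) (L : (R -> R) -> R -> R) (x0 : R) : Prop :=
  exists Y H : nat -> O -> R,
  [/\ forall l, measurable_fun setT (Y l),
      forall l, measurable_fun setT (H l),
      forall (k : nat) (x u : nat -> R),
        (forall l, D (x l)) -> (forall l, 0 <= u l) ->
        mu [set o | forall l, (l <= k)%N -> Y l o = x l /\ u l < H l o] =
        ((x 0%N == x0)%:R * (\prod_(l < k) jump_prob L (x l) (x l.+1))
         * \prod_(l < k.+1) expR (- exit_rate L (x l) * u l))%:E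
    & {ae mu, forall o, forall (k : nat) (t : R),
        \sum_(l < k) H l o <= t < \sum_(l < k.+1) H l o -> X t o = Y k o}].

(* Unconditional (absolutely convergent) summation over Z. *)
Definition sumZ (R : realType) (g : int -> R) : R :=
  fine (\esum_(j in [set: int]) ((g^\+)%R j)%:E)
  - fine (\esum_(j in [set: int]) ((g^\-)%R j)%:E).

Section mott.
Variables (R : realType) (alpha lambda : R).

Definition conductance (x y : R) : R :=
  if x == y then 0 else expR (- (`|x - y| `^ alpha) + lambda * (x + y)).

Variable w : int -> R.

Definition total_conductance (x : R) : R :=
  sumZ (fun j => conductance x (w j)).

Definition mott_generator (f : R -> R) (x : R) : R :=
  sumZ (fun j =>
    conductance x (w j) / total_conductance x * (f (w j) - f x)).

End mott.

(* For almost every environment e, K e is the quenched law of the random walk X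
   on the atoms w_i(e), started from 0. *)
Definition quenched_law (R : realType) (d : measure_display)
    (T : measurableType d) (P : probability T R) (w : int -> T -> R)
    (dO : measure_display) (O : measurableType dO) (X : R -> O -> R)
    (alpha lambda : R) (K : R.-pker T ~> O) : Prop :=
  {ae P, forall e, markov_chain (K e) X (range (w ^~ e))
           (mott_generator alpha lambda (w ^~ e)) 0}.

Definition annealed (R : realType) (d : measure_display) (T : measurableType d)
    (P : probability T R) (dO : measure_display) (O : measurableType dO)
    (K : R.-pker T ~> O) (E : set (T * O)) : \bar R :=
  (\int[P]_e K e [set o | E (e, o)])%E.

Definition running_sup (R : realType) (f : R -> R) (t : R) : R :=
  sup [set f s | s in `[0, t]].

Definition running_inf (R : realType) (f : R -> R) (t : R) : R :=
  inf [set f s | s in `[0, t]].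

Section scaling.
Variables (R : realType) (alpha : R).

Definition Lfun (u : R) : R :=
  if 1 <= u then expR (ln u `^ alpha^-1) else u.

Definition Linv (u : R) : R :=
  if 1 <= u then expR (ln u `^ alpha) else u.

Definition resistance (x y : R) : R := (conductance alpha 0 x y)^-1.

Variables (w : int -> R) (n : nat).

Definition m_plus (x : R) : R :=
  sup [set n%:R^-1 * Lfun (resistance (w j) (w (j + 1)))
      | j in [set j | 0 <= w j <= x * n%:R]].

Definition m_minus (x : R) : R :=
  sup [set n%:R^-1 * Lfun (resistance (w (j - 1)) (w j))
      | j in [set j | - (x * n%:R) <= w j <= 0]].

Definition m_plus_inv (t : R) : R := inf [set x | 0 <= x /\ t < m_plus x].

Definition m_minus_inv (t : R) : R := - inf [set x | 0 <= x /\ t < m_minus x].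

End scaling.

(* Main.v *)
Require Import Defs.
From HB Require Import structures.
From mathcomp Require Import all_boot all_order all_algebra.
From mathcomp Require Import all_classical all_reals all_analysis.
From mathcomp Require Import measurable_realfun.
From mathcomp Require Import ring lra zify.

(* Let l = ln (n t), so that the time scale is n exp (l^alpha).  The numbers
   n m_{n,-}^{-1}(t) and n m_{n,+}^{-1}(t) are the atoms x_a and x_b at the first
   gaps longer than l on the left and on the right of 0, and the point is that at
   time n exp (l^alpha) the walk has visited both x_a and x_b but has not left
   I = {x_a, ..., x_b}.

   With high probability x_a and x_b are at distance O(n), and no gap in a window
   of size O(n) is within del of l.  Since alpha > 1, changing a gap of length l
   by del multiplies its resistance by about exp (+- del l^(alpha-1)), which beats
   every power of l.  Hence the resistance R between any two points of I times
   the total weight pi(I), which is of order n up to powers of l, is much smaller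
   than n exp (l^alpha), whereas the total conductance kappa between I and its
   complement is much smaller than exp (- l^alpha).  For the walk killed outside
   I, a Dirichlet form computation shows that a given point of I is avoided for K
   steps with probability at most R pi(I) / K, and by reversibility the pi-average
   of the probability of leaving I within K steps is at most K kappa / pi(I).  The
   holding times are exponential with mean 1, so the number of steps is
   n exp (l^alpha) up to powers of l.

   The environment estimates are proved for the stationary Poisson process Q: a
   second moment bound produces a long empty interval, and the Palm formula turns
   expected numbers of gaps into the exponential law of w_1.  They carry over to
   the Palm measure P, because P(A) is at most the Q-expectation of the number of
   atoms in [0, 1[ on the event that A holds as seen from one of them. *)

Set Implicit Arguments.
Unset Strict Implicit.
Unset Printing Implicit Defensive.
Import Order.TTheory GRing.Theory Num.Theory.
Import numFieldNormedType.Exports.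

Local Open Scope classical_set_scope.
Local Open Scope ring_scope.

(** * Finite reversible chains *)

(** The delicate point is a factor n. Bounding the exit probability from 0 through pi(0) alone loses
    pi(I) / pi(0), of order n = exp l / t up to powers of l, and for alpha < 2 the gain exp (del
    l^(alpha-1)) does not repay any positive power of n. This is why the exit bound is a stationary
    one, transferred to 0 by hitting: from any point of I the walk reaches 0 early with probability
    at least 1/2, so leaving from 0 can be likelier than leaving on average only by a bounded
    factor. For the same reason the resistance of I is bounded through a sum of exp (gap) over the
    gaps, and not by the number of gaps times the largest resistance. The margin del is a constant:
    a window of size O(n) contains on average O(n del exp (- l)) = O(del / t) gaps within del of l,
    which is small without del tending to 0. The bias lambda / n acts on a window of size O(n), so
    inside the window it changes conductances by bounded factors. *)

Section finite_chain.
Variables (R : realFieldType) (S : finType) (c : S -> S -> R) (pi : S -> R).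
Hypothesis c_ge0 : forall x y, 0 <= c x y.
Hypothesis c_sym : forall x y, c x y = c y x.
Hypothesis pi_gt0 : forall x, 0 < pi x.
Hypothesis c_le : forall x, \sum_y c x y <= pi x.

Let p x y := c x y / pi x.

(** Rows of [p] may sum to less than 1; the missing mass is the walk killed on leaving the finite
    set. The positions at all times 0, ..., K have to lie in [A], so [predT] gives plain
    survival. *)
Fixpoint restricted_prob (A : pred S) (K : nat) (x : S) : R :=
  if K is K'.+1 then (A x)%:R * \sum_y p x y * restricted_prob A K' y
  else (A x)%:R.

Local Notation stay := (restricted_prob predT).
Local Notation avoid z := (restricted_prob (predC1 z)).

Let p_ge0 x y : 0 <= p x y.
Proof. by rewrite divr_ge0// ltW. Qed.

Let sum_p_le1 x : \sum_y p x y <= 1.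
Proof. by rewrite -mulr_suml ler_pdivrMr ?pi_gt0// mul1r. Qed.

Lemma restricted_prob_ge0 A K x : 0 <= restricted_prob A K x.
Proof.
elim: K x => [|K IH] x /=; first exact: ler0n.
by rewrite mulr_ge0// sumr_ge0// => y _; rewrite mulr_ge0.
Qed.

Lemma restricted_prob_nonincreasing A K x :
  restricted_prob A K.+1 x <= restricted_prob A K x.
Proof.
elim: K x => [|K IH] x.
  rewrite /=; case: (A x); rewrite ?mul0r// mul1r.
  apply: le_trans (sum_p_le1 x); apply: ler_sum => y _.
  by rewrite ler_piMr// lern1 leq_b1.
rewrite [leLHS]/= [leRHS]/= ler_wpM2l//; apply: ler_sum => y _.
by apply: ler_wpM2l => //; exact: IH.
Qed.

Lemma restricted_prob_anti A K J x : (K <= J)%N ->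
  restricted_prob A J x <= restricted_prob A K x.
Proof.
move/subnK <-; elim: (J - K)%N => // n IH; rewrite addSn.
exact: le_trans (restricted_prob_nonincreasing _ _ _) IH.
Qed.

Lemma restricted_prob_le1 A K x : restricted_prob A K x <= 1.
Proof.
apply: le_trans (restricted_prob_anti _ _ (leq0n K)) _.
by rewrite /= lern1 leq_b1.
Qed.

Definition dirichlet_form (v : S -> R) : R :=
  2^-1 * \sum_x \sum_y c x y * (v x - v y) ^+ 2.

Section hitting.
Variables (Reff : R) (z : S).
Hypothesis Reff_ge0 : 0 <= Reff.
Hypothesis ReffP : forall (v : S -> R) x,
  (v x - v z) ^+ 2 <= Reff * dirichlet_form v.

(** The expected time before K spent alive without having met [z]: a truncated Green function summed
    over space, used as the test function in the Dirichlet form. *)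
Let v K x := \sum_(k < K) avoid z k x.

Let v_ge0 K x : 0 <= v K x.
Proof. by apply: sumr_ge0 => i _; exact: restricted_prob_ge0. Qed.

Let v_z K : v K z = 0.
Proof.
by rewrite /v big1// => -[[|k] lk] _ /=; rewrite eqxx ?mul0r.
Qed.

Let v_rec K x : x != z -> v K.+1 x = 1 + \sum_y p x y * v K y.
Proof.
move=> xz; rewrite /v big_ord_recl /= xz; congr (_ + _).
under [RHS]eq_bigr do rewrite mulr_sumr.
rewrite exchange_big /=; apply: eq_bigr => i _.
by rewrite mul1r.
Qed.

(** The recursion involves two horizons; since [v] increases with K, replacing the larger one by the
    smaller leaves an inequality at a single K. *)
Let v_step K x : x != z -> pi x * v K x - \sum_y c x y * v K y <= pi x.
Proof.
move=> xz.
have : v K x <= v K.+1 x.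
  by rewrite /v big_ord_recr /= lerDl restricted_prob_ge0.
rewrite v_rec// -(ler_pM2l (pi_gt0 x)) mulrDr mulr1 -lerBlDr.
suff -> : pi x * \sum_y p x y * v K y = \sum_y c x y * v K y by [].
rewrite mulr_sumr; apply: eq_bigr => y _.
by rewrite mulrA /p mulrCA divff ?gt_eqF// mulr1.
Qed.

Let v_energy K : dirichlet_form (v K) <= \sum_x pi x * v K x.
Proof.
have -> : dirichlet_form (v K) =
    \sum_x \sum_y c x y * v K x ^+ 2 - \sum_x v K x * \sum_y c x y * v K y.
  rewrite /dirichlet_form.
  have -> : \sum_x \sum_y c x y * (v K x - v K y) ^+ 2 =
    \sum_x \sum_y c x y * v K x ^+ 2 + \sum_x \sum_y c x y * v K y ^+ 2
     - 2 * \sum_x v K x * \sum_y c x y * v K y.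
    rewrite mulr_sumr -big_split /= -sumrB; apply: eq_bigr => x _.
    rewrite (mulrA 2) [2 * v K x * _]mulr_sumr -big_split /= -sumrB.
    by apply: eq_bigr => y _; ring.
  have -> : \sum_x \sum_y c x y * v K y ^+ 2 = \sum_x \sum_y c x y * v K x ^+ 2.
    rewrite exchange_big /=; apply: eq_bigr => x _; apply: eq_bigr => y _.
    by rewrite c_sym.
  by field.
rewrite -sumrB; apply: ler_sum => x _.
have [->|xz] := eqVneq x z.
  rewrite v_z expr0n /= mul0r subr0 mulr0 big1// => y _; exact: mulr0.
have vx := v_ge0 K x.
apply: le_trans (_ : v K x * (pi x * v K x - \sum_y c x y * v K y) <= _).
  rewrite mulrBr lerD2r -mulr_suml [leRHS]mulrCA -expr2.
  by rewrite ler_wpM2r// sqr_ge0.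
by rewrite [leRHS]mulrC ler_wpM2l// v_step.
Qed.

(** At a maximum point m of v, v(m)^2 <= Reff * E(v) <= Reff * pi(S) * v(m), and dividing by v(m)
    bounds v everywhere. Avoidance probabilities decrease in time, so K times the one at K is at
    most their sum v. *)
Lemma avoid_hitting_bound K x : K%:R * avoid z K x <= Reff * \sum_y pi y.
Proof.
have Spi_ge0 : 0 <= \sum_y pi y by apply: sumr_ge0 => y _; exact/ltW.
apply: le_trans (_ : v K x <= _).
  rewrite /v mulr_natl -[X in _ *+ X]card_ord -sumr_const.
  by apply: ler_sum => i _; apply: restricted_prob_anti; exact: (ltnW (ltn_ord i)).
have [xm _ xmP] := @arg_maxP _ _ _ x xpredT (v K) erefl.
apply: le_trans (xmP x erefl) _.
have [v0|vn0] := eqVneq (v K xm) 0; first by rewrite v0 mulr_ge0.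
have vgt0 : 0 < v K xm by rewrite lt_def vn0 v_ge0.
rewrite -(ler_pM2l vgt0) -expr2.
have := ReffP (v K) xm; rewrite v_z subr0 => /le_trans; apply.
rewrite [leRHS]mulrCA ler_wpM2l//; apply: le_trans (v_energy K) _.
rewrite mulr_sumr; apply: ler_sum => y _.
by rewrite mulrC ler_pM2r//; exact: xmP.
Qed.

End hitting.

(** The total conductance from the finite set to its complement when [pi] is the full weight of a
    site. *)
Definition leakage : R := \sum_x (pi x - \sum_y c x y).

(** Symmetry of [c] makes [pi] subinvariant, so under [pi] each step loses at most the mass
    [leakage] lost in the first one. *)
Lemma stationary_exit_bound K : \sum_x pi x * (1 - stay K x) <= K%:R * leakage.
Proof.
elim: K => [|K IH].
  by rewrite big1 ?mul0r// => x _; rewrite /= subrr mulr0.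
have -> : \sum_x pi x * (1 - stay K.+1 x) =
    leakage + \sum_y (\sum_x c x y) * (1 - stay K y).
  under [X in _ = _ + X]eq_bigr do rewrite mulr_suml.
  rewrite exchange_big -big_split /=; apply: eq_bigr => x _.
  under [X in _ = _ + X]eq_bigr do rewrite mulrBr mulr1.
  rewrite sumrB mulrBr mulr1 mul1r mulr_sumr addrA subrK; congr (_ - _).
  by apply: eq_bigr => y _; rewrite mulrA /p mulrCA divff ?gt_eqF// mulr1.
rewrite -natr1 mulrDl mul1r addrC lerD2r; apply: le_trans IH.
apply: ler_sum => y _; rewrite ler_wpM2r ?subr_ge0 ?restricted_prob_le1//.
by under eq_bigr do rewrite c_sym; exact: c_le.
Qed.

(* Before leaving, the walk has to pass through o or to avoid o. *)
Lemma exit_after_hit o K K' x :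
  (1 - stay K o) * (1 - avoid o K' x) <= 1 - stay (K' + K) x.
Proof.
have e_ge0 : 0 <= 1 - stay K o by rewrite subr_ge0 restricted_prob_le1.
have e_le1 : 1 - stay K o <= 1 by rewrite lerBlDr lerDl restricted_prob_ge0.
have atx K'' : (1 - stay K o) <= 1 - stay (K'' + K) o.
  by rewrite lerD2l lerN2 restricted_prob_anti// leq_addl.
elim: K' x => [|K' IH] x.
  rewrite /= add0n; have [->|_] := eqVneq x o; first by rewrite subr0 mulr1.
  by rewrite subrr mulr0 subr_ge0 restricted_prob_le1.
have [->|xo] := eqVneq x o.
  have -> : avoid o K'.+1 o = 0 by rewrite /= eqxx mul0r.
  by rewrite subr0 mulr1 atx.
rewrite addSn /= xo !mul1r.
have s1 := sum_p_le1 x.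
set s := \sum_y p x y in s1.
have -> : 1 - \sum_y p x y * stay (K' + K) y =
   (1 - s) + \sum_y p x y * (1 - stay (K' + K) y).
  under [X in _ = _ + X]eq_bigr do rewrite mulrBr mulr1.
  by rewrite sumrB -/s addrA subrK.
have -> : 1 - \sum_y p x y * avoid o K' y =
   (1 - s) + \sum_y p x y * (1 - avoid o K' y).
  under [X in _ = _ + X]eq_bigr do rewrite mulrBr mulr1.
  by rewrite sumrB -/s addrA subrK.
rewrite mulrDr lerD//; first by rewrite ler_piMl// subr_ge0.
rewrite mulr_sumr; apply: ler_sum => y _.
by rewrite [leLHS]mulrCA ler_wpM2l.
Qed.

(** Averaging [exit_after_hit] against [pi] gives the starting point [o] the weight of the whole set
    instead of [pi o], up to the probability of missing [o] during K' steps, which is bounded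
    uniformly in the start. *)
Lemma stay_bound o K K' Reff : 0 <= Reff ->
  (forall (v : S -> R) x, (v x - v o) ^+ 2 <= Reff * dirichlet_form v) ->
  (0 < K')%N ->
  (1 - stay K o) * ((\sum_x pi x) * (1 - Reff * (\sum_x pi x) / K'%:R))
   <= (K' + K)%:R * leakage.
Proof.
move=> R0 HR K'0; apply: le_trans (stationary_exit_bound _).
have e_ge0 : 0 <= 1 - stay K o by rewrite subr_ge0 restricted_prob_le1.
rewrite mulr_suml mulr_sumr; apply: ler_sum => x _.
rewrite [leLHS]mulrCA ler_pM2l//; apply: le_trans (exit_after_hit _ _ _ _).
apply: ler_wpM2l => //; rewrite lerD2l lerN2 ler_pdivlMr ?ltr0n// mulrC.
exact: avoid_hitting_bound.
Qed.

End finite_chain.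

(** * Effective resistance between two points of a line *)

Section path_resistance.
Variable R : realFieldType.

Lemma weighted_cauchy_schwarz (s : seq nat) (a r : nat -> R) :
  (forall i, 0 < r i) ->
  (\sum_(i <- s) a i) ^+ 2 <= (\sum_(i <- s) r i) * \sum_(i <- s) a i ^+ 2 / r i.
Proof.
move=> r0; case: s => [|i0 s]; first by rewrite !big_nil expr0n mul0r.
set t := i0 :: s; set A := \sum_(i <- t) a i; set B := \sum_(i <- t) r i.
have B0 : 0 < B.
  by rewrite /B big_cons ltr_wpDr// sumr_ge0// => i _; exact/ltW.
(* The variance of a_i / r_i under the weights r_i, about the mean A / B. *)
have : 0 <= \sum_(i <- t) r i * (a i / r i - A / B) ^+ 2.
  by apply: sumr_ge0 => i _; rewrite mulr_ge0 ?sqr_ge0// ltW.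
have -> : \sum_(i <- t) r i * (a i / r i - A / B) ^+ 2 =
   \sum_(i <- t) a i ^+ 2 / r i - 2 * (A / B) * A + (A / B) ^+ 2 * B.
  move: (A / B) => tau; rewrite /A /B !mulr_sumr -sumrB -big_split /=.
  by apply: eq_bigr => i _; field; rewrite gt_eqF.
have -> : (A / B) ^+ 2 * B = (A / B) * A by field; rewrite gt_eqF.
set E := \sum_(i <- t) _ => H.
have : 0 <= B * (E - A / B * A).
  apply: mulr_ge0; [exact: ltW|move: H].
  by rewrite -mulrA; move: (A / B * A) => q; lra.
rewrite mulrBr subr_ge0; suff -> : B * (A / B * A) = A ^+ 2 by [].
by field; rewrite gt_eqF.
Qed.

Variables (N : nat) (c : 'I_N.+1 -> 'I_N.+1 -> R).
Hypothesis c_ge0 : forall x y, 0 <= c x y.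
Hypothesis c_sym : forall x y, c x y = c y x.
Hypothesis c_gt0 : forall i, (i < N)%N -> 0 < c (inord i) (inord i.+1).

(** The double sum meets each edge in both orientations. [E1] and [E2] bound the same energy along
    the two off-diagonals, which are disjoint, and this uses up the factor 1/2. *)
Lemma nearest_neighbour_energy (v : 'I_N.+1 -> R) :
  \sum_(0 <= i < N) c (inord i) (inord i.+1) * (v (inord i) - v (inord i.+1)) ^+ 2
  <= dirichlet_form c v.
Proof.
pose F x y := c x y * (v x - v y) ^+ 2.
have F0 x y : 0 <= F x y by rewrite mulr_ge0// sqr_ge0.
have Fs x y : F x y = F y x.
  by rewrite /F c_sym -(sqrrN (v x - v y)) opprB.
set E := \sum_(0 <= i < N) _.
have E1 : E <= \sum_(x : 'I_N.+1) \sum_(y : 'I_N.+1 | (y : nat) == x.+1) F x y.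
  rewrite big_ord_recr /= ler_wpDr ?sumr_ge0//.
  rewrite /E big_mkord; apply: ler_sum => i _.
  have iN := ltn_ord i.
  rewrite (bigD1 (inord i.+1)) /=; last by rewrite inordK// ltnS.
  have -> : widen_ord (leqnSn N) i = inord i.
    by apply: val_inj; rewrite /= inordK// ltnS ltnW.
  by rewrite ler_wpDr ?sumr_ge0.
have E2 : E <= \sum_(x : 'I_N.+1) \sum_(y : 'I_N.+1 | (x : nat) == y.+1) F x y.
  apply: le_trans E1 _; rewrite (exchange_big_dep xpredT)//= le_eqVlt.
  apply/orP; left; apply/eqP; apply: eq_bigr => x _.
  by apply: eq_bigr => y _; exact: Fs.
rewrite /dirichlet_form ler_pdivlMl// mulr_natl mulr2n.
apply: le_trans (lerD E1 E2) _; rewrite -big_split /=; apply: ler_sum => x _.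
rewrite [leRHS](bigID (fun y : 'I_N.+1 => (y : nat) == x.+1)) /= lerD2l.
rewrite [leRHS](bigID (fun y : 'I_N.+1 => (x : nat) == y.+1)) /=.
apply: ler_wpDr; first by apply: sumr_ge0 => i _; exact: F0.
rewrite le_eqVlt; apply/orP; left; apply/eqP.
apply: eq_bigl => y; case: eqP => //= [xy|]; rewrite ?andbF ?andbT//.
by apply/esym/eqP; lia.
Qed.

Lemma series_resistance_bound (v : 'I_N.+1 -> R) (x z : 'I_N.+1) :
  (v x - v z) ^+ 2 <=
  (\sum_(0 <= i < N) (c (inord i) (inord i.+1))^-1) * dirichlet_form c v.
Proof.
wlog xz : x z / (x <= z)%N => [H|].
  by have [/H//|/ltnW/H] := leqP x z; rewrite -(sqrrN (v z - v x)) opprB.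
(* Padded by 1 beyond the last edge, because the Cauchy-Schwarz lemma asks for positive weights at
   every index. *)
pose cc i := if (i < N)%N then c (inord i) (inord i.+1) else 1.
have cc0 i : 0 < cc i by rewrite /cc; case: ifP => // /c_gt0.
have -> : v x - v z = \sum_(x <= i < z) (v (inord i) - v (inord i.+1)).
  rewrite (telescope_sumr_eq (fun i => - v (inord i)))//.
    by rewrite opprK addrC !inord_val.
  by move=> i _; rewrite opprK addrC.
apply: le_trans (weighted_cauchy_schwarz _ _ (r := fun i => (cc i)^-1) _) _.
  by move=> i; rewrite invr_gt0.
have zN : (z <= N)%N by rewrite -ltnS.
have sub (f : nat -> R) : (forall i, 0 <= f i) ->
    \sum_(x <= i < z) f i <= \sum_(0 <= i < N) f i.
  move=> f0; rewrite (big_cat_nat (leq0n x))/=; last exact: leq_trans xz zN.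
  rewrite [X in _ + X](big_cat_nat xz zN)/= addrCA lerDl addr_ge0// sumr_ge0//.
rewrite (le_trans (ler_pM _ _ (sub _ _) (sub _ _)))//.
- by apply: sumr_ge0 => i _; rewrite invr_ge0 ltW.
- by apply: sumr_ge0 => i _; rewrite divr_ge0 ?sqr_ge0// invr_ge0 ltW.
- by move=> i; rewrite invr_ge0 ltW.
- by move=> i; rewrite divr_ge0 ?sqr_ge0// invr_ge0 ltW.
have -> : \sum_(0 <= i < N) (cc i)^-1 =
    \sum_(0 <= i < N) (c (inord i) (inord i.+1))^-1.
  by apply: eq_big_nat => i /andP[_ iN]; rewrite /cc iN.
apply: ler_wpM2l; first by rewrite !big_nat sumr_ge0// => i _; rewrite invr_ge0.
apply: le_trans (nearest_neighbour_energy v); rewrite le_eqVlt; apply/orP; left.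
apply/eqP; apply: eq_big_nat => i /andP[_ iN].
by rewrite /cc iN invrK mulrC.
Qed.

End path_resistance.

(** * Measure-theoretic tools *)

Section measurable_predicates.
Context d (T : measurableType d) (R : realType).
Implicit Types P : T -> Prop.

Lemma measurable_exists (I : countType) (P : I -> T -> Prop) :
  (forall i, measurable [set x | P i x]) -> measurable [set x | exists i, P i x].
Proof.
move=> mP; rewrite (_ : mkset _ = \bigcup_i [set x | P i x]).
  by apply: countable_bigcupT_measurable => //; exact: countableP.
by apply/seteqP; split => [x [i Pi]|x [i _ Pi]]; exists i.
Qed.

Lemma measurable_not P : measurable [set x | P x] -> measurable [set x | ~ P x].
Proof. exact: measurableC. Qed.

Lemma measurable_forall (I : countType) (P : I -> T -> Prop) :
  (forall i, measurable [set x | P i x]) -> measurable [set x | forall i, P i x].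
Proof.
move=> mP; rewrite (_ : mkset _ = [set x | ~ exists i, ~ P i x]).
  by apply/measurable_not/measurable_exists => i; exact/measurable_not.
apply/seteqP; split => x /=.
  by move=> H [i Pi]; exact: Pi (H i).
by move/forallNP => H i; exact: contrapT.
Qed.

Lemma measurable_and P Q : measurable [set x | P x] -> measurable [set x | Q x] ->
  measurable [set x | P x /\ Q x].
Proof. exact: measurableI. Qed.

Lemma measurable_or P Q : measurable [set x | P x] -> measurable [set x | Q x] ->
  measurable [set x | P x \/ Q x].
Proof. exact: measurableU. Qed.

Lemma measurable_constant (Q : Prop) : measurable [set _ : T | Q].
Proof.
have [q|q] := pselect Q.
  by rewrite (_ : mkset _ = setT)//; apply/seteqP; split.
by rewrite (_ : mkset _ = set0)//; apply/seteqP; split.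
Qed.

Lemma measurable_imp P Q : measurable [set x | P x] -> measurable [set x | Q x] ->
  measurable [set x | P x -> Q x].
Proof.
move=> mP mQ; rewrite (_ : mkset _ = [set x | ~ P x \/ Q x]).
  exact/measurable_or/mQ/measurable_not.
apply/seteqP; split => x /= H; last by move=> p; case: H.
by have [p|] := pselect (P x); [right; exact: H|left].
Qed.

Lemma measurable_le (f g : T -> R) : measurable_fun setT f ->
  measurable_fun setT g -> measurable [set x | f x <= g x].
Proof.
move=> mf mg; have := @measurable_fun_ler _ _ _ setT f g mf mg measurableT [set true].
by move=> /(_ I); rewrite setTI; apply.
Qed.

Lemma measurable_lt (f g : T -> R) : measurable_fun setT f ->
  measurable_fun setT g -> measurable [set x | f x < g x].
Proof.
move=> mf mg; rewrite (_ : mkset _ = [set x | ~ g x <= f x]).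
  exact/measurable_not/measurable_le.
by apply/seteqP; split=> x /=; rewrite ltNge => /negP.
Qed.

Lemma measurable_eq (f g : T -> R) : measurable_fun setT f ->
  measurable_fun setT g -> measurable [set x | f x = g x].
Proof.
move=> mf mg; rewrite (_ : mkset _ = [set x | f x <= g x /\ g x <= f x]).
  by apply: measurable_and; exact: measurable_le.
apply/seteqP; split=> x /=.
  by move=> ->.
by move=> [fg gf]; apply/eqP; rewrite eq_le fg.
Qed.

End measurable_predicates.

Section expectation_tools.
Context d (T : measurableType d) (R : realType).
Variable mu : {measure set T -> \bar R}.
Local Open Scope ereal_scope.

(* The integral of any nonnegative function, measurable or not, is the supremum
   of the integrals of the simple functions below it. *)
Lemma le_integral_nonneg (f g : T -> \bar R) : (forall x, 0 <= f x) ->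
  (forall x, f x <= g x) -> \int[mu]_x f x <= \int[mu]_x g x.
Proof.
move=> f0 fg; have g0 x : 0 <= g x := le_trans (f0 x) (fg x).
rewrite !ge0_integralTE//; apply: le_ereal_sup => _ [h hf <-].
by exists h => // x; exact: le_trans (hf x) (fg x).
Qed.

Lemma integral_sum_indic (I : Type) (s : seq I) (a : I -> R) (A : I -> set T) :
  (forall i, 0 <= a i)%R -> (forall i, measurable (A i)) ->
  \int[mu]_x (\sum_(i <- s) a i * \1_(A i) x)%R%:E = \sum_(i <- s) (a i)%:E * mu (A i).
Proof.
move=> a0 mA.
under eq_integral do rewrite -sumEFin.
rewrite ge0_integral_sum//.
- apply: eq_bigr => i _; under eq_integral do rewrite EFinM.
  rewrite ge0_integralZl_EFin//.
    by rewrite integral_indic// setIT.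
  by apply/measurable_EFinP; exact: measurable_indic.
- by move=> i; apply/measurable_EFinP; apply: measurable_funM.
- by move=> i x _; rewrite lee_fin mulr_ge0.
Qed.

End expectation_tools.

Section second_moment.
Context d (T : measurableType d) (R : realType).
Variable mu : probability T R.

(** Chebyshev at half of M = m p, integrated from the pointwise inequality 1_A M^2 / 4 + 2 M Z <=
    Z^2 + M^2, so that only the probabilities of the E_i and of their pairwise intersections enter.
    The slack [eta] serves events slightly less likely than p, such as long holding times of a walk
    that may be killed. *)
Lemma second_moment_lower_tail (m : nat) (E : 'I_m -> set T) (p eta : R) :
  (0 < m)%N -> 0 < p -> (forall i, measurable (E i)) ->
  (forall i, (mu (E i) <= p%:E)%E) ->
  (forall i, ((p * (1 - eta))%:E <= mu (E i))%E) ->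
  (forall i j, i != j -> (mu (E i `&` E j) <= (p ^+ 2)%:E)%E) ->
  (mu [set x | (\sum_(i < m) \1_(E i) x <= m%:R * p / 2)%R]
    <= (4 / (m%:R * p) + 8 * eta)%:E)%E.
Proof.
move=> m0 p0 mE Ep pE EEp; set A := mkset _.
pose M : R := m%:R * p.
have M0 : 0 < M by rewrite mulr_gt0// ltr0n.
have mA : measurable A.
  apply: measurable_le => //; apply: measurable_sum => i; exact: measurable_indic.
pose Ei i := fine (mu (E i)).
have EiE i : mu (E i) = (Ei i)%:E by rewrite fineK// fin_num_measure.
pose Eij i j := fine (mu (E i `&` E j)).
have mEE i j : measurable (E i `&` E j) by exact: measurableI.
have EijE i j : mu (E i `&` E j) = (Eij i j)%:E by rewrite fineK// fin_num_measure.
pose a := fine (mu A).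
have aE : mu A = a%:E by rewrite fineK// fin_num_measure.
(* [None] indexes the extra term: the indicator of [A] on the left, the constant M^2 on the
   right. *)
pose w (k : option 'I_m) : R := if k is Some i then 2 * M else M ^+ 2 / 4.
pose W (k : option 'I_m) := if k is Some i then E i else A.
pose w' (k : option ('I_m * 'I_m)) : R := if k is Some i then 1 else M ^+ 2.
pose W' (k : option ('I_m * 'I_m)) : set T :=
  if k is Some i then E i.1 `&` E i.2 else setT.
have key : (\int[mu]_x (\sum_(k : option 'I_m) w k * \1_(W k) x)%:E <=
  \int[mu]_x (\sum_(k : option ('I_m * 'I_m)) w' k * \1_(W' k) x)%:E)%E.
  apply: le_integral_nonneg => x.
    rewrite lee_fin sumr_ge0// => -[i|] _; rewrite mulr_ge0//=.
      by rewrite mulr_ge0 ?ltW.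
    by rewrite divr_ge0 ?sqr_ge0.
  rewrite lee_fin.
  have sum_opt (I : finType) (f : option I -> R) :
      \sum_k f k = f None + \sum_i f (Some i).
    rewrite (bigD1 None)//=; congr (_ + _).
    rewrite (reindex_omap Some id) => [|[i|]]//=; apply: eq_bigl => i.
    by rewrite eqxx.
  rewrite !sum_opt /= -mulr_sumr.
  have -> : \sum_(i : 'I_m * 'I_m) 1 * \1_(E i.1 `&` E i.2) x =
     (\sum_i \1_(E i) x) ^+ 2 :> R.
    rewrite expr2 big_distrlr/= pair_bigA/=; apply: eq_bigr => -[i j] _ /=.
    by rewrite mul1r indicI.
  set Z := \sum_i _; rewrite [\1_setT x]indicE in_setT mulr1.
  have : 0 <= (Z - M) ^+ 2 by exact: sqr_ge0.
  rewrite indicE; case: (boolP (x \in A)) => xA; last by rewrite mulr0; nra.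
  rewrite inE /A /= -/Z -/M in xA; rewrite mulr1 => _.
  have : 0 <= (M / 2 - Z) * ((M / 2 - Z) + M).
    by rewrite mulr_ge0// ?subr_ge0// addr_ge0 ?subr_ge0// ltW.
  nra.
have w0 k : 0 <= w k.
  by case: k => [i|] /=; [rewrite mulr_ge0// ltW|rewrite divr_ge0// sqr_ge0].
have w'0 k : 0 <= w' k by case: k => [i|] //=; rewrite sqr_ge0.
have mW k : measurable (W k) by case: k.
have mW' k : measurable (W' k) by case: k => [i|]//=.
rewrite !integral_sum_indic// in key.
have sum_opt (I : finType) (f : option I -> \bar R) :
    (\sum_k f k = f None + \sum_i f (Some i))%E.
  rewrite (bigD1 None)//=; congr (_ + _)%E.
  rewrite (reindex_omap Some id) => [|[i|]]//=; apply: eq_bigl => i.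
  by rewrite eqxx.
rewrite !sum_opt /= probability_setT mule1 aE -EFinM in key.
move: key; rewrite (eq_bigr (fun i => (2 * M * Ei i)%:E)); last first.
  by move=> i _; rewrite EiE.
rewrite [X in (_ <= _ + X)%E -> _](eq_bigr (fun i => (Eij i.1 i.2)%:E)); last first.
  by move=> i _; rewrite EijE mul1e.
rewrite !sumEFin -!EFinD lee_fin aE lee_fin => key.
have s1 : m%:R * (p * (1 - eta)) <= \sum_i Ei i.
  rewrite mulr_natl -[X in _ *+ X]card_ord -sumr_const; apply: ler_sum => i _.
  by rewrite -lee_fin -EiE.
have s2 : \sum_(i : 'I_m * 'I_m) Eij i.1 i.2 <= M + M ^+ 2.
  rewrite -(pair_bigA _ (fun i j => Eij i j))/=.
  apply: le_trans (_ : \sum_(i < m) (p + m%:R * p ^+ 2) <= _).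
    apply: ler_sum => i _; rewrite (bigD1 i)//= lerD//.
      by rewrite -lee_fin -EijE setIid.
    apply: le_trans (_ : \sum_(j < m) p ^+ 2 <= _); last first.
      by rewrite sumr_const card_ord mulr_natl.
    rewrite big_mkcond; apply: ler_sum => j _; case: ifPn => [ji|_].
      by rewrite -lee_fin -EijE EEp// eq_sym.
    exact: sqr_ge0.
  rewrite sumr_const card_ord -mulr_natl /M le_eqVlt; apply/orP; left; apply/eqP.
  by ring.
rewrite -mulr_sumr in key.
have s1' : M * (1 - eta) <= \sum_i Ei i by rewrite /M -mulrA.
have s3 : 2 * M * (M * (1 - eta)) <= 2 * M * \sum_i Ei i.
  by rewrite ler_wpM2l// mulr_ge0// ltW.
have : M ^+ 2 / 4 * a <= M + M ^+ 2 * 2 * eta by move: key s3 s2; lra.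
move=> H; rewrite -(ler_pM2l (x := M ^+ 2 / 4)); last first.
  by rewrite divr_gt0// exprn_gt0.
apply: le_trans H _; rewrite -/M le_eqVlt; apply/orP; left; apply/eqP.
by field; rewrite gt_eqF.
Qed.

End second_moment.

(** * Path probabilities of the walk *)

Section path_measure.
Context d (O : measurableType d) (R : realType).
Variable mu : {measure set O -> \bar R}.
Variables (Y H : nat -> O -> R) (D : set R) (L : (R -> R) -> R -> R).
Hypothesis mY : forall l, measurable_fun setT (Y l).
Hypothesis mH : forall l, measurable_fun setT (H l).
Hypothesis boxE : forall (k : nat) (x u : nat -> R),
  (forall l, D (x l)) -> (forall l, 0 <= u l) ->
  mu [set o | forall l, (l <= k)%N -> Y l o = x l /\ u l < H l o] =
  ((x 0%N == 0)%:R * (\prod_(l < k) jump_prob L (x l) (x l.+1))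
   * \prod_(l < k.+1) expR (- exit_rate L (x l) * u l))%:E.
Variables (N : nat) (st : 'I_N -> R) (c : 'I_N -> 'I_N -> R) (pi : 'I_N -> R).
Variable o0 : 'I_N.
Hypothesis st_inj : injective st.
Hypothesis st_o0 : st o0 = 0.
Hypothesis Dst : forall i, D (st i).
Hypothesis exit1 : forall i, exit_rate L (st i) = 1.
Hypothesis jumpE : forall i j, jump_prob L (st i) (st j) = c i j / pi i.

Definition path_event (A : pred 'I_N) (k : nat) (u : nat -> R) : set O :=
  [set o | forall l, (l <= k)%N -> (exists i, A i /\ Y l o = st i) /\ u l < H l o].

Lemma measurable_path_event A k u : measurable (path_event A k u).
Proof.
apply: measurable_forall => l; apply: measurable_imp; first exact: measurable_constant.
apply: measurable_and; last exact: measurable_lt.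
apply: measurable_exists => i; apply: measurable_and; first exact: measurable_constant.
exact: measurable_eq.
Qed.

(** [boxE] only knows single trajectories. Fixing the first i + 1 states to [f] and leaving the next
    j free in [A] allows an induction on j that sums over one state at a time. *)
Let prefixed (A : pred 'I_N) (u : nat -> R) (f : nat -> 'I_N) i j : set O :=
  [set o | (forall l, (l <= i)%N -> Y l o = st (f l) /\ u l < H l o) /\
    (forall l, (i < l <= i + j)%N -> (exists y, A y /\ Y l o = st y) /\ u l < H l o)].

Let measurable_prefixed A u f i j : measurable (prefixed A u f i j).
Proof.
apply: measurable_and; apply: measurable_forall => l; apply: measurable_imp;
    try exact: measurable_constant.
  by apply: measurable_and; [exact: measurable_eq|exact: measurable_lt].
apply: measurable_and; last exact: measurable_lt.
apply: measurable_exists => y; apply: measurable_and; first exact: measurable_constant.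
exact: measurable_eq.
Qed.

(** [restricted_prob] without the indicator at the starting point, which is already fixed as the
    last state of the prefix. *)
Let tail A j x : R :=
  if j is j'.+1 then \sum_y c x y / pi x * restricted_prob c pi A j' y else 1.

Let tailE A j x : restricted_prob c pi A j x = (A x)%:R * tail A j x.
Proof. by case: j => [|j]; rewrite /= ?mulr1. Qed.

Let prefixedE A u f i j : (forall l, 0 <= u l) ->
  mu (prefixed A u f i j) =
  ((f 0%N == o0)%:R * (\prod_(l < i) (c (f l) (f l.+1) / pi (f l)))
    * tail A j (f i) * \prod_(l < (i + j).+1) expR (- u l))%:E.
Proof.
move=> u0; elim: j i f => [|j IH] i f.
  rewrite addn0 mulr1 -[prefixed A u f i 0](_ :
    [set o | forall l, (l <= i)%N -> Y l o = st (f l) /\ u l < H l o] = _); last first.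
    apply/seteqP; split => o; last by case.
    by split=> // l; rewrite addn0; case: ltngtP.
  rewrite (@boxE i (fun l => st (f l)) u)//.
  rewrite -st_o0 (inj_eq st_inj); congr (_ * _ * _)%:E.
    by apply: eq_bigr => l _; rewrite jumpE.
  by apply: eq_bigr => l _; rewrite exit1 mulN1r.
pose upd y l := if l == i.+1 then y else f l.
have -> : prefixed A u f i j.+1 =
   \big[setU/set0]_(y < N | A y) prefixed A u (upd y) i.+1 j.
  rewrite -(bigcup_pred A); apply/seteqP; split => o /=.
    move=> [h1 h2]; have [|[y [Ay Yy]] uy] := h2 i.+1; first by lia.
    exists y => //; split => l.
      rewrite leq_eqVlt ltnS /upd => /predU1P[->|li]; first by rewrite eqxx.
      by rewrite ltn_eqF ?ltnS//; exact: h1.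
    by move=> li; apply: h2; lia.
  move=> [y Ay [h1 h2]]; split => l.
    by move=> li; have := h1 l; rewrite /upd ltn_eqF ?ltnS//; apply; lia.
  move=> li; have [l1|l1] := eqVneq l i.+1; last by apply: h2; lia.
  rewrite l1; have [|Yi ui] := h1 i.+1; first by [].
  by split=> //; exists y; rewrite Yi /upd eqxx.
rewrite measure_bigsetU_ord_cond; last 2 first.
- by move=> y _; exact: measurable_prefixed.
- move=> y y' _ _ [q [[h1 _] [h2 _]]].
  have [+ _] := h1 i.+1 (leqnn _); have [-> _] := h2 i.+1 (leqnn _).
  by rewrite /upd eqxx => /st_inj.
rewrite (eq_bigr _ (fun y _ => IH i.+1 (upd y))).
rewrite sumEFin; congr EFin.
rewrite [tail A j.+1 _]/= [in RHS]mulrAC mulr_sumr big_mkcond; apply: eq_bigr => y _.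
rewrite tailE addSnnS /upd /= big_ord_recr /= eqxx ltn_eqF//.
have -> : \prod_(l < i) (c (if (l : nat) == i.+1 then y else f l)
     (if l.+1 == i.+1 then y else f l.+1) /
   pi (if (l : nat) == i.+1 then y else f l)) =
   \prod_(l < i) (c (f l) (f l.+1) / pi (f l)).
  apply: eq_bigr => l _; have li := ltn_ord l.
  by rewrite !ltn_eqF// ltnS ltnW.
by case: (A y) => /=; rewrite ?mul1r ?mul0r ?mulr0//; ring.
Qed.

Lemma path_eventE A k u : (forall l, 0 <= u l) ->
  mu (path_event A k u) =
  (restricted_prob c pi A k o0 * \prod_(l < k.+1) expR (- u l))%:E.
Proof.
move=> u0.
have -> : path_event A k u =
    \big[setU/set0]_(y < N | A y) prefixed A u (fun=> y) 0 k.
  rewrite -(bigcup_pred A); apply/seteqP; split => o /=.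
    move=> h; have [[y [Ay Yy]] uy] := h 0%N (leq0n _).
    exists y => //; split => l; first by rewrite leqn0 => /eqP ->.
    by move=> /andP[_ lk]; exact: h.
  move=> [y Ay [h1 h2]] [|l] lk; last exact: h2.
  by have [Yi ui] := h1 0%N (leqnn _); split => //; exists y.
rewrite measure_bigsetU_ord_cond; last 2 first.
- by move=> y _; exact: measurable_prefixed.
- move=> y y' _ _ [q [[h1 _] [h2 _]]].
  have [+ _] := h1 0%N (leqnn _); have [-> _] := h2 0%N (leqnn _).
  by move=> /st_inj.
rewrite (eq_bigr _ (fun y _ => prefixedE A (fun=> y) 0 k u0)).
under eq_bigr do rewrite big_ord0 mulr1.
rewrite sumEFin; congr EFin; rewrite -mulr_suml; congr (_ * _).
rewrite tailE big_mkcond (bigD1 o0)//= eqxx mul1r [X in _ + X]big1 ?addr0.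
  by case: (A o0); rewrite ?mul1r ?mul0r.
by move=> y /negbTE yo; rewrite yo mul0r if_same.
Qed.

End path_measure.

(** * Running extrema of right-continuous paths and of jump paths *)

Section running_extrema.
Variable R : realType.

Lemma running_infE (f : R -> R) (T : R) :
  running_inf f T = - running_sup (fun s => - f s) T.
Proof.
rewrite /running_inf /inf /running_sup; congr (- sup _).
apply/seteqP; split => [_ [_ [s sT <-] <-]|_ [s sT <-]]; first by exists s.
by exists (f s) => //; exists s.
Qed.

(** Rational times clamped to [0, T]. The right end needs its own index [None]: right continuity
    transfers bounds from the rationals to every time except T. *)
Let sample (T : R) (q : option rat) : R :=
  if q is Some q then Num.min (Num.max (ratr q) 0) T else T.

Let sample_itv (T : R) q : 0 <= T -> sample T q \in `[0, T].
Proof.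
move=> T0; rewrite in_itv /=; case: q => [q|] /=; last by rewrite T0 lexx.
by rewrite le_min ge_min lexx orbT T0 !andbT le_max lexx orbT.
Qed.

Let sample_bound (f : R -> R) (T c : R) : 0 <= T ->
  (forall t, 0 <= t -> f s @[s --> t^'+] --> f t) ->
  (forall q, f (sample T q) <= c) -> forall s, s \in `[0, T] -> f s <= c.
Proof.
move=> T0 fr fq s; rewrite in_itv /= => /andP[s0]; rewrite le_eqVlt.
move=> /predU1P[->|sT]; first exact: (fq None).
rewrite leNgt; apply/negP => cf.
have : \forall r \near s^'+, c < f r by apply: (cvgr_gt (f s) (fr _ s0)).
rewrite near_withinE /= => /nbhs_ballP[e /= e0 He].
have [|q /andP[q1 q2]] := @rat_in_itvoo R s (Num.min T (s + e)).
  by rewrite lt_min sT ltrDl.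
have : c < f (sample T (Some q)).
  have -> : sample T (Some q) = ratr q.
    rewrite /= (max_l (ltW (le_lt_trans s0 q1))) min_l// ltW//.
    by apply: lt_le_trans q2 _; rewrite ge_min lexx.
  apply: He => //; rewrite /ball /= distrC ger0_norm ?subr_ge0 ?ltW//.
  by rewrite ltrBlDl (lt_le_trans q2)// ge_min lexx orbT.
by rewrite ltNge fq.
Qed.

Section measurability.
Context d (O : measurableType d) (X : R -> O -> R) (T : R).
Hypothesis T0 : 0 <= T.
Hypothesis mX : forall t, 0 <= t -> measurable_fun setT (X t).
Hypothesis rcX : forall o t, 0 <= t -> X s o @[s --> t^'+] --> X t o.

Lemma measurable_running_sup_eq b :
  measurable [set o | running_sup (X ^~ o) T = b].
Proof.
have sE o c : (forall q, X (sample T q) o <= c) <->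
    (forall s, s \in `[0, T] -> X s o <= c).
  split=> [|h q]; last by apply: h; exact: sample_itv.
  by apply: sample_bound => // t t0; exact: rcX.
(* The second alternative is the default value 0 of [sup] on an unbounded set, which right
   continuity does not exclude. *)
rewrite (_ : mkset _ = [set o |
   ((exists n : nat, forall q, X (sample T q) o <= n%:R) /\
    (forall q, X (sample T q) o <= b) /\
    (forall m : nat, exists q, b - m.+1%:R^-1 < X (sample T q) o)) \/
   (~ (exists n : nat, forall q, X (sample T q) o <= n%:R) /\ b = 0)]).
  have mq q : measurable_fun setT (X (sample T q)).
    by apply: mX; have := sample_itv q T0; rewrite in_itv /= => /andP[].
  have mB : measurable [set o | exists n : nat, forall q, X (sample T q) o <= n%:R].
    apply: measurable_exists => n; apply: measurable_forall => q.
    exact: measurable_le.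
  apply: measurable_or; apply: measurable_and => //.
  - apply: measurable_and.
      by apply: measurable_forall => q; exact: measurable_le.
    apply: measurable_forall => m; apply: measurable_exists => q.
    exact: measurable_lt.
  - exact: measurable_not.
  - exact: measurable_constant.
apply/seteqP; split => o /=; rewrite /running_sup; set A := [set _ | _ in _].
  have A0 : A !=set0 by exists (X 0 o); exists 0 => //; rewrite /= in_itv /= lexx.
  have [[n bn]|nb] := pselect (exists n : nat, forall q, X (sample T q) o <= n%:R).
    have hA : has_sup A.
      by split=> //; exists n%:R => _ [s sT <-]; move/sE : bn; apply.
    move=> <-; left; split; first by exists n.
    split=> [q|m].
      by apply: sup_upper_bound => //; exists (sample T q) => //; exact: sample_itv.
    have : 0 < m.+1%:R^-1 :> R by rewrite invr_gt0.
    move=> /sup_adherent/(_ hA)[_ [s sT <-]] h.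
    apply: contrapT => /forallNP H; move: h; apply/negP; rewrite -leNgt.
    by move: s sT; apply/sE => q; rewrite leNgt; apply/negP/H.
  move=> <-; right; split => //; rewrite sup_out// => -[_ [M AM]]; apply: nb.
  have [n Mn] : exists n : nat, M <= n%:R.
    exists (Num.truncn `|M|).+1; apply: le_trans (ler_norm _) _.
    by rewrite ltW// truncnS_gt.
  exists n; apply/sE => s sT; apply: le_trans Mn; apply: AM; by exists s.
case=> [[[n bn] [bb bm]]|[nb ->]].
  have A0 : A !=set0 by exists (X 0 o); exists 0 => //; rewrite /= in_itv /= lexx.
  have hA : has_sup A.
    by split=> //; exists n%:R => _ [s sT <-]; move/sE : bn; apply.
  apply/eqP; rewrite eq_le; apply/andP; split.
    by apply: ge_sup => // _ [s sT <-]; move/sE : bb; apply.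
  apply/ler_addgt0Pl => e e0.
  have [m me] : exists m : nat, m.+1%:R^-1 <= e.
    exists (Num.truncn e^-1); rewrite -[leRHS]invrK lef_pV2 ?posrE ?invr_gt0//.
    by rewrite ltW// truncnS_gt.
  have [q bq] := bm m.
  have : X (sample T q) o <= sup A.
    by apply: sup_upper_bound => //; exists (sample T q) => //; exact: sample_itv.
  move: bq me; move: (m.+1%:R^-1) (sup A) (X _ o) => u1 u2 u3 h1 h2 h3.
  rewrite -lerBlDl; apply: le_trans h3; apply: le_trans (ltW h1).
  by rewrite lerD2l lerN2.
rewrite sup_out// => -[_ [M AM]]; apply: nb.
exists (Num.truncn `|M|).+1; apply/sE => s sT.
apply: le_trans (_ : M <= _); first by apply: AM; exists s.
by apply: le_trans (ler_norm _) _; rewrite ltW// truncnS_gt.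
Qed.

End measurability.

Lemma measurable_running_inf_eq d (O : measurableType d) (X : R -> O -> R) (T : R) b :
  0 <= T -> (forall t, 0 <= t -> measurable_fun setT (X t)) ->
  (forall o t, 0 <= t -> X s o @[s --> t^'+] --> X t o) ->
  measurable [set o | running_inf (X ^~ o) T = b].
Proof.
move=> T0 mX rcX; rewrite (_ : mkset _ =
    [set o | running_sup ((fun t o => - X t o) ^~ o) T = - b]).
  apply: measurable_running_sup_eq => //.
    by move=> t t0; exact/measurable_funN/mX.
  by move=> o t t0; apply: cvgN; exact: rcX.
by apply/seteqP; split => o /=; rewrite running_infE; [move=> <-; rewrite opprK|move=> ->; rewrite opprK].
Qed.

Section jump_path.
Variables (X : R -> R) (Y H : nat -> R) (T lo hi : R) (K1 K2 : nat).
Hypothesis XE : forall k t,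
  \sum_(l < k) H l <= t < \sum_(l < k.+1) H l -> X t = Y k.
Hypothesis Y_itv : forall l, (l <= K2)%N -> lo <= Y l <= hi.
Hypothesis H_gt0 : forall l, (l <= K2)%N -> 0 < H l.
Hypothesis K12 : (K1 <= K2)%N.
Hypothesis early : \sum_(l < K1) H l <= T.
Hypothesis late : T < \sum_(l < K2.+1) H l.
Hypothesis hit_hi : exists2 k, (k <= K1)%N & Y k = hi.
Hypothesis hit_lo : exists2 k, (k <= K1)%N & Y k = lo.

(** [late] bounds the jump index at any time up to T by K2, and up to that index the positions are
    confined. *)
Let visited_range s : s \in `[0, T] -> lo <= X s <= hi.
Proof.
rewrite in_itv /= => /andP[s0 sT].
have ex : exists k, s < \sum_(l < k.+1) H l.
  by exists K2; exact: le_lt_trans late.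
have [k ks kmin] := ex_minnP ex.
have kK : (k <= K2)%N by apply: kmin; exact: le_lt_trans late.
rewrite (@XE k) ?Y_itv// ks andbT.
case: k ks kmin {kK} => [|k] ks kmin; first by rewrite big_ord0.
by rewrite leNgt; apply/negP => /kmin; rewrite ltnn.
Qed.

Let visited k : (k <= K1)%N -> exists2 s, s \in `[0, T] & X s = Y k.
Proof.
move=> kK; exists (\sum_(l < k) H l); last first.
  by apply: XE; rewrite lexx big_ord_recr /= ltrDl H_gt0// (leq_trans kK).
have H0 l : (l < K1)%N -> 0 <= H l.
  by move=> lK; rewrite ltW// H_gt0// (leq_trans (ltnW lK)).
rewrite in_itv /=; apply/andP; split.
  by apply: sumr_ge0 => l _; rewrite H0// (leq_trans (ltn_ord l)).
apply: le_trans early; rewrite -!(big_mkord xpredT H) (big_cat_nat (leq0n k) kK)/=.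
by rewrite lerDl big_nat sumr_ge0// => l /andP[_ lK]; exact: H0.
Qed.

Lemma running_sup_jump_path : running_sup X T = hi.
Proof.
have [k kK Yk] := hit_hi; have [s sT Xs] := visited kK.
have hA : has_sup [set X s | s in `[0, T]].
  by split; [exists (X s); exists s|exists hi => _ [r rT <-]; have /andP[] := visited_range rT].
apply/eqP; rewrite eq_le; apply/andP; split.
  by apply: ge_sup; [case: hA|move=> _ [r rT <-]; have /andP[] := visited_range rT].
by apply: sup_upper_bound => //; exists s => //; rewrite Xs.
Qed.

Lemma running_inf_jump_path : running_inf X T = lo.
Proof.
have [k kK Yk] := hit_lo; have [s sT Xs] := visited kK.
have hA : has_inf [set X s | s in `[0, T]].
  by split; [exists (X s); exists s|exists lo => _ [r rT <-]; have /andP[] := visited_range rT].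
apply/eqP; rewrite eq_le; apply/andP; split.
  by apply: ge_inf => //; [case: hA|exists s => //; rewrite Xs].
by apply: lb_le_inf; [case: hA|move=> _ [r rT <-]; have /andP[] := visited_range rT].
Qed.

End jump_path.
End running_extrema.

Lemma measure_bigsetU_le d (T : measurableType d) (R : realType)
    (mu : {measure set T -> \bar R}) (n : nat) (A : nat -> set T) (a : R) :
  (forall i, measurable (A i)) -> (forall i, (mu (A i) <= a%:E)%E) ->
  (mu (\big[setU/set0]_(i < n) A i) <= (n%:R * a)%:E)%E.
Proof.
move=> mA Aa; elim: n => [|n IH]; first by rewrite big_ord0 measure0 mul0r.
rewrite big_ord_recr /=.
apply: le_trans (measureU2 _ _ (mA n)) _; first exact: bigsetU_measurable.
apply: le_trans (leeD IH (Aa n)) _.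
by rewrite -EFinD lee_fin -natr1 mulrDl mul1r.
Qed.

(** * From survival and hitting to the law of the extrema *)

Section quenched_estimate.
Context d (O : measurableType d) (R : realType).
Variable mu : probability O R.
Variables (X : R -> O -> R) (Y H : nat -> O -> R) (D : set R) (L : (R -> R) -> R -> R).
Hypothesis mX : forall t, 0 <= t -> measurable_fun setT (X t).
Hypothesis rcX : forall o t, 0 <= t -> X s o @[s --> t^'+] --> X t o.
Hypothesis mY : forall l, measurable_fun setT (Y l).
Hypothesis mH : forall l, measurable_fun setT (H l).
Hypothesis boxE : forall (k : nat) (x u : nat -> R),
  (forall l, D (x l)) -> (forall l, 0 <= u l) ->
  mu [set o | forall l, (l <= k)%N -> Y l o = x l /\ u l < H l o] =
  ((x 0%N == 0)%:R * (\prod_(l < k) jump_prob L (x l) (x l.+1))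
   * \prod_(l < k.+1) expR (- exit_rate L (x l) * u l))%:E.
Hypothesis XE : {ae mu, forall o, forall (k : nat) (t : R),
  \sum_(l < k) H l o <= t < \sum_(l < k.+1) H l o -> X t o = Y k o}.
Variables (N : nat) (st : 'I_N -> R) (c : 'I_N -> 'I_N -> R) (pi : 'I_N -> R).
Variable o0 : 'I_N.
Hypothesis st_inj : injective st.
Hypothesis st_o0 : st o0 = 0.
Hypothesis Dst : forall i, D (st i).
Hypothesis exit1 : forall i, exit_rate L (st i) = 1.
Hypothesis jumpE : forall i j, jump_prob L (st i) (st j) = c i j / pi i.
Hypothesis c_ge0 : forall i j, 0 <= c i j.
Hypothesis pi_gt0 : forall i, 0 < pi i.
Hypothesis c_le : forall i, \sum_j c i j <= pi i.
Variables (lo hi : 'I_N) (T u : R) (K1 K2 : nat).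
Hypothesis st_itv : forall i, st lo <= st i <= st hi.
Hypothesis T0 : 0 <= T.
Hypothesis u0 : 0 <= u.
Hypothesis K12 : (K1 <= K2)%N.
Hypothesis K1u : K1%:R * u <= T.
Hypothesis TK2 : T <= K2.+1%:R * expR (- 1) / 2.

Let stay := restricted_prob c pi predT K2 o0.
Let avoid z := restricted_prob c pi (predC1 z) K1 o0.

(** With a threshold s at the index l and 0 elsewhere, a path event constrains the size of one
    holding time only and acquires exactly the factor exp (- s). *)
Let spike (s : R) (l : nat) (k : nat) : R := if k == l then s else 0.

Let prod_spike s l k : (l <= k)%N ->
  \prod_(i < k.+1) expR (- spike s l i) = expR (- s).
Proof.
move=> lk; rewrite (bigD1 (Ordinal (lk : (l < k.+1)%N)))//= /spike eqxx big1 ?mulr1//.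
by move=> i /negbTE; rewrite -val_eqE /= => ->; rewrite oppr0 expR0.
Qed.

Let ev A k v := path_event Y H st A k v.
Let mev A k v : measurable (ev A k v).
Proof. exact: measurable_path_event. Qed.

Let evE A k v : (forall l, 0 <= v l) ->
  mu (ev A k v) = (restricted_prob c pi A k o0 * \prod_(l < k.+1) expR (- v l))%:E.
Proof.
exact: (path_eventE mY mH boxE st_inj st_o0 Dst exit1 jumpE).
Qed.

Let ev0 A k : mu (ev A k (fun=> 0)) = (restricted_prob c pi A k o0)%:E.
Proof. by rewrite evE// big1 ?mulr1// => i _; rewrite oppr0 expR0. Qed.

Let ev_le A k (v : nat -> R) (b : R) : (forall l, 0 <= v l) ->
  restricted_prob c pi A k o0 * \prod_(l < k.+1) expR (- v l) <= b ->
  (mu (ev A k v) <= b%:E)%E.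
Proof. by move=> v0 vb; rewrite evE// lee_fin. Qed.

Let target := [set o | running_inf (X ^~ o) T = st lo /\ running_sup (X ^~ o) T = st hi].

Let mtarget : measurable target.
Proof.
apply: measurable_and; first exact: measurable_running_inf_eq.
exact: measurable_running_sup_eq.
Qed.

(** For a surviving walk off [few], more than K2.+1 exp (-1) / 2, hence more than T, of the holding
    times exceed 1, so T comes before the jump K2 + 1. Off [slow], the first K1 holding times add up
    to at most K1 u <= T. *)
Let longs l := ev predT K2 (spike 1 l).
Let few : set O :=
  [set o | \sum_(l < K2.+1) \1_(longs l) o <= K2.+1%:R * expR (- 1) / 2 :> R].
Let slow := \big[setU/set0]_(l < K1) ev predT K1 (spike u l).

Let spike_ge0 s l k : 0 <= s -> 0 <= spike s l k.
Proof. by rewrite /spike; case: ifP. Qed.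

Let mslow : measurable slow.
Proof. by apply: bigsetU_measurable => i _; exact: mev. Qed.

Let mfew : measurable few.
Proof.
apply: measurable_le => //; apply: measurable_sum => i.
by apply: measurable_indic; exact: mev.
Qed.

Let slow_le : (mu slow <= (K1%:R * expR (- u))%:E)%E.
Proof.
(* The union bound asks for an estimate at every index; truncating at K1 changes no index that
   occurs. *)
rewrite /slow; have -> : \big[setU/set0]_(l < K1) ev predT K1 (spike u l) =
   \big[setU/set0]_(l < K1) ev predT K1 (spike u (minn l K1)).
  by apply: eq_bigr => l _; rewrite (minn_idPl (ltnW (ltn_ord l))).
apply: (@measure_bigsetU_le _ _ _ _ _ (fun l => ev predT K1 (spike u (minn l K1)))) => // l.
apply: ev_le; first by move=> k; exact: spike_ge0.
rewrite prod_spike ?geq_minr// ler_piMl ?expR_ge0//.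
exact: restricted_prob_le1.
Qed.

(** A long holding time together with survival has probability stay * exp (-1), while two of them
    have stay * exp (-2), at most the square of p = exp (-1): this is the second moment bound with
    eta = 1 - stay. *)
Let few_le : (mu few <= (4 / (K2.+1%:R * expR (- 1)) + 8 * (1 - stay))%:E)%E.
Proof.
have s1 : stay <= 1 by exact: restricted_prob_le1.
have s0 : 0 <= stay by exact: restricted_prob_ge0.
have longE (l : 'I_K2.+1) : mu (longs l) = (stay * expR (- 1))%:E.
  rewrite /longs evE; last by move=> k; exact: spike_ge0.
  by rewrite prod_spike// -ltnS.
apply: second_moment_lower_tail => //.
- by move=> i; exact: mev.
- by move=> i; rewrite longE lee_fin ler_piMl// expR_ge0.
- by move=> i; rewrite longE opprB addrC subrK mulrC.
move=> i j ij.
have -> : longs i `&` longs j =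
   ev predT K2 (fun k => spike 1 i k + spike 1 j k).
  have ne (k : nat) : (k == i) && (k == j) = false.
    by apply/negbTE/andP => -[/eqP ki /eqP kj]; case/eqP: ij; apply: val_inj; rewrite /= -ki -kj.
  apply/seteqP; split => o.
    move=> [hi' hj] l lK; have [Yl Hi] := hi' l lK; have [_ Hj] := hj l lK.
    split=> //; move: Hi Hj (ne l); rewrite /spike.
    by case: eqP; case: eqP; rewrite ?addr0 ?add0r.
  move=> h; split=> l lK; have [Yl Hl] := h l lK; split=> //.
    by apply: le_lt_trans Hl; rewrite lerDl spike_ge0.
  by apply: le_lt_trans Hl; rewrite lerDr spike_ge0.
rewrite evE; last by move=> k; rewrite addr_ge0// spike_ge0.
rewrite (eq_bigr (fun k : 'I__ => expR (- spike 1 i k) * expR (- spike 1 j k))); last first.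
  by move=> k _; rewrite opprD expRD.
have iK : (i <= K2)%N by rewrite -ltnS.
have jK : (j <= K2)%N by rewrite -ltnS.
rewrite big_split /= (prod_spike 1 iK) (prod_spike 1 jK) lee_fin expr2 ler_piMl//.
Qed.

Let cover (N0 : set O) :
  (forall o, ~ N0 o -> forall (k : nat) (t : R),
     \sum_(l < k) H l o <= t < \sum_(l < k.+1) H l o -> X t o = Y k o) ->
  ev predT K2 (fun=> 0) `<=` target `|` (N0 `|` (ev (predC1 hi) K1 (fun=> 0) `|`
    (ev (predC1 lo) K1 (fun=> 0) `|` (slow `|` few)))).
Proof.
move=> hN o Po; apply: contrapT => /not_orP[ntg].
move=> /not_orP[/hN XYo] /not_orP[nhi] /not_orP[nlo] /not_orP[nslow nfew].
apply: ntg.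
have hit z : ~ ev (predC1 z) K1 (fun=> 0) o -> exists2 k, (k <= K1)%N & Y k o = st z.
  move=> nz; apply: contrapT => nk; apply: nz => l lK.
  have [[i [_ Yi]] Hl] := Po l (leq_trans lK K12); split=> //.
  exists i; split=> //; apply/eqP => iz; apply: nk; exists l => //.
  by rewrite Yi iz.
have Yitv l : (l <= K2)%N -> st lo <= Y l o <= st hi.
  by move=> /Po[[i [_ ->]] _].
have Hpos l : (l <= K2)%N -> 0 < H l o by move=> /Po[].
have early : \sum_(l < K1) H l o <= T.
  apply: le_trans K1u; rewrite mulr_natl -[X in _ *+ X]card_ord -sumr_const.
  apply: ler_sum => l _; rewrite leNgt; apply/negP => ul.
  apply: nslow; rewrite /slow -(bigcup_pred xpredT (fun i : 'I_K1 => ev predT K1 (spike u i))).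
  exists l => //=.
  move=> k kK; have [Yk Hk] := Po k (leq_trans kK K12); split => //.
  by rewrite /spike; case: eqP => // ->.
have late : T < \sum_(l < K2.+1) H l o.
  move/negP: nfew; rewrite -ltNge => fewP.
  apply: le_lt_trans TK2 _; apply: lt_le_trans fewP _.
  apply: ler_sum => l _; rewrite indicE.
  case: (boolP (o \in longs l)) => [|_].
    by rewrite inE => /(_ l); rewrite -ltnS ltn_ord => /(_ isT)[_]; rewrite /spike eqxx => /ltW.
  by rewrite ltW// Hpos// -ltnS.
split; first exact: (running_inf_jump_path XYo Yitv Hpos K12 early late (hit _ nlo)).
exact: (running_sup_jump_path XYo Yitv Hpos K12 early late (hit _ nhi)).
Qed.

(** The coefficient 9 is 1 for the killed walk itself plus 8 for the slack in [few_le]. *)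
Lemma quenched_estimate :
  ((1 - 9 * (1 - stay) - avoid hi - avoid lo - K1%:R * expR (- u)
    - 4 / (K2.+1%:R * expR (- 1)))%:E <=
  mu [set o | running_inf (X ^~ o) T = st lo /\ running_sup (X ^~ o) T = st hi])%E.
Proof.
case: XE => N0 [mN0 muN0 N0P].
have {}N0P o : ~ N0 o -> forall (k : nat) (t : R),
     \sum_(l < k) H l o <= t < \sum_(l < k.+1) H l o -> X t o = Y k o.
  by move=> nN; apply: contrapT => nP; apply: nN; exact: N0P.
rewrite -/target.
have mB1 := measurableU _ _ mslow mfew.
have mB2 := measurableU _ _ (mev (predC1 lo) K1 (fun=> 0)) mB1.
have mB3 := measurableU _ _ (mev (predC1 hi) K1 (fun=> 0)) mB2.
have mB4 := measurableU _ _ mN0 mB3.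
have : (mu (ev predT K2 (fun=> 0%R)) <= mu target + (mu N0 +
   (mu (ev (predC1 hi) K1 (fun=> 0%R)) + (mu (ev (predC1 lo) K1 (fun=> 0%R)) +
   (mu slow + mu few)))))%E.
  apply: le_trans (le_measure _ _ _ (cover N0P)) _; rewrite ?inE//.
    exact: measurableU.
  apply: le_trans (measureU2 _ mtarget mB4) _; rewrite leeD2l//.
  apply: le_trans (measureU2 _ mN0 mB3) _; rewrite leeD2l//.
  apply: le_trans (measureU2 _ _ mB2) _; rewrite ?leeD2l//.
  apply: le_trans (measureU2 _ _ mB1) _; rewrite ?leeD2l//.
  exact: measureU2.
rewrite muN0 add0e !ev0 -/stay -/(avoid _) -/(avoid _).
have -> : mu target = (fine (mu target))%:E by rewrite fineK// fin_num_measure.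
move=> h; have {}h := le_trans h (leeD2l _ (leeD2l _ (leeD2l _ (leeD slow_le few_le)))).
move: h; rewrite -!EFinD !lee_fin.
move: (fine (mu target)) (avoid hi) (avoid lo) (K1%:R * _) (4 / _) stay.
by move=> x1 x2 x3 x4 x5 x6 h; lra.
Qed.

End quenched_estimate.

(** * Absolutely convergent sums over the integers *)

Section sum_over_integers.
Variable R : realType.
Implicit Types g : int -> R.

Lemma sumZ_ge0E g : (forall j, 0 <= g j) ->
  sumZ g = fine (\esum_(j in [set: int]) (g j)%:E).
Proof.
move=> g0; rewrite /sumZ [X in _ - fine X]esum1 ?subr0.
  by congr fine; apply: eq_esum => j _; rewrite /funrpos /= max_l.
by move=> j _; rewrite /funrneg /= max_r// oppr_le0.
Qed.

Lemma sumZN g : (forall j, 0 <= g j) -> sumZ (fun j => - g j) = - sumZ g.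
Proof.
move=> g0; rewrite (sumZ_ge0E g0) /sumZ [X in fine X - _]esum1 ?sub0r.
  congr (- fine _); apply: eq_esum => j _.
  by rewrite /funrneg /= opprK max_l.
by move=> j _; rewrite /funrpos /= max_r// oppr_le0.
Qed.

Section bounded.
Variables (g : int -> R) (C : R).
Hypothesis g0 : forall j, 0 <= g j.
Hypothesis gC : forall s : seq int, uniq s -> \sum_(j <- s) g j <= C.

(** [fine] sends an infinite sum to 0, so finiteness has to come first, from a bound uniform over
    finite partial sums. *)
Let esum_le : (\esum_(j in [set: int]) (g j)%:E <= C%:E)%E.
Proof.
apply: ge_ereal_sup => _ [A [finA _] <-].
by rewrite fsbig_finite//= sumEFin lee_fin; apply: gC; exact: finmap.fset_uniq.
Qed.

Let esum_fin : (\esum_(j in [set: int]) (g j)%:E)%E \is a fin_num.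
Proof.
rewrite ge0_fin_numE ?(le_lt_trans esum_le) ?ltry//.
by apply: esum_ge0 => j _; rewrite lee_fin.
Qed.

Lemma sumZ_le : sumZ g <= C.
Proof. by rewrite sumZ_ge0E// -lee_fin fineK. Qed.

Lemma sumZ_ge s : uniq s -> \sum_(j <- s) g j <= sumZ g.
Proof.
move=> us; rewrite sumZ_ge0E// -lee_fin fineK//; apply: esum_ge.
exists [set` s]; first by split=> //; exact: finite_seq.
by rewrite -fsbig_seq//= sumEFin.
Qed.

End bounded.

Lemma sumZ_single g q : 0 <= g q -> (forall j, j != q -> g j = 0) -> sumZ g = g q.
Proof.
move=> gq gj.
have g0 j : 0 <= g j by have [->//|/gj ->] := eqVneq j q.
have gC (s : seq int) : uniq s -> \sum_(j <- s) g j <= g q.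
  move=> us; have [qs|qs] := boolP (q \in s).
    by rewrite (bigD1_seq q)//= big1 ?addr0.
  by rewrite big_seq big1// => j js; apply: gj; apply: contraNneq qs => <-.
apply/eqP; rewrite eq_le; apply/andP; split; first exact: sumZ_le gC.
by have := sumZ_ge g0 gC (s := [:: q]) isT; rewrite big_seq1.
Qed.

Lemma sumZ_scale g k C : 0 < k -> (forall j, 0 <= g j) ->
  (forall s : seq int, uniq s -> \sum_(j <- s) g j <= C) ->
  sumZ (fun j => g j * k) = sumZ g * k.
Proof.
move=> k0 g0 gC.
have h0 j : 0 <= g j * k by rewrite mulr_ge0// ltW.
have hC (s : seq int) : uniq s -> \sum_(j <- s) g j * k <= sumZ g * k.
  by move=> us; rewrite -mulr_suml ler_pM2r//; exact: sumZ_ge gC _ us.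
apply/eqP; rewrite eq_le; apply/andP; split; first exact: sumZ_le hC.
rewrite -ler_pdivlMr//; apply: sumZ_le => // s us.
rewrite ler_pdivlMr// mulr_suml; exact: sumZ_ge hC _ us.
Qed.

End sum_over_integers.

Section increasing_enumerations.
Variables (R : realType) (x : int -> R).
Hypothesis inc : forall i, x i < x (i + 1).

Lemma enum_lt i j : i < j -> x i < x j.
Proof.
move=> ij; have -> : j = i + (`|j - i|.-1.+1)%:Z by lia.
elim: (`|j - i|.-1)%N => [|k IH]; first exact: inc.
apply: lt_trans IH _; have -> : i + k.+2%:Z = i + k.+1%:Z + 1 by lia.
exact: inc.
Qed.

Lemma enum_ltE i j : (x i < x j) = (i < j).
Proof.
case: (ltgtP i j) => [/enum_lt ->//|/enum_lt ji|->]; last by rewrite ltxx.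
by rewrite ltNge (ltW ji).
Qed.

Lemma enum_leE i j : (x i <= x j) = (i <= j).
Proof. by rewrite leNgt enum_ltE -leNgt. Qed.

Lemma enum_inj : injective x.
Proof.
by move=> i j xij; apply/eqP; rewrite eq_le -!enum_leE xij lexx.
Qed.

End increasing_enumerations.

(** * Jump rates of Mott's walk *)

Section mott_chain.
Variables (R : realType) (alpha lambda : R) (x : int -> R).
Hypothesis inc : forall i, x i < x (i + 1).

Lemma conductance_ge0 (y z : R) : 0 <= conductance alpha lambda y z.
Proof. by rewrite /conductance; case: ifP => // _; exact: expR_ge0. Qed.

Lemma conductanceC (y z : R) :
  conductance alpha lambda y z = conductance alpha lambda z y.
Proof. by rewrite /conductance eq_sym distrC [y + z]addrC. Qed.

Section at_site.
Variables (p : int) (C : R).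
Hypothesis pC : forall s : seq int, uniq s ->
  \sum_(j <- s) conductance alpha lambda (x p) (x j) <= C.

Let g j := conductance alpha lambda (x p) (x j).
Let g0 j : 0 <= g j := conductance_ge0 _ _.

Lemma total_conductance_le : total_conductance alpha lambda x (x p) <= C.
Proof. exact: sumZ_le. Qed.

Lemma total_conductance_ge s : uniq s ->
  \sum_(j <- s) conductance alpha lambda (x p) (x j) <=
    total_conductance alpha lambda x (x p).
Proof. by move=> us; exact: (sumZ_ge g0 pC). Qed.

Lemma total_conductance_gt0 : 0 < total_conductance alpha lambda x (x p).
Proof.
apply: lt_le_trans (total_conductance_ge (s := [:: p + 1]) isT).
rewrite big_seq1 /conductance ifF ?expR_gt0//.
by apply/negbTE/eqP => /(enum_inj inc); lia.
Qed.

(** Applied to the indicator of x_p, the generator gives minus the sum of all jump probabilities;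
    the term j = p vanishes on both sides because its conductance is 0. *)
Lemma exit_rate_mott :
  exit_rate (mott_generator alpha lambda x) (x p) = 1.
Proof.
have t0 := total_conductance_gt0.
rewrite /exit_rate /mott_generator.
rewrite (_ : (fun j => _) = (fun j => - (g j * (total_conductance alpha lambda x (x p))^-1))).
  rewrite sumZN ?opprK; last by move=> j; rewrite divr_ge0// ltW.
  by rewrite (sumZ_scale (C := C))// ?invr_gt0// divff// gt_eqF.
apply/funext => j; rewrite [\1_[set x p] (x p)]indicE mem_set//.
rewrite /g indicE; have [<-|pj] := eqVneq p j.
  by rewrite mem_set// subrr mulr0 /conductance eqxx mul0r oppr0.
rewrite memNset ?sub0r ?mulrN1//= => /(enum_inj inc) jp.
by rewrite jp eqxx in pj.
Qed.

Lemma jump_prob_mott q :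
  jump_prob (mott_generator alpha lambda x) (x p) (x q) =
  conductance alpha lambda (x p) (x q) / total_conductance alpha lambda x (x p).
Proof.
have t0 := total_conductance_gt0.
rewrite /jump_prob exit_rate_mott divr1 /conductance.
rewrite [x p == _]eq_sym; case: ifPn => [_|qp]; first by rewrite mul0r.
rewrite /mott_generator.
rewrite (sumZ_single (q := q)); last 2 first.
- rewrite mulr_ge0 ?divr_ge0 ?conductance_ge0// ?(ltW t0)// !indicE mem_set//.
  rewrite memNset ?subr0//= => pq; by rewrite pq eqxx in qp.
- move=> j jq; rewrite !indicE memNset; last first.
    by move=> /= /(enum_inj inc) jq'; rewrite jq' eqxx in jq.
  rewrite memNset ?subrr ?mulr0//= => pq; by rewrite pq eqxx in qp.
rewrite !indicE mem_set// memNset ?subr0 ?mulr1; last first.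
  by move=> /= pq; rewrite pq eqxx in qp.
by rewrite /conductance eq_sym (negbTE qp).
Qed.

End at_site.
End mott_chain.

(** * Conductance estimates for Mott's walk *)

Lemma ler_sum_subset (R : realType) (I : eqType) (s t : seq I) (f : I -> R) :
  uniq s -> uniq t -> {subset s <= t} -> (forall i, 0 <= f i) ->
  \sum_(i <- s) f i <= \sum_(i <- t) f i.
Proof.
move=> us ut st f0; have -> : \sum_(i <- s) f i = \sum_(i <- t | i \in s) f i.
  rewrite -[RHS]big_filter; apply: perm_big; apply: uniq_perm => //.
    exact: filter_uniq.
  by move=> i; rewrite mem_filter; case: (boolP (i \in s)) => //= /st ->.
by rewrite [leRHS](bigID (mem s))/= lerDl sumr_ge0.
Qed.

Section local_sums.
Variables (R : realType) (D : nat).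
Hypothesis D0 : (0 < D)%N.

Let block_sum m :
  \sum_(0 <= k < m * D) (2^-1 ^+ (k %/ D) : R) <= D%:R * (2 - 2 * 2^-1 ^+ m).
Proof.
elim: m => [|m IH]; first by rewrite mul0n big_nil expr0 mulr1 subrr mulr0.
rewrite (big_cat_nat (n := m * D)) ?leq_mul2r ?leqnSn ?orbT//=.
apply: le_trans (lerD IH (lexx _)) _.
have -> : \sum_(m * D <= k < m.+1 * D) (2^-1 ^+ (k %/ D) : R) = D%:R * 2^-1 ^+ m.
  rewrite (eq_big_nat _ _ (F2 := fun=> 2^-1 ^+ m)); last first.
    move=> k /andP[k1 k2]; congr (_ ^+ _); apply/eqP.
    by rewrite eqn_leq -ltnS ltn_divLR// k2 leq_divRL.
  by rewrite sumr_const_nat mulSn addnK mulr_natl.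
rewrite -mulrDr ler_wpM2l// exprS; lra.
Qed.

(** D consecutive indices gain one unit in the lower bound for h, and exp (-1) <= 1/2, so the blocks
    of D terms are dominated by a geometric series of sum 2. *)
Lemma geometric_block_sum (h : nat -> R) (s : seq nat) : uniq s ->
  (forall k, (k %/ D)%:R <= h k) -> \sum_(k <- s) expR (- h k) <= 2 * D%:R.
Proof.
move=> us hk.
have e2 : expR (-1) <= 2^-1 :> R.
  by rewrite expRN lef_pV2 ?posrE ?expR_gt0//; have := expR_ge1Dx (1 : R); lra.
have b k : expR (- h k) <= 2^-1 ^+ (k %/ D).
  apply: le_trans (_ : expR (- (k %/ D)%:R) <= _); first by rewrite ler_expR lerN2.
  have -> : - (k %/ D)%:R = (k %/ D)%:R * - 1 :> R by rewrite mulrN1.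
  rewrite expRM_natl lerXn2r ?nnegrE ?expR_ge0//.
apply: le_trans (_ : \sum_(k <- s) 2^-1 ^+ (k %/ D) <= _); first exact: ler_sum.
pose N := (\max_(k <- s) k).+1.
apply: le_trans (_ : \sum_(k <- iota 0 (N * D)) 2^-1 ^+ (k %/ D) <= _).
  apply: ler_sum_subset => //; first exact: iota_uniq.
  move=> k ks; rewrite mem_iota add0n leq0n /=.
  apply: leq_trans (_ : N <= _)%N; last by rewrite leq_pmulr.
  by rewrite ltnS; exact: leq_bigmax_seq.
have := block_sum N; rewrite /index_iota subn0 => /le_trans; apply.
by rewrite mulrC ler_wpM2r// gerBl mulr_ge0.
Qed.

Variable x : int -> R.
Hypothesis inc : forall i, x i < x (i + 1).

Lemma right_local_sum p (s : seq int) :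
  (forall r : nat, x p + r%:R <= x (p + (r * D)%:Z)) ->
  uniq s -> (forall j, j \in s -> p <= j) ->
  \sum_(j <- s) expR (- (x j - x p)) <= 2 * D%:R.
Proof.
move=> loc us sp.
pose h k := x (p + k%:Z) - x p.
have -> : \sum_(j <- s) expR (- (x j - x p)) =
    \sum_(k <- [seq `|j - p|%N | j <- s]) expR (- h k).
  rewrite big_map; apply: eq_big_seq => j js; rewrite /h.
  by have -> : p + `|j - p|%N%:Z = j by have := sp _ js; lia.
apply: geometric_block_sum.
  rewrite map_inj_in_uniq// => j k js ks.
  by have := sp _ js; have := sp _ ks; lia.
move=> k; rewrite /h lerBrDl; apply: le_trans (loc _) _.
rewrite enum_leE// lerD2l lez_nat; exact: leq_trunc_div.
Qed.

Lemma left_local_sum p (s : seq int) :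
  (forall r : nat, x (p - (r * D)%:Z) <= x p - r%:R) ->
  uniq s -> (forall j, j \in s -> j <= p) ->
  \sum_(j <- s) expR (- (x p - x j)) <= 2 * D%:R.
Proof.
move=> loc us sp.
pose h k := x p - x (p - k%:Z).
have -> : \sum_(j <- s) expR (- (x p - x j)) =
    \sum_(k <- [seq `|j - p|%N | j <- s]) expR (- h k).
  rewrite big_map; apply: eq_big_seq => j js; rewrite /h.
  by have -> : p - `|j - p|%N%:Z = j by have := sp _ js; lia.
apply: geometric_block_sum.
  rewrite map_inj_in_uniq// => j k js ks.
  by have := sp _ js; have := sp _ ks; lia.
move=> k; rewrite /h lerBrDl -lerBrDr; apply: le_trans (loc _).
rewrite enum_leE// lerD2l lerN2 lez_nat; exact: leq_trunc_div.
Qed.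

End local_sums.

Section power_bounds.
Variables (R : realType) (alpha : R).
Hypothesis alpha1 : 1 < alpha.

Let powR_split (z : R) : 0 <= z -> z `^ alpha = z * z `^ (alpha - 1).
Proof. by move=> z0; rewrite mulr_powRB1// (lt_trans ltr01). Qed.

Lemma powRB1_le (y z : R) : 0 <= y -> y <= z -> y `^ (alpha - 1) <= z `^ (alpha - 1).
Proof.
move=> y0 yz; apply: ge0_ler_powR; rewrite ?nnegrE ?subr_ge0 ?(ltW alpha1)//.
exact: le_trans yz.
Qed.

(** The subtracted constant is A b with b = A^(1/(alpha-1)), where A z and z^alpha cross: up to b
    the left side is nonpositive, beyond b already A z is at most z^alpha. *)
Lemma powR_linear_bound (A z : R) : 0 <= A -> 0 <= z ->
  A * z - A * A `^ ((alpha - 1)^-1) <= z `^ alpha.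
Proof.
move=> A0 z0; set b := A `^ _; have b0 : 0 <= b by exact: powR_ge0.
have [zb|bz] := leP z b.
  apply: le_trans (powR_ge0 _ _); rewrite subr_le0.
  exact: ler_wpM2l.
apply: le_trans (_ : A * z <= _); first by rewrite gerBl mulr_ge0.
rewrite powR_split// mulrC ler_wpM2l//.
apply: le_trans (powRB1_le b0 (ltW bz)).
by rewrite /b -powRrM mulVf ?powRr1// subr_eq0 gt_eqF.
Qed.

(* Both bounds come from z^alpha = z * z^(alpha - 1). *)
Lemma powR_below (l del g : R) : 0 <= g -> 0 <= l -> 1 <= l `^ (alpha - 1) ->
  0 <= del -> g <= l - del ->
  g `^ alpha <= l `^ alpha - del * (l `^ (alpha - 1) - 1) - l + g.
Proof.
move=> g0 l0 l1 del0 gl; rewrite !powR_split//.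
have gl' : g <= l by lra.
have := ler_wpM2l g0 (powRB1_le g0 gl').
set P := l `^ _ in l1 *; move: (g * _) => Q QP.
have : 0 <= (l - del - g) * (P - 1) by rewrite mulr_ge0 ?subr_ge0.
nra.
Qed.

Lemma powR_above (l del A v z : R) : 0 <= l -> 0 <= del -> 0 <= v -> 0 <= A ->
  1 + A <= l `^ (alpha - 1) -> l + del + v <= z ->
  l `^ alpha + del * l `^ (alpha - 1) - A * (l + del) + v <= z `^ alpha - A * z.
Proof.
move=> l0 del0 v0 A0 l1 lz.
have z0 : 0 <= z by apply: le_trans lz; rewrite !addr_ge0.
rewrite !powR_split//.
have lz' : l <= z by apply: le_trans lz; rewrite -addrA lerDl addr_ge0.
have := ler_wpM2l z0 (powRB1_le l0 lz').
set P := l `^ _ in l1 *; move: (z * _ `^ _) => Q QP.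
have : 0 <= (z - (l + del + v)) * (P - A) by rewrite mulr_ge0 ?subr_ge0//; lra.
have : 0 <= v * (P - A - 1) by rewrite mulr_ge0//; lra.
nra.
Qed.

End power_bounds.

Section trap_estimates.
Variables (R : realType) (alpha lam : R) (x : int -> R).
Hypothesis alpha1 : 1 < alpha.
Hypothesis inc : forall i, x i < x (i + 1).
Variables (W A B l del S : R) (D : nat) (a b : int).
Hypothesis D0 : (0 < D)%N.
Hypothesis A0 : 0 <= A.
Hypothesis lamA : `|lam| <= A.
Hypothesis lamW : `|lam| * W <= B.
Hypothesis ab : a <= b.
Hypothesis window : forall j, a - 1 <= j <= b + 1 -> `|x j| <= W.
Hypothesis loc_right : forall p (r : nat), `|x p| <= W ->
  x p + r%:R <= x (p + (r * D)%:Z).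
Hypothesis loc_left : forall p (r : nat), `|x p| <= W ->
  x (p - (r * D)%:Z) <= x p - r%:R.

Let cond y z := conductance alpha lam y z.
Let tot p := total_conductance alpha lam x (x p).

(** Writing y + z as 2 y - (y - z) separates a bounded part, since y is in the window, from a part
    linear in the jump length, which |y - z|^alpha absorbs however far z is. *)
Let tilt_le y z : `|y| <= W -> lam * (y + z) <= 2 * B + `|lam| * `|y - z|.
Proof.
move=> yW; have -> : y + z = 2 * y - (y - z) by lra.
rewrite mulrBr; apply: lerD.
  apply: le_trans (ler_norm _) _; rewrite mulrCA normrM ger0_norm// ler_pM2l//.
  by rewrite normrM (le_trans _ lamW)// ler_wpM2l.
by apply: le_trans (ler_norm _) _; rewrite normrN normrM.
Qed.

(** In the slope 1 + A, the A pays for the tilt and the 1 is what leaves exp (- |y - z|). *)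
Let C1 := expR (2 * B + (1 + A) * (1 + A) `^ (alpha - 1)^-1).

Let cond_le y z : `|y| <= W -> cond y z <= C1 * expR (- `|y - z|).
Proof.
move=> yW; rewrite /cond /conductance; case: ifP => _.
  by rewrite mulr_ge0 ?expR_ge0.
rewrite /C1 -expRD ler_expR.
have := tilt_le z yW.
have : `|lam| * `|y - z| <= A * `|y - z| by rewrite ler_wpM2r.
have A1 : 0 <= 1 + A by rewrite addr_ge0.
have := powR_linear_bound alpha1 A1 (normr_ge0 (y - z)).
move: (_ `^ alpha) (_ * _ `^ _^-1) (`|lam| * _) (lam * _) => q1 q2 q3 q4.
by rewrite mulrDl mul1r; lra.
Qed.

Let local_right p (s : seq int) : `|x p| <= W -> uniq s ->
  (forall j, j \in s -> p <= j) ->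
  \sum_(j <- s) expR (- (x j - x p)) <= 2 * D%:R.
Proof. by move=> pW; apply: (right_local_sum D0 inc) => r; exact: loc_right. Qed.

Let local_left p (s : seq int) : `|x p| <= W -> uniq s ->
  (forall j, j \in s -> j <= p) ->
  \sum_(j <- s) expR (- (x p - x j)) <= 2 * D%:R.
Proof. by move=> pW; apply: (left_local_sum D0 inc) => r; exact: loc_left. Qed.

Definition site_bound : R := 4 * C1 * D%:R.

Lemma conductances_bounded p (s : seq int) : `|x p| <= W -> uniq s ->
  \sum_(j <- s) conductance alpha lam (x p) (x j) <= site_bound.
Proof.
move=> pW us.
apply: le_trans (_ : \sum_(j <- s) C1 * expR (- `|x p - x j|) <= _).
  by apply: ler_sum => j _; exact: cond_le.
rewrite -mulr_sumr (bigID (fun j => p <= j))/=.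
rewrite -[X in _ * (X + _)]big_filter -[X in _ * (_ + X)]big_filter.
have C10 : 0 <= C1 by exact: expR_ge0.
have -> : site_bound = C1 * (2 * D%:R + 2 * D%:R) by rewrite /site_bound; ring.
apply: ler_wpM2l => //; apply: lerD.
  apply: le_trans (local_right pW (filter_uniq (fun j => p <= j) us) _).
    rewrite le_eqVlt; apply/orP; left; apply/eqP; apply: eq_big_seq => j.
    rewrite mem_filter => /andP[pj _]; congr (expR (- _)).
    by rewrite distrC ger0_norm// subr_ge0 enum_leE.
  by move=> j; rewrite mem_filter => /andP[].
apply: le_trans (local_left pW (filter_uniq (fun j => ~~ (p <= j)) us) _).
  rewrite le_eqVlt; apply/orP; left; apply/eqP; apply: eq_big_seq => j.
  rewrite mem_filter => /andP[pj _]; congr (expR (- _)).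
  by rewrite ger0_norm// subr_ge0 enum_leE//; lia.
by move=> j; rewrite mem_filter => /andP[pj _]; lia.
Qed.

Local Notation N := `|b - a|%N.
Definition trap_state (i : 'I_N.+1) : R := x (a + (i : nat)%:Z).
Definition trap_conductance (i j : 'I_N.+1) : R :=
  conductance alpha lam (trap_state i) (trap_state j).
Definition trap_weight (i : 'I_N.+1) : R :=
  total_conductance alpha lam x (trap_state i).

Let idx (i : 'I_N.+1) : int := a + (i : nat)%:Z.

Let idx_itv i : a <= idx i <= b.
Proof. by rewrite /idx; have := ltn_ord i; lia. Qed.

Let idxW i : `|x (idx i)| <= W.
Proof. by apply: window; have := idx_itv i; lia. Qed.

Let idx_uniq : uniq [seq idx i | i <- enum 'I_N.+1].
Proof.
by rewrite map_inj_uniq ?enum_uniq// => i j; rewrite /idx => ij; apply: val_inj => /=; lia.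
Qed.

Let idx_surj q : a <= q <= b -> exists i, idx i = q.
Proof.
move=> qab; have qN : (`|q - a| < N.+1)%N by lia.
by exists (Ordinal qN); rewrite /idx /=; lia.
Qed.

Let big_idx (f : int -> R) :
  \sum_(q <- [seq idx i | i <- enum 'I_N.+1]) f q = \sum_i f (idx i).
Proof. by rewrite big_map big_enum. Qed.

Lemma trap_weight_gt0 i : 0 < trap_weight i.
Proof.
by apply: (total_conductance_gt0 inc (C := site_bound)) => s; apply: conductances_bounded; exact: idxW.
Qed.

Lemma trap_conductance_le i : \sum_j trap_conductance i j <= trap_weight i.
Proof.
rewrite -(big_idx (fun q => cond (x (idx i)) (x q))).
by apply: (total_conductance_ge (C := site_bound)) => // s; exact: conductances_bounded.
Qed.

Lemma trap_weight_le i : trap_weight i <= site_bound.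
Proof. by apply: total_conductance_le => s; apply: conductances_bounded; exact: idxW. Qed.

Let cond_next j : a <= j < b -> expR (- 2 * B - (x (j + 1) - x j) `^ alpha) <=
  cond (x j) (x (j + 1)).
Proof.
move=> jab; rewrite /cond /conductance ifF; last first.
  by apply/negbTE; rewrite lt_eqF.
rewrite ler_expR distrC ger0_norm; last by rewrite subr_ge0 ltW.
have jW : `|x j| <= W by apply: window; lia.
have j1W : `|x (j + 1)| <= W by apply: window; lia.
have : `|lam * (x j + x (j + 1))| <= 2 * B.
  rewrite normrM; apply: le_trans (_ : `|lam| * (W + W) <= _).
    by rewrite ler_wpM2l// (le_trans (ler_normD _ _))// lerD.
  by move: lamW; rewrite mulrDr; move: (`|lam| * W) => q; lra.
by rewrite ler_norml => /andP[h _]; move: (_ `^ alpha) (lam * _) h => q1 q2; lra.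
Qed.

(** A gap of length at most 1 gives its left end a weight of at least exp (- 2 B - 1), so order n
    short gaps make the weight of the trap at least of order n. *)
Lemma trap_weight_lower (s : seq int) : uniq s ->
  (forall j, j \in s -> a <= j < b /\ x (j + 1) - x j <= 1) ->
  expR (- 2 * B - 1) * (size s)%:R <= \sum_i trap_weight i.
Proof.
move=> us sP; rewrite -(big_idx tot).
apply: le_trans (_ : \sum_(j <- s) tot j <= _); last first.
  apply: ler_sum_subset => //.
    move=> j /sP[jab _]; have [|i <-] := idx_surj (q := j); first by lia.
    by apply: map_f; rewrite mem_enum.
  move=> q; rewrite /tot /total_conductance sumZ_ge0E ?fine_ge0 ?esum_ge0//.
    by move=> j _; rewrite lee_fin conductance_ge0.
  by move=> j; exact: conductance_ge0.
have -> : expR (- 2 * B - 1) * (size s)%:R = \sum_(j <- s) expR (- 2 * B - 1).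
  by rewrite big_const_seq count_predT iter_addr_0 mulr_natr.
rewrite big_seq [leRHS]big_seq; apply: ler_sum => j /sP[jab j1].
have jW : `|x j| <= W by apply: window; lia.
apply: le_trans (total_conductance_ge (C := site_bound) _ (s := [:: j + 1]) isT); last first.
  by move=> s' us'; exact: conductances_bounded.
rewrite big_seq1; apply: le_trans (cond_next jab).
rewrite ler_expR lerD2l lerN2.
have -> : 1 = 1 `^ alpha :> R by rewrite powR1.
apply: ge0_ler_powR; rewrite ?nnegrE//.
  exact/ltW/(lt_trans ltr01 alpha1).
by rewrite subr_ge0 ltW.
Qed.

Let bW : `|x b| <= W. Proof. by apply: window; lia. Qed.
Let b1W : `|x (b + 1)| <= W. Proof. by apply: window; lia. Qed.
Let aW : `|x a| <= W. Proof. by apply: window; lia. Qed.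
Let a1W : `|x (a - 1)| <= W. Proof. by apply: window; lia. Qed.

Hypothesis l0 : 0 <= l.
Hypothesis del0 : 0 <= del.
Hypothesis l1 : 1 + A <= l `^ (alpha - 1).
Hypothesis lB : `|lam| * (l + del) <= B.
Hypothesis gap_left : l + del <= x a - x (a - 1).
Hypothesis gap_right : l + del <= x (b + 1) - x b.
Hypothesis gap_small : forall j, a <= j < b -> x (j + 1) - x j <= l - del.
Hypothesis sum_exp : \sum_(i < N) expR (x (a + (i : nat)%:Z + 1) - x (a + (i : nat)%:Z)) <= S.

(** [powR_below] retains a factor exp (gap - l) for each gap. The sum of exp (gap) will be of order
    n up to powers of l, and exp (- l) = 1 / (n t) cancels this n; bounding every resistance by the
    largest one would keep it. *)
Lemma trap_resistance_le :
  \sum_(0 <= i < N) (trap_conductance (inord i) (inord i.+1))^-1 <=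
  expR (2 * B + l `^ alpha - del * (l `^ (alpha - 1) - 1) - l) * S.
Proof.
apply: le_trans (ler_wpM2l (expR_ge0 _) sum_exp).
rewrite big_mkord mulr_sumr; apply: ler_sum => i _.
have iN := ltn_ord i.
rewrite /trap_conductance /trap_state !inordK//; last by rewrite ltnS ltnW.
have -> : a + i.+1%:Z = a + (i : nat)%:Z + 1 by clear; lia.
set j := a + _; have jab : a <= j < b by rewrite /j; clear -iN ab; lia.
have cn := cond_next jab.
rewrite -expRD -lef_pV2 ?posrE ?expR_gt0 ?invr_gt0//; last first.
  by apply: lt_le_trans cn; exact: expR_gt0.
rewrite invrK -expRN; apply: le_trans cn; rewrite ler_expR.
have P1 : 1 <= l `^ (alpha - 1) by apply: le_trans l1; rewrite lerDl.
have g0 : 0 <= x (j + 1) - x j by rewrite subr_ge0 ltW.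
have := powR_below alpha1 g0 l0 P1 del0 (gap_small jab).
move: (_ `^ alpha) (_ `^ alpha) (_ `^ (alpha - 1)) => q1 q2 q3; lra.
Qed.

Let C3 := expR (3 * B - l `^ alpha - del * l `^ (alpha - 1)).

Let cond_across y z v : `|y| <= W -> 0 <= v -> l + del + v <= `|y - z| ->
  cond y z <= C3 * expR (- v).
Proof.
move=> yW v0 lz; rewrite /cond /conductance; case: ifP => _.
  by rewrite mulr_ge0 ?expR_ge0.
rewrite /C3 -expRD ler_expR.
have := tilt_le z yW.
have l1' : 1 + `|lam| <= l `^ (alpha - 1) by apply: le_trans l1; rewrite lerD2l.
have := powR_above alpha1 l0 del0 v0 (normr_ge0 lam) l1' lz.
move: lB.
move: (_ `^ alpha) (_ `^ alpha) (_ * _ `^ (alpha - 1)) (`|lam| * _) (`|lam| * _) (lam * _).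
by move=> q1 q2 q3 q4 q5 q6; lra.
Qed.

(** A jump from p to some q beyond b splits into the distance from p to b, the barrier, and the
    distance from b + 1 to q. The sums over p and over q are at most 2 D each, and the two sides
    together give 2 (2 D)^2 = 8 D^2. *)
Lemma trap_leakage_le :
  leakage trap_conductance trap_weight <= 8 * D%:R ^+ 2 * C3.
Proof.
have C30 : 0 <= C3 by exact: expR_ge0.
pose bnd p := C3 * (2 * D%:R) * expR (- (x b - x p)) +
              C3 * (2 * D%:R) * expR (- (x p - x a)).
have site i : trap_weight i - \sum_j trap_conductance i j <= bnd (idx i).
  move: (idxW i) (idx_itv i); set p := idx i => pW /andP[ap pb].
  rewrite lerBlDl -[trap_weight i]/(tot p).
  apply: total_conductance_le => s us.
  rewrite (bigID (fun q => a <= q <= b))/=.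
  rewrite -[X in X + _ <= _]big_filter -[X in _ + X <= _]big_filter; apply: lerD.
    rewrite -(big_idx (fun q => cond (x p) (x q))).
    apply: ler_sum_subset => //; first exact: filter_uniq.
      move=> q; rewrite mem_filter => /andP[qab _].
      by have [k <-] := idx_surj qab; apply: map_f; rewrite mem_enum.
    by move=> q; exact: conductance_ge0.
  set s' := seq.filter _ s; have us' : uniq s' by exact: filter_uniq.
  have s'P q : q \in s' -> ~~ (a <= q <= b) by rewrite mem_filter => /andP[].
  rewrite (bigID (fun q => b < q))/=.
  rewrite -[X in X + _ <= _]big_filter -[X in _ + X <= _]big_filter; apply: lerD.
    apply: le_trans (_ : \sum_(q <- [seq q <- s' | b < q])
        C3 * expR (- (x b - x p)) * expR (- (x q - x (b + 1))) <= _).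
      rewrite big_seq [leRHS]big_seq; apply: ler_sum => q.
      rewrite mem_filter => /andP[bq qs'].
      rewrite -mulrA -expRD -opprD; apply: cond_across => //.
        by apply: addr_ge0; rewrite subr_ge0 enum_leE//; clear -bq; lia.
      rewrite distrC ger0_norm ?subr_ge0 ?enum_leE//; last by clear -bq pb; lia.
      by move: gap_right; lra.
    rewrite -mulr_sumr -[leRHS]mulrA [2 * _ * _]mulrC mulrA ler_wpM2l//.
      by rewrite mulr_ge0// expR_ge0.
    apply: local_right => //; first exact: filter_uniq.
    by move=> q; rewrite mem_filter => /andP[bq _]; clear -bq; lia.
  apply: le_trans (_ : \sum_(q <- [seq q <- s' | ~~ (b < q)])
      C3 * expR (- (x p - x a)) * expR (- (x (a - 1) - x q)) <= _).
    rewrite big_seq [leRHS]big_seq; apply: ler_sum => q.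
    rewrite mem_filter => /andP[bq /s'P qs'].
    have qa : q <= a - 1 by clear -bq qs'; lia.
    rewrite -mulrA -expRD -opprD; apply: cond_across => //.
      by apply: addr_ge0; rewrite subr_ge0 enum_leE//; clear -qa; lia.
    rewrite ger0_norm ?subr_ge0 ?enum_leE//; last by clear -qa ap; lia.
    by move: gap_left; lra.
  rewrite -mulr_sumr -[leRHS]mulrA [2 * _ * _]mulrC mulrA ler_wpM2l//.
    by rewrite mulr_ge0// expR_ge0.
  apply: local_left => //; first exact: filter_uniq.
  by move=> q; rewrite mem_filter => /andP[bq /s'P qs']; clear -bq qs'; lia.
apply: le_trans (ler_sum _ (fun i _ => site i)) _.
rewrite -(big_idx bnd) /bnd big_split /= -!mulr_sumr.
have mapP' j : j \in [seq idx i | i <- enum 'I_N.+1] -> a <= j <= b.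
  by move=> /mapP[i _ ->]; exact: idx_itv.
have sb : \sum_(q <- [seq idx i | i <- enum 'I_N.+1]) expR (- (x b - x q)) <= 2 * D%:R.
  by apply: local_left => // j /mapP' /andP[].
have sa : \sum_(q <- [seq idx i | i <- enum 'I_N.+1]) expR (- (x q - x a)) <= 2 * D%:R.
  by apply: local_right => // j /mapP' /andP[].
have CD : 0 <= C3 * (2 * D%:R) by rewrite mulr_ge0.
apply: le_trans (lerD (ler_wpM2l CD sb) (ler_wpM2l CD sa)) _.
by rewrite le_eqVlt; apply/orP; left; apply/eqP; ring.
Qed.

End trap_estimates.

Section finite_trap.
Variables (R : realFieldType) (N : nat).
Variables (c : 'I_N.+1 -> 'I_N.+1 -> R) (pi : 'I_N.+1 -> R).
Hypothesis c_ge0 : forall x y, 0 <= c x y.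
Hypothesis c_sym : forall x y, c x y = c y x.
Hypothesis c_gt0 : forall i, (i < N)%N -> 0 < c (inord i) (inord i.+1).
Hypothesis pi_gt0 : forall x, 0 < pi x.
Hypothesis c_le : forall x, \sum_y c x y <= pi x.
Variables (Rb Pu Pl Kp e : R) (K1 K2 : nat) (o : 'I_N.+1).
Hypothesis RbP : \sum_(0 <= i < N) (c (inord i) (inord i.+1))^-1 <= Rb.
Hypothesis PuP : \sum_x pi x <= Pu.
Hypothesis PlP : Pl <= \sum_x pi x.
Hypothesis KpP : leakage c pi <= Kp.
Hypothesis K1_gt0 : (0 < K1)%N.
Hypothesis K2_gt0 : (0 < K2)%N.
Hypothesis Pl_gt0 : 0 < Pl.
Hypothesis e_gt0 : 0 < e.
Hypothesis fast : Rb * Pu <= e * K1%:R.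
Hypothesis mixing : 2 * (Rb * Pu) <= K2%:R.
Hypothesis tight : 4 * K2%:R * Kp <= e * Pl.

Let Reff := \sum_(0 <= i < N) (c (inord i) (inord i.+1))^-1.

Let Reff_ge0 : 0 <= Reff.
Proof. by rewrite /Reff big_nat sumr_ge0// => i /andP[_ /c_gt0 h]; rewrite invr_ge0 ltW. Qed.

Let RP : Reff * \sum_x pi x <= Rb * Pu.
Proof. by apply: ler_pM => //; apply: sumr_ge0 => x _; exact/ltW. Qed.

Lemma finite_trap_avoid z : restricted_prob c pi (predC1 z) K1 o <= e.
Proof.
have := avoid_hitting_bound c_ge0 c_sym pi_gt0 c_le Reff_ge0
  (fun v x => series_resistance_bound c_ge0 c_sym c_gt0 v x z) K1 o.
move=> h; have {}h := le_trans (le_trans h RP) fast.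
by move: h; rewrite mulrC ler_pM2r// ltr0n.
Qed.

Lemma finite_trap_stay : 1 - restricted_prob c pi predT K2 o <= e.
Proof.
(* Both horizons are K2. [mixing] makes the last factor of [stay_bound] at least 1/2, and the 4 K2
   of [tight] is twice K2 + K2. *)
have := stay_bound c_ge0 c_sym pi_gt0 c_le K2 Reff_ge0
  (fun v x => series_resistance_bound c_ge0 c_sym c_gt0 v x o) K2_gt0.
set s := 1 - restricted_prob _ _ _ _ _.
have s0 : 0 <= s by rewrite subr_ge0; exact: restricted_prob_le1.
move: RP PlP; set P := \sum_x _ => RP' PlP'.
have K0 : 0 < K2%:R :> R by rewrite ltr0n.
have half : 2^-1 <= 1 - Reff * P / K2%:R.
  have : Reff * P / K2%:R <= 2^-1.
    rewrite ler_pdivrMr//; move: (le_trans RP' (lexx _)) mixing.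
    by move: (Reff * P) (Rb * Pu) => q1 q2; lra.
  by move: (Reff * P / _) => q; lra.
move=> h.
have P0 : 0 < P := lt_le_trans Pl_gt0 PlP'.
have : s * (P * 2^-1) <= (K2 + K2)%:R * Kp.
  apply: le_trans (_ : s * (P * (1 - Reff * P / K2%:R)) <= _).
    by rewrite ler_wpM2l// ler_pM2l.
  by apply: le_trans h _; rewrite ler_wpM2l.
rewrite natrD => h2.
have h3 : s * P <= e * P.
  apply: le_trans (_ : e * Pl <= _); last by rewrite ler_pM2l.
  by apply: le_trans tight; move: h2; rewrite mulrA; lra.
by move: h3; rewrite ler_pM2r.
Qed.

End finite_trap.

(** * The walk in a fixed environment *)

Section trapped_walk.
Context d (O : measurableType d) (R : realType).
Variable mu : probability O R.
Variables (X : R -> O -> R) (alpha lam : R) (x : int -> R).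
Hypothesis mX : forall t, 0 <= t -> measurable_fun setT (X t).
Hypothesis cX : forall o, cadlag (X ^~ o).
Hypothesis alpha1 : 1 < alpha.
Hypothesis inc : forall i, x i < x (i + 1).
Hypothesis x0 : x 0 = 0.
Hypothesis chain : markov_chain mu X (range x) (mott_generator alpha lam x) 0.
Variables (W A B l del S V Z e T u : R) (D K1 K2 : nat) (a b : int).
Hypothesis D0 : (0 < D)%N.
Hypothesis A0 : 0 <= A.
Hypothesis lamA : `|lam| <= A.
Hypothesis lamW : `|lam| * W <= B.
Hypothesis a0 : a <= 0.
Hypothesis b0 : 0 <= b.
Hypothesis window : forall j, a - 1 <= j <= b + 1 -> `|x j| <= W.
Hypothesis loc_right : forall p (r : nat), `|x p| <= W ->
  x p + r%:R <= x (p + (r * D)%:Z).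
Hypothesis loc_left : forall p (r : nat), `|x p| <= W ->
  x (p - (r * D)%:Z) <= x p - r%:R.
Hypothesis l0 : 0 <= l.
Hypothesis del0 : 0 <= del.
Hypothesis l1 : 1 + A <= l `^ (alpha - 1).
Hypothesis lB : `|lam| * (l + del) <= B.
Hypothesis gap_left : l + del <= x a - x (a - 1).
Hypothesis gap_right : l + del <= x (b + 1) - x b.
Hypothesis gap_small : forall j, a <= j < b -> x (j + 1) - x j <= l - del.
Hypothesis sum_exp :
  \sum_(i < `|b - a|%N) expR (x (a + (i : nat)%:Z + 1) - x (a + (i : nat)%:Z)) <= S.
Hypothesis card_le : (`|b - a|%N.+1)%:R <= V.
Variable s : seq int.
Hypothesis us : uniq s.
Hypothesis sP : forall j, j \in s -> a <= j < b /\ x (j + 1) - x j <= 1.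
Hypothesis sZ : Z <= (size s)%:R.
Hypothesis Z0 : 0 < Z.

Let Rb := expR (2 * B + l `^ alpha - del * (l `^ (alpha - 1) - 1) - l) * S.
Let Pu := V * site_bound alpha A B D.
Let Pl := expR (- 2 * B - 1) * Z.
Let Kp := 8 * D%:R ^+ 2 * expR (3 * B - l `^ alpha - del * l `^ (alpha - 1)).

Hypothesis K1_gt0 : (0 < K1)%N.
Hypothesis K12 : (K1 <= K2)%N.
Hypothesis e_gt0 : 0 < e.
Hypothesis fast : Rb * Pu <= e * K1%:R.
Hypothesis mixing : 2 * (Rb * Pu) <= K2%:R.
Hypothesis tight : 4 * K2%:R * Kp <= e * Pl.
Hypothesis T0 : 0 <= T.
Hypothesis u0 : 0 <= u.
Hypothesis K1u : K1%:R * u <= T.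
Hypothesis TK2 : T <= K2.+1%:R * expR (- 1) / 2.

Let ab : a <= b. Proof. exact: le_trans b0. Qed.

Let st := trap_state x (a := a) (b := b).
Let c := trap_conductance alpha lam x (a := a) (b := b).
Let pi := trap_weight alpha lam x (a := a) (b := b).

Let N_itv (i : 'I_`|b - a|%N.+1) : a <= a + (i : nat)%:Z <= b.
Proof. by move: ab; have := ltn_ord i; clear; lia. Qed.

Let st_bound i (s' : seq int) : uniq s' ->
  \sum_(j <- s') conductance alpha lam (st i) (x j) <= site_bound alpha A B D.
Proof.
apply: (conductances_bounded alpha1 inc D0 A0 lamA lamW ab loc_right loc_left).
by apply: window; have := N_itv i; clear; lia.
Qed.

(** Of the 11 e, 9 come from survival in [quenched_estimate] and 1 from each endpoint that may be
    avoided. *)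
Lemma trapped_walk :
  ((1 - 11 * e - K1%:R * expR (- u) - 4 / (K2.+1%:R * expR (- 1)))%:E <=
  mu [set o | running_inf (X ^~ o) T = x a /\ running_sup (X ^~ o) T = x b])%E.
Proof.
case: chain => Y [H [mY mH boxE XE]].
have oN : (`|a| < `|b - a|%N.+1)%N by move: a0 b0; clear; lia.
have hN : (`|b - a| < `|b - a|%N.+1)%N by [].
pose o0 : 'I_`|b - a|%N.+1 := Ordinal oN.
pose hi : 'I_`|b - a|%N.+1 := Ordinal hN.
pose lo : 'I_`|b - a|%N.+1 := ord0.
have st_lo : st lo = x a by rewrite /st /trap_state addr0.
have st_hi : st hi = x b.
  by rewrite /st /trap_state; congr x; move: ab; clear; rewrite /=; lia.
have st_o0 : st o0 = 0.
  by rewrite -x0 /st /trap_state; congr x; move: a0; clear; rewrite /=; lia.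
have st_inj : injective st.
  by move=> i j /(enum_inj inc) ij; apply: val_inj => /=; move: ij; clear; lia.
have Dst i : range x (st i) by exists (a + (i : nat)%:Z).
have exit1 i : exit_rate (mott_generator alpha lam x) (st i) = 1.
  exact: (exit_rate_mott inc (fun s' => st_bound i (s' := s'))).
have jumpE i j : jump_prob (mott_generator alpha lam x) (st i) (st j) = c i j / pi i.
  exact: (jump_prob_mott inc (fun s' => st_bound i (s' := s'))).
have c_ge0 i j : 0 <= c i j by exact: conductance_ge0.
have c_sym i j : c i j = c j i by exact: conductanceC.
have pi_gt0 i : 0 < pi i by exact: (trap_weight_gt0 alpha1 inc D0 A0 lamA lamW ab window loc_right loc_left).
have c_le i : \sum_j c i j <= pi i.
  exact: (trap_conductance_le alpha1 inc D0 A0 lamA lamW ab window loc_right loc_left).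
have c_gt0 i : (i < `|b - a|)%N -> 0 < c (inord i) (inord i.+1).
  move=> iN; rewrite /c /trap_conductance /conductance ifF ?expR_gt0//.
  apply/negbTE/eqP => /(st_inj _ _)/(congr1 val); rewrite /= !inordK//; last by rewrite ltnW.
  by move=> /eqP; rewrite eqn_leq ltnn andbF.
have RbP : \sum_(0 <= i < `|b - a|) (c (inord i) (inord i.+1))^-1 <= Rb.
  exact: (trap_resistance_le alpha1 inc D0 A0 lamA lamW ab window l0 del0 l1 gap_small).
have PuP : \sum_i pi i <= Pu.
  apply: le_trans (_ : \sum_(i < `|b - a|%N.+1) site_bound alpha A B D <= _).
    by apply: ler_sum => i _; exact: (trap_weight_le alpha1 inc D0 A0 lamA lamW ab window loc_right loc_left).
  rewrite sumr_const card_ord /Pu -mulr_natl ler_wpM2r//.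
  by rewrite /site_bound !mulr_ge0// expR_ge0.
have PlP : Pl <= \sum_i pi i.
  apply: le_trans (_ : expR (- 2 * B - 1) * (size s)%:R <= _).
    by rewrite ler_wpM2l// expR_ge0.
  exact: (trap_weight_lower alpha1 inc D0 A0 lamA lamW ab window loc_right loc_left).
have KpP : leakage c pi <= Kp.
  exact: (trap_leakage_le alpha1 inc D0 A0 lamA lamW ab window loc_right loc_left).
have K2_gt0 : (0 < K2)%N := leq_trans K1_gt0 K12.
have Pl_gt0 : 0 < Pl by rewrite mulr_gt0// expR_gt0.
have av z := finite_trap_avoid c_ge0 c_sym c_gt0 pi_gt0 c_le o0 RbP PuP K1_gt0 fast z.
have stay := finite_trap_stay c_ge0 c_sym c_gt0 pi_gt0 c_le o0 RbP PuP PlP KpP K2_gt0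
  Pl_gt0 e_gt0 mixing tight.
rewrite -st_lo -st_hi.
apply: le_trans (quenched_estimate (L := mott_generator alpha lam x) (c := c) (pi := pi)
  (o0 := o0) (u := u) (K1 := K1) (K2 := K2)
  mX _ mY mH boxE XE st_inj st_o0 Dst exit1 jumpE c_ge0 pi_gt0 c_le _ T0 u0 K12 K1u TK2).
- rewrite lee_fin; have := av hi; have := av lo; move: stay.
  move: (restricted_prob _ _ predT _ _) (restricted_prob _ _ (predC1 lo) _ _).
  move: (restricted_prob _ _ (predC1 hi) _ _) (K1%:R * _) (4 / _) => q1 q2 q3 q4 q5; lra.
- by move=> o t t0; case: (cX o) => h _; exact: h.
by move=> i; rewrite st_lo st_hi /st /trap_state !enum_leE//; exact: N_itv.
Qed.

End trapped_walk.

(** * Good environments *)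

Section good_environment.
Variable R : realType.

(* The walk started at the atom 0 is trapped between the first gaps larger than
   l on either side of 0; M bounds the position of these gaps, and W is a larger
   window in which no gap is within del of l and the atoms are not clustered. *)
Record good_environment (l del M W eps V Z : R) (L D : nat) (x : int -> R) : Prop :=
  GoodEnvironment {
    run_right : exists i : nat, (i + L)%:R <= M /\
      forall j, ~ (i%:R <= x j <= (i + L)%:R);
    run_left : exists i : nat, (i + L)%:R <= M /\
      forall j, ~ (- (i + L)%:R <= x j <= - i%:R);
    no_critical_gap : forall j, `|x j| <= W ->
      ~ (l - del < x (j + 1) - x j <= l + del);
    no_early_gap : forall j, 0 <= x j <= eps -> x (j + 1) - x j <= l;
    few_gaps : forall (k : nat), (k <= L)%N -> forall s : seq int, uniq s ->
      (forall j, j \in s -> `|x j| <= W /\ k%:R < x (j + 1) - x j) ->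
      (size s)%:R <= V * expR (- k%:R);
    sparse : forall p (r : nat), `|x p| <= W ->
      x p + r%:R <= x (p + (r * D)%:Z) /\ x (p - (r * D)%:Z) <= x p - r%:R;
    short_gaps : exists s : seq int, [/\ uniq s,
      forall j, j \in s -> 0 <= x j <= eps /\ x (j + 1) - x j <= 1
      & Z <= (size s)%:R];
    outer_right : exists j, M <= x j <= W;
    outer_left : exists j, - W <= x j <= - M }.

Variables (l del M W eps V Z : R) (L D : nat) (x : int -> R).
Hypothesis incx : increasing_enum x.
Hypothesis x0 : x 0 = 0.
Hypothesis good : good_environment l del M W eps V Z L D x.
Hypothesis lL : l < L%:R.
Hypothesis del0 : 0 <= del.
Hypothesis MW : M <= W.

Let inc : forall i, x i < x (i + 1). Proof. by case: incx. Qed.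

(** The empty run of length L > l cannot contain the atom at 0, so it lies to the right of 0 and
    before M; the gap around it is longer than l, and the first such gap starts no later. *)
Lemma first_big_gap_right : exists b : int,
  [/\ 0 <= b, l < x (b + 1) - x b, x b < M &
      forall j, 0 <= j < b -> x (j + 1) - x j <= l].
Proof.
have [i [iM ivoid]] := run_right good.
have i0 : 0 < i%:R :> R.
  rewrite ltr0n lt0n; apply/eqP => i0; have := ivoid 0; rewrite x0 i0 lexx; apply.
  by rewrite ler0n.
have exk : exists k : nat, i%:R <= x k%:Z.
  have [_ /(_ i%:R)[j ij] _] := incx; exists `|j|%N.
  rewrite ltW// (lt_le_trans ij)// enum_leE//; clear; lia.
have [[|k] ik kmin] := ex_minnP exk; first by rewrite x0 leNgt i0 in ik.
have xk : x k%:Z < i%:R by rewrite ltNge; apply/negP => /kmin; rewrite ltnn.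
have xk1 : (i + L)%:R < x k.+1%:Z.
  by rewrite ltNge; apply/negP => h; apply: (ivoid k.+1%:Z); rewrite ik.
have kk1 : k%:Z + 1 = k.+1%:Z by clear; lia.
have exg : exists k : nat, l < x (k%:Z + 1) - x k%:Z.
  exists k; rewrite kk1 ltrBrDr; apply: lt_trans xk1.
  by rewrite natrD addrC ltrD.
have [m gm mmin] := ex_minnP exg.
have mk : (m <= k)%N.
  apply: mmin; rewrite kk1 ltrBrDr; apply: lt_trans xk1.
  by rewrite natrD addrC ltrD.
exists m%:Z; split => //.
  apply: le_lt_trans (_ : x k%:Z < _); first by rewrite enum_leE// lez_nat.
  apply: lt_le_trans xk _; apply: le_trans iM; by rewrite ler_nat leq_addr.
move=> j jm; rewrite leNgt; apply/negP => gj.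
have jj : j = `|j|%N%:Z by clear -jm; lia.
by have := mmin `|j|%N; rewrite -jj => /(_ gj); clear -jm; lia.
Qed.

Lemma first_big_gap_left : exists a : int,
  [/\ a <= 0, l < x a - x (a - 1), - M < x a &
      forall j, a <= j < 0 -> x (j + 1) - x j <= l].
Proof.
have [i [iM ivoid]] := run_left good.
have i0 : 0 < i%:R :> R.
  rewrite ltr0n lt0n; apply/eqP => i0; have := ivoid 0; rewrite x0 i0 oppr0 lexx andbT.
  by apply; rewrite oppr_le0 ler0n.
have exk : exists k : nat, x (- k%:Z) <= - i%:R.
  have [_ _ /(_ (- i%:R))[j ij]] := incx; exists `|j|%N.
  rewrite ltW// (le_lt_trans _ ij)// enum_leE//; clear; lia.
have [[|k] ik kmin] := ex_minnP exk.
  by rewrite oppr0 x0 leNgt oppr_lt0 i0 in ik.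
have xk : - i%:R < x (- k%:Z) by rewrite ltNge; apply/negP => /kmin; rewrite ltnn.
have xk1 : x (- k.+1%:Z) < - (i + L)%:R.
  by rewrite ltNge; apply/negP => h; apply: (ivoid (- k.+1%:Z)); rewrite ik andbT.
have kk1 : - k%:Z - 1 = - k.+1%:Z by clear; lia.
have exg : exists k : nat, l < x (- k%:Z) - x (- k%:Z - 1).
  exists k; rewrite kk1 ltrBrDl; apply: le_lt_trans xk.
  by rewrite -lerBrDr (le_trans (ltW xk1))// natrD opprD lerD2l lerN2 ltW.
have [m gm mmin] := ex_minnP exg.
have mk : (m <= k)%N.
  apply: mmin; rewrite kk1 ltrBrDl; apply: le_lt_trans xk.
  by rewrite -lerBrDr (le_trans (ltW xk1))// natrD opprD lerD2l lerN2 ltW.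
exists (- m%:Z); split => //.
  apply: lt_le_trans (_ : x (- k%:Z) <= _); last by rewrite enum_leE// lerN2 lez_nat.
  apply: le_lt_trans xk; rewrite lerN2; apply: le_trans iM; by rewrite ler_nat leq_addr.
move=> j jm; rewrite leNgt; apply/negP => gj.
have jj : - (`|j|%N.-1)%:Z = j + 1 by clear -jm; lia.
have := mmin `|j|%N.-1; rewrite jj addrK => /(_ gj); clear -jm; lia.
Qed.

Section between.
Variables a b : int.
Hypothesis a0 : a <= 0.
Hypothesis b0 : 0 <= b.
Hypothesis gapa : l < x a - x (a - 1).
Hypothesis gapb : l < x (b + 1) - x b.
Hypothesis aM : - M < x a.
Hypothesis bM : x b < M.
Hypothesis small_left : forall j, a <= j < 0 -> x (j + 1) - x j <= l.
Hypothesis small_right : forall j, 0 <= j < b -> x (j + 1) - x j <= l.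

Let ab : a <= b. Proof. exact: le_trans b0. Qed.

(** The neighbours x_(a-1) and x_(b+1) lie beyond gaps of unknown length; the outer atoms, between M
    and W in absolute value, keep them in the window. *)
Lemma trap_window j : a - 1 <= j <= b + 1 -> `|x j| <= W.
Proof.
move=> /andP[aj jb]; rewrite ler_norml; apply/andP; split.
  have [q /andP[q1 q2]] := outer_left good; apply: le_trans q1 _.
  rewrite enum_leE//; suff : q < a by clear -aj; lia.
  by rewrite -(enum_ltE inc); exact: le_lt_trans aM.
have [q /andP[q1 q2]] := outer_right good; apply: le_trans q2.
rewrite enum_leE//; suff : b < q by clear -jb; lia.
by rewrite -(enum_ltE inc); exact: lt_le_trans q1.
Qed.

Let small j : a <= j < b -> x (j + 1) - x j <= l.
Proof.
move=> jab; have [j0|j0] := leP 0 j; first by apply: small_right; move: jab j0; clear; lia.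
by apply: small_left; move: jab j0; clear; lia.
Qed.

Lemma trap_gap_small j : a <= j < b -> x (j + 1) - x j <= l - del.
Proof.
move=> jab; have jW : `|x j| <= W by apply: trap_window; move: jab; clear; lia.
rewrite leNgt; apply/negP => g; apply: (no_critical_gap good jW).
by rewrite g (le_trans (small jab))// lerDl.
Qed.

Lemma trap_gap_right : l + del <= x (b + 1) - x b.
Proof.
have bW : `|x b| <= W by apply: trap_window; move: ab; clear; lia.
rewrite leNgt; apply/negP => g; apply: (no_critical_gap good bW).
by rewrite (ltW g) andbT (le_lt_trans _ gapb)// gerBl.
Qed.

Lemma trap_gap_left : l + del <= x a - x (a - 1).
Proof.
have aW : `|x (a - 1)| <= W by apply: trap_window; move: ab; clear; lia.
rewrite leNgt; apply/negP => g; apply: (no_critical_gap good aW).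
by rewrite subrK (ltW g) andbT (le_lt_trans _ gapa)// gerBl.
Qed.

Let sites := [seq a + (i : nat)%:Z | i <- iota 0 `|b - a|%N.+1].

Let sites_uniq : uniq sites.
Proof. by rewrite map_inj_uniq ?iota_uniq// => i j; clear; lia. Qed.

Let sitesP j : j \in sites -> a <= j <= b.
Proof.
move=> /mapP[i]; rewrite mem_iota => ib ->; move: ib ab; clear; lia.
Qed.

(** The case k = 0 of [few_gaps], since every gap is positive. *)
Lemma trap_card : (`|b - a|%N.+1)%:R <= V.
Proof.
have -> : `|b - a|%N.+1 = size sites by rewrite size_map size_iota.
have := few_gaps good (leq0n L) sites_uniq; rewrite oppr0 expR0 mulr1.
apply=> j /sitesP jab; split.
  by apply: trap_window; move: jab; clear; lia.
by rewrite subr_gt0.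
Qed.

(** Layer by layer: exp g is at most the sum of exp (k + 1) over the integers k in [0, g[, and at
    most V exp (- k) gaps exceed k, so each of the L + 1 layers contributes at most exp 1 * V. *)
Lemma trap_sum_exp :
  \sum_(i < `|b - a|%N) expR (x (a + (i : nat)%:Z + 1) - x (a + (i : nat)%:Z))
  <= expR 1 * L.+1%:R * V.
Proof.
pose g (i : nat) := x (a + i%:Z + 1) - x (a + i%:Z).
have gi (i : 'I_`|b - a|) : expR (g i) <=
    \sum_(k < L.+1) expR 1 * expR (k : nat)%:R * ((k : nat)%:R < g i)%R%:R.
  have jab : a <= a + (i : nat)%:Z < b by have := ltn_ord i; move: ab; clear; lia.
  have gL : g i < L%:R := le_lt_trans (small jab) lL.
  have g0 : 0 < g i by rewrite subr_gt0.
  have exk : exists k : nat, g i <= k.+1%:R.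
    by exists L; rewrite ltW// (lt_trans gL)// ltr_nat.
  have [k gk kmin] := ex_minnP exk.
  have kg : k%:R < g i.
    case: k gk kmin => [//|k] gk kmin.
    by rewrite ltNge; apply/negP => /kmin; rewrite ltnn.
  have kL : (k < L.+1)%N by rewrite ltnS; apply: kmin; rewrite ltW// (lt_trans gL)// ltr_nat.
  rewrite (bigD1 (Ordinal kL))//= kg mulr1 -expRD.
  apply: le_trans (_ : expR (1 + k%:R) <= _); first by rewrite ler_expR [1 + _]addrC natr1.
  by rewrite lerDl sumr_ge0// => q _; rewrite !mulr_ge0// expR_ge0.
apply: le_trans (ler_sum _ (fun i _ => gi i)) _.
rewrite exchange_big /=.
apply: le_trans (_ : \sum_(k < L.+1) expR 1 * V <= _); last first.
  by rewrite sumr_const card_ord -[leLHS]mulr_natr mulrAC.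
apply: ler_sum => k _; rewrite -mulr_sumr -mulrA ler_wpM2l ?expR_ge0//.
rewrite -ler_pdivlMl ?expR_gt0// -expRN mulrC.
set s := [seq a + (i : nat)%:Z | i <- iota 0 `|b - a|%N & ((k : nat)%:R < g i)%R].
have -> : \sum_(i < `|b - a|) ((k : nat)%:R < g i)%R%:R = (size s)%:R :> R.
  rewrite size_map size_filter -sum1_count natr_sum -(big_mkord xpredT (fun i => ((k : nat)%:R < g i)%R%:R)).
  by rewrite /index_iota subn0 [RHS]big_mkcond; apply: eq_bigr => i _; case: (_ < _).
apply: (few_gaps good); first by rewrite -ltnS.
  rewrite map_inj_uniq ?filter_uniq ?iota_uniq// => i j; clear; lia.
move=> j /mapP[i]; rewrite mem_filter mem_iota => /andP[kg ib] ->; split => //.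
by apply: trap_window; move: ib ab; clear; lia.
Qed.

(** [no_early_gap] forces the right barrier beyond eps, so the short gaps found in [0, eps] lie
    inside the trap. *)
Lemma trap_short_gaps : exists s : seq int, [/\ uniq s,
  forall j, j \in s -> a <= j < b /\ x (j + 1) - x j <= 1 & Z <= (size s)%:R].
Proof.
have [s [us sP sZ]] := short_gaps good; exists s; split => // j /sP[/andP[j0 je] j1].
split=> //; rewrite -x0 enum_leE// in j0; apply/andP; split; first exact: le_trans j0.
rewrite ltNge; apply/negP => bj.
have : x (b + 1) - x b <= l.
  apply: (no_early_gap good); rewrite -{1}x0 enum_leE// b0 /=.
  by apply: le_trans je; rewrite enum_leE.
by rewrite leNgt gapb.
Qed.

End between.
End good_environment.

(** * The barriers as values of m_{n,-}^{-1} and m_{n,+}^{-1} *)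

Section barrier_location.
Variables (R : realType) (alpha : R) (x : int -> R) (n : nat) (t : R).
Hypothesis alpha1 : 1 < alpha.
Hypothesis incx : increasing_enum x.
Hypothesis x0 : x 0 = 0.
Hypothesis n0 : (0 < n)%N.
Hypothesis t0 : 0 < t.

Let inc : forall i, x i < x (i + 1). Proof. by case: incx. Qed.
Let nR : 0 < n%:R :> R. Proof. by rewrite ltr0n. Qed.
Let l := ln (n%:R * t).

(** The unbiased resistance of a gap g is exp (g^alpha), at least 1, so the first branch of [Lfun]
    applies and undoes the power. The level t thus corresponds to the gap length l = ln (n t). *)
Lemma Lfun_resistance (y z : R) : y < z -> Defs.Lfun alpha (resistance alpha y z) = expR (z - y).
Proof.
move=> yz; rewrite /resistance /conductance ifF; last by rewrite lt_eqF.
rewrite mul0r addr0 expRN invrK distrC ger0_norm ?subr_ge0 ?ltW//.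
rewrite /Defs.Lfun ifT; last by rewrite -expR0 ler_expR powR_ge0.
rewrite expRK -powRrM mulfV ?powRr1 ?subr_ge0 ?ltW// gt_eqF//.
exact: lt_trans ltr01 alpha1.
Qed.

Let barrier_gt (y z : R) : y < z ->
  (t < n%:R^-1 * Defs.Lfun alpha (resistance alpha y z)) = (l < z - y).
Proof.
move=> yz; rewrite Lfun_resistance// ltr_pdivlMl// -(lnK (x := n%:R * t)); last first.
  by rewrite posrE mulr_gt0.
by rewrite ltr_expR.
Qed.

Lemma m_plus_gt y : 0 <= y ->
  t < m_plus alpha x n y <-> exists j, 0 <= x j <= y * n%:R /\ l < x (j + 1) - x j.
Proof.
move=> y0; rewrite /m_plus; set E := [set _ | _ in _].
(* [sup] is 0 on unbounded sets, so boundedness has to be proved: finitely many atoms lie in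
   [0, y n], and a sum of positive terms bounds each of them. *)
have hE : has_sup E.
  split; first by exists (n%:R^-1 * Defs.Lfun alpha (resistance alpha (x 0) (x (0 + 1)))), 0 => //=;
    rewrite x0 lexx mulr_ge0// ltW.
  have [_ /(_ (y * n%:R))[J yJ] _] := incx.
  exists (n%:R^-1 * \sum_(k < `|J|.+1) expR (x ((k : nat)%:Z + 1) - x (k : nat)%:Z)) => _ [j /= /andP[j0 jy] <-].
  rewrite Lfun_resistance// ler_pM2l ?invr_gt0//.
  rewrite -x0 enum_leE// in j0.
  have jJ : j < J by rewrite -(enum_ltE inc); exact: le_lt_trans yJ.
  have jk : (`|j| < `|J|.+1)%N by move: j0 jJ; clear; lia.
  rewrite (bigD1 (Ordinal jk))//= gez0_abs// lerDl sumr_ge0// => q _; exact: expR_ge0.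
split=> [h|[j [jy gj]]].
  apply: contrapT => /forallNP none.
  move: h; apply/negP; rewrite -leNgt; apply: ge_sup; first by case: hE.
  move=> _ [j /= jy <-]; rewrite leNgt barrier_gt//; apply/negP => gj.
  by apply: (none j).
apply: lt_le_trans (_ : n%:R^-1 * Defs.Lfun alpha (resistance alpha (x j) (x (j + 1))) <= _).
  by rewrite barrier_gt.
by apply: sup_upper_bound => //; exists j.
Qed.

Lemma m_minus_gt y : 0 <= y ->
  t < m_minus alpha x n y <-> exists j, - (y * n%:R) <= x j <= 0 /\ l < x j - x (j - 1).
Proof.
move=> y0; rewrite /m_minus; set E := [set _ | _ in _].
have incB j : x (j - 1) < x j by rewrite -[X in _ < x X](subrK 1).
have hE : has_sup E.
  split; first by exists (n%:R^-1 * Defs.Lfun alpha (resistance alpha (x (0 - 1)) (x 0))), 0 => //=;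
    rewrite x0 lexx andbT oppr_le0 mulr_ge0// ltW.
  have [_ _ /(_ (- (y * n%:R)))[J yJ]] := incx.
  exists (n%:R^-1 * \sum_(k < `|J|.+1) expR (x (- (k : nat)%:Z) - x (- (k : nat)%:Z - 1))) => _ [j /= /andP[jy j0] <-].
  rewrite Lfun_resistance// ler_pM2l ?invr_gt0//.
  rewrite -x0 enum_leE// in j0.
  have jJ : J < j by rewrite -(enum_ltE inc); exact: lt_le_trans yJ _.
  have jk : (`|j| < `|J|.+1)%N by move: j0 jJ; clear; lia.
  rewrite (bigD1 (Ordinal jk))//=.
  have -> : - `|j|%N%:Z = j by move: j0; clear; lia.
  by rewrite lerDl sumr_ge0// => q _; exact: expR_ge0.
split=> [h|[j [jy gj]]].
  apply: contrapT => /forallNP none.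
  move: h; apply/negP; rewrite -leNgt; apply: ge_sup; first by case: hE.
  move=> _ [j /= jy <-]; rewrite leNgt barrier_gt//; apply/negP => gj.
  by apply: (none j).
apply: lt_le_trans (_ : n%:R^-1 * Defs.Lfun alpha (resistance alpha (x (j - 1)) (x j)) <= _).
  by rewrite barrier_gt.
by apply: sup_upper_bound => //; exists j.
Qed.

Let inf_ray (P : R -> Prop) (c : R) : 0 <= c ->
  (forall y, 0 <= y -> P y <-> c <= y) -> inf [set y | 0 <= y /\ P y] = c.
Proof.
move=> c0 Pc; have -> : [set y | 0 <= y /\ P y] = `[c, +oo[%classic.
  apply/seteqP; split => y /=; rewrite in_itv /= andbT; first by move=> [y0 /(Pc _ y0)].
  by move=> cy; have y0 := le_trans c0 cy; split => //; exact/(Pc _ y0).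
by rewrite inf_itv// bnd_simp.
Qed.

Lemma m_plus_invE b : 0 <= b -> l < x (b + 1) - x b ->
  (forall j, 0 <= j < b -> x (j + 1) - x j <= l) ->
  m_plus_inv alpha x n t = n%:R^-1 * x b.
Proof.
move=> b0 gb small; have xb0 : 0 <= x b by rewrite -x0 enum_leE.
apply: inf_ray; first by rewrite mulr_ge0// invr_ge0 ltW.
move=> y y0; rewrite ler_pdivrMl// mulrC; apply: (iff_trans (m_plus_gt y0)).
split=> [[j [/andP[j0 jy] gj]]|by_]; last by exists b; rewrite xb0.
apply: le_trans jy; rewrite enum_leE// leNgt; apply/negP => jb.
rewrite -x0 enum_leE// in j0.
by move: gj; apply/negP; rewrite -leNgt small// j0.
Qed.

Lemma m_minus_invE a : a <= 0 -> l < x a - x (a - 1) ->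
  (forall j, a <= j < 0 -> x (j + 1) - x j <= l) ->
  m_minus_inv alpha x n t = n%:R^-1 * x a.
Proof.
move=> a0 ga small; have xa0 : x a <= 0 by rewrite -x0 enum_leE.
rewrite /m_minus_inv; apply/eqP; rewrite eqr_oppLR -mulrN; apply/eqP.
apply: inf_ray; first by rewrite mulr_ge0 ?oppr_ge0// invr_ge0 ltW.
move=> y y0; rewrite ler_pdivrMl// mulrC lerNl; apply: (iff_trans (m_minus_gt y0)).
split=> [[j [/andP[jy j0] gj]]|ya]; last by exists a; rewrite ya.
apply: le_trans jy _; rewrite enum_leE// leNgt; apply/negP => aj.
rewrite -x0 enum_leE// in j0.
move: gj; apply/negP; rewrite -leNgt -{1}(subrK 1 j); apply: small.
by move: aj j0; clear; lia.
Qed.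

End barrier_location.

(** * Poisson and Palm estimates *)

(** [F] is an arbitrary nonnegative function, compared with a multiple of an indicator through
    [le_integral_nonneg]; this suits the counting functions of the Palm formula. *)
Lemma markov_inequality_ext d (T : measurableType d) (R : realType)
    (mu : {measure set T -> \bar R}) (a c : R) (F : T -> \bar R) (E : set T) :
  0 < a -> measurable E -> (forall x, 0 <= F x)%E -> (forall x, E x -> (a%:E <= F x)%E) ->
  (\int[mu]_x F x <= c%:E)%E -> (mu E <= (c / a)%:E)%E.
Proof.
move=> a0 mE F0 EF Fc.
have : (\int[mu]_x (\sum_(i <- [:: tt]) a * \1_E x)%R%:E <= c%:E)%E.
  apply: le_trans Fc; apply: le_integral_nonneg => x; rewrite big_seq1.
    by rewrite lee_fin mulr_ge0// ltW.
  rewrite indicE; case: (boolP (x \in E)) => xE; last by rewrite mulr0 F0.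
  by rewrite mulr1; apply: EF; rewrite inE in xE.
rewrite (@integral_sum_indic _ _ _ _ _ _ (fun=> a) (fun=> E))//; last by move=> _; exact: ltW.
by rewrite big_seq1 muleC EFinM -lee_pdivlMr.
Qed.

Section counting_lemmas.
Variables (R : realType) (I : choiceType).
Implicit Types A B : set I.
Local Notation counting := (@counting I R).

Lemma counting_ge0 A : (0 <= counting A)%E.
Proof. by rewrite /counting; case: ifP => _; rewrite ?leey// lee_fin. Qed.

Lemma counting_mono A B : A `<=` B -> (counting A <= counting B)%E.
Proof.
move=> AB; have [fB|fB] := pselect (finite_set B); last first.
  by rewrite [X in (_ <= X)%E]/counting_measure.counting asboolF// leey.
rewrite /counting !asboolT//; last exact: sub_finite_set fB.
rewrite lee_fin ler_nat finmap.fsubset_leq_card// -fset_set_sub//.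
exact: sub_finite_set fB.
Qed.

Lemma counting_seq (s : seq I) : uniq s -> counting [set` s] = (size s)%:R%:E.
Proof.
move=> us; rewrite /counting asboolT; last exact: finite_seq.
congr (_%:R%:E); apply: perm_size; apply: uniq_perm => //.
move=> i; rewrite in_fset_set; last exact: finite_seq.
by apply/idP/idP; rewrite inE.
Qed.

Lemma counting_ge A (s : seq I) : uniq s -> (forall i, i \in s -> A i) ->
  ((size s)%:R%:E <= counting A)%E.
Proof. by move=> us sA; rewrite -counting_seq//; exact: counting_mono. Qed.

Lemma counting_eqP A (k : nat) : counting A = k%:R%:E <->
  exists s : seq I, uniq s /\ size s = k /\ forall i, A i <-> i \in s.
Proof.
split=> [|[s [us [<- sA]]]]; last first.
  by rewrite -counting_seq//; congr counting; apply/seteqP; split => i /sA.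
rewrite /counting; case: asboolP => [fA|//] [] /eqP; rewrite eqr_nat => /eqP <-.
exists (finmap.enum_fset (fset_set A)); split; first exact: finmap.fset_uniq.
split=> // i; rewrite in_fset_set//; split; first by move=> Ai; rewrite inE.
by rewrite inE.
Qed.

Lemma counting_eq0P A : counting A = 0%:R%:E <-> forall i, ~ A i.
Proof.
split=> [/counting_eqP[s [_ [/size0nil -> sA]]] i /sA//|nA].
apply/counting_eqP; exists [::]; split => //; split=> // i.
by split=> // /nA.
Qed.

Lemma counting_finite A : finite_set A -> exists k : nat, counting A = k%:R%:E.
Proof. by move=> fA; rewrite /counting asboolT//; exists (size (finmap.enum_fset (fset_set A))). Qed.

End counting_lemmas.

Section measurable_counting.
Context d (T : measurableType d) (R : realType) (I : countType).
Variable P : I -> T -> Prop.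
Hypothesis mP : forall i, measurable [set s | P i s].

(** Finite lists over a countable type are countable, so an exact count is a countable union of
    events. *)
Lemma measurable_counting_eq (k : nat) :
  measurable [set s | counting [set i | P i s] = k%:R%:E :> \bar R].
Proof.
rewrite (_ : mkset _ = [set s | exists l : seq I, uniq l /\ size l = k /\
    forall i, (P i s -> i \in l) /\ (i \in l -> P i s)]).
  apply: measurable_exists => l; apply: measurable_and; first exact: measurable_constant.
  apply: measurable_and; first exact: measurable_constant.
  apply: measurable_forall => i; apply: measurable_and; apply: measurable_imp => //;
    exact: measurable_constant.
by apply/seteqP; split => s /= /counting_eqP.
Qed.

Lemma measurable_seq_exists (Q : seq I -> Prop) :
  measurable [set s | exists l : seq I, [/\ uniq l, forall i, i \in l -> P i s & Q l]].
Proof.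
apply: measurable_exists => l.
rewrite (_ : mkset _ = [set s | uniq l /\ ((forall i, i \in l -> P i s) /\ Q l)]).
  apply: measurable_and; first exact: measurable_constant.
  apply: measurable_and; last exact: measurable_constant.
  apply: measurable_forall => i; apply: measurable_imp => //.
  exact: measurable_constant.
by apply/seteqP; split => s /=; [move=> []|move=> [? []]].
Qed.

End measurable_counting.

Section poisson_estimates.
Context (R : realType) d (S : measurableType d).
Variables (Q : probability S R) (y : int -> S -> R).
Hypothesis hy : unit_poisson_process Q y.

Let my i : measurable_fun setT (y i). Proof. by case: hy. Qed.
Let incy s : increasing_enum (y ^~ s). Proof. by case: hy => _ /(_ s). Qed.

Lemma finite_atoms s (a b : R) : finite_set [set i | y i s \in `[a, b[].
Proof.
have [inc /(_ b)[j bj] /(_ a)[i ia]] := incy s.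
apply: (@sub_finite_set _ _ [set` [seq i + k%:Z | k <- iota 0 `|j - i|%N]]); last exact: finite_seq.
move=> q /=; rewrite in_itv /= => /andP[aq qb].
have iq : i < q by rewrite -(enum_ltE inc); exact: lt_le_trans aq.
have qj : q < j by rewrite -(enum_ltE inc); exact: lt_trans bj.
apply/mapP; exists `|q - i|%N; last by clear -iq; lia.
by rewrite mem_iota add0n; clear -iq qj; lia.
Qed.

Definition atoms (a b : R) (s : S) : set int := [set i | y i s \in `[a, b[].

Definition has_count (a b : R) (k : nat) : set S :=
  [set s | counting (atoms a b s) = k%:R%:E :> \bar R].

Let measurable_atom a b i : measurable [set s | y i s \in `[a, b[].
Proof.
rewrite (_ : mkset _ = [set s | a <= y i s /\ y i s < b]).
  by apply: measurable_and; [exact: measurable_le|exact: measurable_lt].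
by apply/seteqP; split => s /=; rewrite in_itv /=; [move=> /andP[]|move=> [-> ->]].
Qed.

Lemma measurable_has_count a b k : measurable (has_count a b k).
Proof. by apply: measurable_counting_eq => i; exact: measurable_atom. Qed.

Lemma has_count0P a b s : has_count a b 0 s <-> forall i, ~ (a <= y i s < b).
Proof.
rewrite /has_count /=; split => [/counting_eq0P h i yi|h].
  by apply: (h i); rewrite /atoms /= in_itv.
by apply/counting_eq0P => i; rewrite /atoms /= in_itv; exact: h.
Qed.

Lemma has_counts_prob (m : nat) (a b : 'I_m -> R) (k : 'I_m -> nat) :
  (forall i, a i <= b i) ->
  (forall i j, i != j -> b i <= a j \/ b j <= a i) ->
  Q [set s | forall i, has_count (a i) (b i) (k i) s] =
  (\prod_(i < m) poisson_mass (b i - a i) (k i))%:E.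
Proof.
move=> ab dis; case: hy => _ _ /(_ m (fun i => `[a i, b i[%classic) k) h.
have len i : lebesgue_measure (`[a i, b i[%classic : set R) = (b i - a i)%:E.
  rewrite lebesgue_measure_itv /= lte_fin; case: ltP => // ba.
  by have -> : b i - a i = 0 by apply/eqP; rewrite subr_eq0 eq_le ab ba.
rewrite [LHS]h.
- by congr EFin; apply: eq_bigr => i _; rewrite len.
- by move=> i; exact: measurable_itv.
- by move=> i; rewrite len ltry.
move=> i j /dis ij; rewrite -subset0 => z [] /=.
rewrite !in_itv /= => /andP[z1 z2] /andP[z3 z4].
by case: ij => h'; [have := lt_le_trans z2 (le_trans h' z3)|
   have := lt_le_trans z4 (le_trans h' z1)]; rewrite ltxx.
Qed.

Lemma has_count_prob a b k : a <= b ->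
  Q (has_count a b k) = (poisson_mass (b - a) k)%:E.
Proof.
move=> ab; have := @has_counts_prob 1 (fun=> a) (fun=> b) (fun=> k).
rewrite big_ord1 => <-//.
- by congr (Q _); apply/seteqP; split => s /= => [h i|]; [exact: h|apply; exact: ord0].
- by move=> i j; rewrite !ord1 eqxx.
Qed.

Lemma poisson_mass0 (r : R) : poisson_mass r 0 = expR (- r).
Proof. by rewrite /poisson_mass expr0 mulr1 fact0 divr1. Qed.

(** Chernoff's bound with parameter 4: (4 r)^k / k! is one term of the series of exp (4 r). *)
Lemma poisson_mass_le (r : R) k : 0 <= r ->
  poisson_mass r k <= expR (3 * r) * (4 ^+ k)^-1.
Proof.
move=> r0; rewrite /poisson_mass.
have : (4 * r) ^+ k / k`!%:R <= expR (4 * r).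
  case: k => [|k]; first by rewrite expr0 fact0 divr1 -expR0 ler_expR mulr_ge0.
  apply: le_trans (expR_ge1Dxn k _); first by rewrite lerDr.
  by rewrite mulr_ge0.
rewrite exprMn => h.
have -> : 3 * r = - r + 4 * r by ring.
rewrite expRD -!mulrA ler_wpM2l ?expR_ge0// ler_pdivlMr ?exprn_gt0//.
by rewrite mulrC mulrA.
Qed.

Lemma measurable_counting_ge a b k :
  measurable [set s | (k%:R%:E <= counting (atoms a b s) :> \bar R)%E].
Proof.
rewrite (_ : mkset _ = [set s | ~ exists q : nat, (q < k)%N /\ has_count a b q s]).
  apply: measurable_not; apply: measurable_exists => q.
  by apply: measurable_and; [exact: measurable_constant|exact: measurable_has_count].
apply/seteqP; split => s /=; rewrite /has_count /=.
  by move=> h [q [qk qE]]; move: h; rewrite qE lee_fin ler_nat leqNgt qk.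
move=> nk; have [q qE] : exists q : nat, counting (atoms a b s) = q%:R%:E :> \bar R :=
  counting_finite R (finite_atoms s a b).
by rewrite qE lee_fin ler_nat leqNgt; apply/negP => kK; apply: nk; exists q.
Qed.

Lemma count_tail a b (K : nat) : a <= b ->
  (Q [set s | K%:R%:E <= counting (atoms a b s) :> \bar R] <=
    (2 * expR (3 * (b - a)) * (4 ^+ K)^-1)%:E)%E.
Proof.
move=> ab; set A := mkset _; pose C := expR (3 * (b - a)).
have C0 : 0 <= C by exact: expR_ge0.
have AE : A = \bigcup_k has_count a b (K + k).
  apply/seteqP; split => s /=.
    move=> Ks; have [k kE] : exists k : nat, counting (atoms a b s) = k%:R%:E :> \bar R :=
      counting_finite R (finite_atoms s a b).
    move: Ks; rewrite /A /= kE lee_fin ler_nat => Kk.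
    by exists (k - K)%N => //; rewrite /has_count /= subnKC.
  by move=> [k _]; rewrite /has_count /A /= => ->; rewrite lee_fin ler_nat leq_addr.
have mA : measurable A.
  by rewrite AE; apply: bigcup_measurable => k _; exact: measurable_has_count.
apply: le_trans (_ : \sum_(k <oo) Q (has_count a b (K + k)) <= _)%E.
  apply: measure_sigma_subadditive => //; last by rewrite -AE.
  by move=> k; exact: measurable_has_count.
apply: lime_le; first by apply: is_cvg_nneseries => k _ _.
near=> m.
apply: le_trans (_ : \sum_(0 <= k < m) (C * (4 ^+ K)^-1 * (4 ^+ k)^-1)%:E <= _)%E.
  apply: lee_sum => k _; rewrite has_count_prob// lee_fin.
  apply: le_trans (poisson_mass_le _ _) _; first by rewrite subr_ge0.
  by rewrite exprD invfM mulrA.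
rewrite sumEFin lee_fin -mulr_sumr.
have -> : 2 * expR (3 * (b - a)) * (4 ^+ K)^-1 = C * (4 ^+ K)^-1 * 2.
  by rewrite /C; ring.
rewrite ler_wpM2l//; first by rewrite mulr_ge0// invr_ge0 exprn_ge0.
have geo (q : nat) : \sum_(0 <= k < q) (4 ^+ k : R)^-1 <= 2 - 2 * (4 ^+ q)^-1.
  elim: q => [|q IH]; first by rewrite big_nil expr0 invr1; lra.
  rewrite big_nat_recr//=; apply: le_trans (lerD IH (lexx _)) _.
  rewrite exprS invfM; have : 0 <= (4 ^+ q : R)^-1 by rewrite invr_ge0 exprn_ge0.
  by move: ((4 ^+ q)^-1) => z z0; lra.
apply: le_trans (geo m) _; rewrite gerBl mulr_ge0// invr_ge0 exprn_ge0//.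
Unshelve. all: by end_near. Qed.

End poisson_estimates.

Section sequence_space.
Variable R : realType.

Definition seq_generators : set (set (int -> R)) :=
  [set A | exists i (B : set R), measurable B /\ A = [set x | B (x i)]].

(** Makes configurations with the sigma-algebra [measurable_seqs] a measurable type, so that the
    lemmas on measurable predicates apply to sets of configurations. *)
Definition seq_space := g_sigma_algebraType seq_generators.

Lemma measurable_coordinate i : measurable_fun setT (fun x : seq_space => (x : int -> R) i).
Proof.
move=> _ B mB; rewrite setTI; apply: sub_sigma_algebra.
by exists i, B; split => //; rewrite /measurable.
Qed.

Lemma measurable_gap i : measurable_fun setT
  (fun x : seq_space => (x : int -> R) (i + 1) - (x : int -> R) i).
Proof. by apply: measurable_funB; exact: measurable_coordinate. Qed.

End sequence_space.

Lemma expR1_le4 (R : realType) : expR 1 <= 4 :> R.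
Proof.
have e2 : expR (2^-1) <= 2 :> R.
  rewrite -[leLHS]invrK -[leRHS]invrK lef_pV2 ?posrE ?invr_gt0 ?expR_gt0// -expRN.
  by apply: le_trans (expR_ge1Dx _); lra.
have -> : (1 : R) = 2%:R * 2^-1 by field.
rewrite expRM_natl; apply: le_trans (_ : 2 ^+ 2 <= _); last by rewrite expr2; lra.
by rewrite lerXn2r ?nnegrE ?expR_ge0.
Qed.

Section poisson_events.
Context (R : realType) d (S : measurableType d).
Variables (Q : probability S R) (y : int -> S -> R).
Hypothesis hy : unit_poisson_process Q y.

Let my i : measurable_fun setT (y i). Proof. by case: hy. Qed.
Let incy s : increasing_enum (y ^~ s). Proof. by case: hy => _ /(_ s). Qed.
Let mhc a b k := measurable_has_count hy a b k.

Let poisson11 : poisson_mass (1 : R) 1 = expR (-1).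
Proof. by rewrite /poisson_mass expr1 mulr1 -[1`!]/1%N divr1. Qed.

(* The events {one atom in [a + i, a + i + 1), none in the next L cells} have
   probability exp (-1 - L); they are independent when they involve disjoint
   intervals and incompatible otherwise, so the second moment method applies. *)
Lemma no_empty_run (a : R) (m L : nat) : (0 < m)%N ->
  (Q [set s | forall i, (i < m)%N -> ~ has_count y (a + i.+1%:R) (a + (i.+1 + L)%:R) 0 s]
   <= (4 / (m%:R * expR (- L.+1%:R)))%:E)%E.
Proof.
move=> m0.
pose E (i : 'I_m) := has_count y (a + i%:R) (a + i.+1%:R) 1 `&`
  has_count y (a + i.+1%:R) (a + (i.+1 + L)%:R) 0.
have mE i : measurable (E i) by apply: measurableI; exact: mhc.
have le1 (k : nat) : a + k%:R <= a + k.+1%:R by rewrite lerD2l ler_nat.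
have leL (k : nat) : a + k.+1%:R <= a + (k.+1 + L)%:R by rewrite lerD2l ler_nat leq_addr.
have QE i : Q (E i) = (expR (- L.+1%:R))%:E.
  pose aa (q : 'I_2) := if q == ord0 then a + i%:R else a + i.+1%:R.
  pose bb (q : 'I_2) := if q == ord0 then a + i.+1%:R else a + (i.+1 + L)%:R.
  pose kk (q : 'I_2) := if q == ord0 then 1%N else 0%N.
  have := @has_counts_prob _ _ _ _ _ hy 2 aa bb kk.
  rewrite big_ord_recl big_ord1 /aa /bb /kk /= => h.
  have -> : E i = [set s | forall q : 'I_2,
     has_count y (aa q) (bb q) (kk q) s].
    apply/seteqP; split => s /=; rewrite /aa /bb /kk.
      by move=> [h1 h2] q; case: eqP.
    by move=> hq; split; [exact: (hq ord0)|exact: (hq ord_max)].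
  rewrite h.
  - have -> : a + i.+1%:R - (a + i%:R) = 1 by rewrite -natr1; ring.
    have -> : a + (i.+1 + L)%:R - (a + i.+1%:R) = L%:R by rewrite natrD; ring.
    by rewrite poisson11 poisson_mass0 -expRD -opprD nat1r.
  - by move=> q; case: eqP.
  - move=> [[|[|q]] hq] [[|[|q']] hq']; rewrite -!val_eqE //= => _;
      first [by left | by right].
pose p := expR (- L.+1%:R) : R.
have p0 : 0 < p by exact: expR_gt0.
have pair (i j : 'I_m) : (i < j)%N -> (Q (E i `&` E j) <= (p ^+ 2)%:E)%E.
  move=> ij; have [jL|Lj] := leqP j (i + L)%N.
    rewrite (_ : E i `&` E j = set0) ?measure0 ?lee_fin ?exprn_ge0 ?ltW//.
    rewrite -subset0 => s [] [_ /has_count0P h1] [+ _].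
    rewrite /has_count /= => /counting_eqP[l [_ [sl lP]]].
    case: l sl lP => [//|q l] _ /(_ q); rewrite mem_head => -[_ /(_ isT)].
    rewrite /atoms /= in_itv /= => /andP[q1 q2]; apply: (h1 q).
    rewrite (le_trans _ q1) ?lerD2l ?ler_nat//=.
    by rewrite (lt_le_trans q2)// lerD2l ler_nat addSn ltnS.
  pose aa (q : 'I_4) := nth 0 [:: a + i%:R; a + i.+1%:R; a + j%:R; a + j.+1%:R] q.
  pose bb (q : 'I_4) := nth 0 [:: a + i.+1%:R; a + (i.+1 + L)%:R; a + j.+1%:R; a + (j.+1 + L)%:R] q.
  pose kk (q : 'I_4) := nth 0%N [:: 1%N; 0%N; 1%N; 0%N] q.
  have := @has_counts_prob _ _ _ _ _ hy 4 aa bb kk.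
  rewrite !big_ord_recl big_ord0 /aa /bb /kk /= => h.
  have -> : E i `&` E j = [set s | forall q : 'I_4,
     has_count y (aa q) (bb q) (kk q) s].
    apply/seteqP; split => s /=; rewrite /aa /bb /kk.
      by move=> [[h1 h2] [h3 h4]] [[|[|[|[|q]]]] hq].
    move=> hq; split; split; [exact: (hq (@Ordinal 4 0 isT))|exact: (hq (@Ordinal 4 1 isT))|exact: (hq (@Ordinal 4 2 isT))|exact: (hq (@Ordinal 4 3 isT))].
  have iLj : a + (i.+1 + L)%:R <= a + j%:R by rewrite lerD2l ler_nat addSn.
  rewrite h.
  - have -> : a + i.+1%:R - (a + i%:R) = 1 by rewrite -natr1; ring.
    have -> : a + (i.+1 + L)%:R - (a + i.+1%:R) = L%:R by rewrite natrD; ring.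
    have -> : a + j.+1%:R - (a + j%:R) = 1 by rewrite -natr1; ring.
    have -> : a + (j.+1 + L)%:R - (a + j.+1%:R) = L%:R by rewrite natrD; ring.
    by rewrite poisson11 poisson_mass0 mulr1 !mulrA -!expRD /p -expRM_natl lee_fin ler_expR -natr1; lra.
  - by move=> [[|[|[|[|q]]]] hq] //=.
  - have ij' : a + i.+1%:R <= a + j%:R := le_trans (leL i) iLj.
    have iLj' : a + (i.+1 + L)%:R <= a + j.+1%:R := le_trans iLj (le1 j).
    have ij'' := le_trans ij' (le1 j).
    move=> [[|[|[|[|q]]]] hq] [[|[|[|[|q']]]] hq'] //=; rewrite -?val_eqE//= => _;
      first [by left | by right].
have := @second_moment_lower_tail _ _ _ Q m E p 0 m0 p0 mE.
rewrite mulr0 addr0 => h; apply: le_trans (h _ _ _).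
- apply: le_measure; rewrite ?inE.
  + apply: measurable_forall => i; apply: measurable_imp; first exact: measurable_constant.
    by apply: measurable_not; exact: mhc.
  + by apply: measurable_le => //; apply: measurable_sum => i; exact: measurable_indic.
  + move=> s /= hs; rewrite big1; first by rewrite divr_ge0// mulr_ge0// ltW.
    by move=> i _; rewrite indicE memNset// => -[_]; exact: hs.
- by move=> i; rewrite QE.
- by move=> i; rewrite QE subr0 mulr1.
- move=> i j ij; have [lij|lji] := ltnP i j; first exact: pair.
  by rewrite setIC; apply: pair; rewrite ltn_neqAle lji andbT eq_sym.
Qed.

Let poisson12 : poisson_mass (1 : R) 2 = expR (-1) / 2.
Proof. by rewrite /poisson_mass expr1n mulr1. Qed.

(** Two atoms in one unit cell force a gap of length at most 1. The cells start at 1 so that they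
    lie to the right of any atom of [0, 1[ taken as the new origin. *)
Definition crowded_cells (m : nat) (s : S) : R :=
  \sum_(i < m) \1_(has_count y (i.+1%:R) (i.+2%:R) 2) s.

Lemma few_crowded_cells (m : nat) : (0 < m)%N ->
  (Q [set s | (crowded_cells m s <= m%:R * (expR (-1) / 2) / 2)%R]
   <= (4 / (m%:R * (expR (-1) / 2)))%:E)%E.
Proof.
move=> m0; pose E (i : 'I_m) := has_count y (i.+1%:R) (i.+2%:R) 2.
have mE i : measurable (E i) by exact: mhc.
have len (i : nat) : i.+2%:R - i.+1%:R = 1 :> R by rewrite -(natr1 i.+1); ring.
have QE i : Q (E i) = (expR (-1) / 2)%:E.
  by rewrite /E (has_count_prob hy) ?ler_nat// len poisson12.
have := @second_moment_lower_tail _ _ _ Q m E (expR (-1) / 2) 0 m0 _ mE.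
rewrite mulr0 addr0; apply.
- by rewrite divr_gt0// expR_gt0.
- by move=> i; rewrite QE.
- by move=> i; rewrite QE subr0 mulr1.
move=> i j ij.
pose aa (q : 'I_2) : R := if q == ord0 then i.+1%:R else j.+1%:R.
pose bb (q : 'I_2) : R := if q == ord0 then i.+2%:R else j.+2%:R.
have := @has_counts_prob _ _ _ _ _ hy 2 aa bb (fun=> 2%N).
rewrite big_ord_recl big_ord1 /aa /bb /= => h.
have -> : E i `&` E j = [set s | forall q : 'I_2, has_count y (aa q) (bb q) 2 s].
  apply/seteqP; split => s /=; rewrite /aa /bb.
    by move=> [h1 h2] q; case: eqP.
  by move=> hq; split; [exact: (hq ord0)|exact: (hq ord_max)].
have dis : i.+2%:R <= j.+1%:R :> R \/ j.+2%:R <= i.+1%:R :> R.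
  rewrite !ler_nat; have [lij|lji] := ltnP i j; [left; exact: lij|right].
  by rewrite ltnS ltn_neqAle lji andbT eq_sym.
rewrite h.
- by rewrite !len poisson12 expr2.
- by move=> q; case: eqP => _; rewrite ler_nat.
- move=> [[|[|q]] hq] [[|[|q']] hq']; rewrite -!val_eqE //= => _.
  by case: dis; auto.
Qed.

Lemma crowded_cells_gaps (m : nat) (s : S) : exists l : seq int, [/\ uniq l,
  forall j, j \in l -> 1 <= y j s < m.+1%:R /\ y (j + 1) s - y j s <= 1
  & crowded_cells m s <= (size l)%:R].
Proof.
have [inc _ _] := incy s.
elim: m => [|m [l [ul lP lm]]].
  by exists [::]; split => //; rewrite /crowded_cells big_ord0.
rewrite /crowded_cells big_ord_recr /=.
have [c2|nc2] := pselect (has_count y (m.+1%:R) (m.+2%:R) 2 s); last first.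
  exists l; split => //.
    move=> j /lP[/andP[j1 jm] jg]; split => //; rewrite j1 (lt_le_trans jm)//.
    by rewrite ler_nat.
  by rewrite indicE memNset// addr0.
move: (c2); rewrite /has_count /= => /counting_eqP[lp [up [slp lpP]]].
case: lp up slp lpP => [//|p [//|q [|//]]] up _ lpP.
have cell i : m.+1%:R <= y i s < m.+2%:R <-> i \in [:: p; q].
  by rewrite -lpP /atoms /= in_itv.
(* The smaller of the two atoms has its successor in the same cell. *)
have [j [jc jc1]] : exists j, m.+1%:R <= y j s < m.+2%:R /\ m.+1%:R <= y (j + 1) s < m.+2%:R.
  have pc : m.+1%:R <= y p s < m.+2%:R by apply/cell; rewrite mem_head.
  have qc : m.+1%:R <= y q s < m.+2%:R by apply/cell; rewrite !inE eqxx orbT.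
  have mid i i' : m.+1%:R <= y i s < m.+2%:R -> m.+1%:R <= y i' s < m.+2%:R -> i < i' ->
     m.+1%:R <= y (i + 1) s < m.+2%:R.
    move=> /andP[i1 i2] /andP[i3 i4] ii'; rewrite (le_trans i1) ?ltW//=.
    by apply: le_lt_trans i4; rewrite (enum_leE inc); clear -ii'; lia.
  case: (ltgtP p q) => [pq|qp|pq].
  - by exists p; split => //; exact: (mid p q).
  - by exists q; split => //; exact: (mid q p).
  - by move: up; rewrite pq /= mem_head.
exists (j :: l); split => /=.
- rewrite ul andbT; apply/negP => /lP[/andP[_ jm] _].
  by move: jc; rewrite leNgt jm.
- move=> i; rewrite inE => /predU1P[->|/lP[/andP[i1 im] ig]].
    case/andP: jc => j1 j2; split.
      by rewrite (le_trans _ j1) ?j2// ler1n.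
    case/andP: jc1 => _ j3; rewrite lerBlDr (le_trans (ltW j3))//.
    by rewrite -(natr1 m.+1) addrC lerD2l.
  by split => //; rewrite i1 (lt_le_trans im)// ler_nat.
rewrite -[X in _ <= X]natr1 lerD// indicE; by case: (_ \in _).
Qed.

Lemma void_prob a b : a <= b ->
  Q [set s | forall i, ~ (a <= y i s < b)] = (expR (- (b - a)))%:E.
Proof.
move=> ab; rewrite -(poisson_mass0 (b - a)) -(has_count_prob hy)//.
by congr (Q _); apply/seteqP; split => s /has_count0P.
Qed.

(** With 4^(-K) <= exp (- K), [count_tail] gives the exponent 3 (r + 2) - (r + 1) D - 1, at most (r
    + 1) (6 - D); for D > 6 the resulting series in r has ratio at most 1/2. *)
Lemma clustered_prob (a : nat -> R) (D : nat) : (6 < D)%N ->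
  (Q [set s | exists r : nat, ((r.+1 * D).+1%:R%:E <=
     counting (atoms y (a r) (a r + r.+2%:R) s) :> \bar R)%E]
   <= (4 * expR (6 - D%:R))%:E)%E.
Proof.
move=> D6; pose F r := [set s | ((r.+1 * D).+1%:R%:E <=
     counting (atoms y (a r) (a r + r.+2%:R) s) :> \bar R)%E].
have ar r : a r <= a r + r.+2%:R by rewrite lerDl.
have c1 : 6 - D%:R <= -1 :> R.
  by have : 7%:R <= D%:R :> R; [rewrite ler_nat|lra].
have mF r : measurable (F r) by exact: (measurable_counting_ge hy).
have FE : [set s | exists r : nat, ((r.+1 * D).+1%:R%:E <=
     counting (atoms y (a r) (a r + r.+2%:R) s) :> \bar R)%E] = \bigcup_r F r.
  by apply/seteqP; split => s /= [r]; [exists r|move=> _ ?; exists r].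
rewrite FE; apply: le_trans (_ : \sum_(r <oo) Q (F r) <= _)%E.
  by apply: measure_sigma_subadditive => //; exact: bigcup_measurable.
apply: lime_le; first by apply: is_cvg_nneseries => r _ _.
near=> m.
pose c : R := 6 - D%:R.
apply: le_trans (_ : \sum_(0 <= r < m) (2 * expR c * 2^-1 ^+ r)%:E <= _)%E.
  apply: lee_sum => r _.
  apply: le_trans (count_tail hy _ (ar r)) _; rewrite lee_fin addrAC subrr add0r.
  rewrite -!mulrA ler_pM2l//.
  have e4 (K : nat) : (4 ^+ K)^-1 <= expR (- K%:R) :> R.
    have -> : - K%:R = K%:R * (-1) :> R by rewrite mulrN1.
    rewrite expRM_natl expRN exprVn lef_pV2 ?posrE ?exprn_gt0 ?expR_gt0//.
    rewrite lerXn2r ?nnegrE ?expR_ge0//.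
    exact: expR1_le4.
  apply: le_trans (ler_wpM2l (expR_ge0 _) (e4 _)) _.
  have half (q : nat) : expR (q%:R * c) <= 2^-1 ^+ q.
    rewrite expRM_natl lerXn2r ?nnegrE ?expR_ge0//.
    apply: le_trans (_ : expR (-1) <= _); first by rewrite ler_expR.
    by rewrite expRN lef_pV2 ?posrE ?expR_gt0//; have := expR_ge1Dx (1 : R); lra.
  apply: le_trans (ler_wpM2l (expR_ge0 c) (half r)).
  rewrite -!expRD ler_expR /c -(natr1 (r.+1 * D)) natrM -!(natr1 r.+1) -!(natr1 r).
  have : 0 <= r%:R :> R by []. 
  nra.
rewrite sumEFin lee_fin -mulr_sumr.
have -> : 4 * expR (6 - D%:R) = 2 * expR c * 2 by rewrite /c; ring.
rewrite ler_wpM2l//.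
have geo (q : nat) : \sum_(0 <= r < q) (2^-1 ^+ r : R) <= 2 - 2 * 2^-1 ^+ q.
  elim: q => [|q IH]; first by rewrite big_nil expr0; lra.
  rewrite big_nat_recr//=; apply: le_trans (lerD IH (lexx _)) _.
  by rewrite exprS; lra.
apply: le_trans (geo m) _; rewrite gerBl mulr_ge0// exprn_ge0//.
Unshelve. all: by end_near. Qed.

End poisson_events.

(** * Palm calculus and the law of a gap *)

Section palm_calculus.
Context (R : realType) dS (S : measurableType dS).
Variables (Q : probability S R) (y : int -> S -> R).
Hypothesis hy : unit_poisson_process Q y.
Context dT (T : measurableType dT).
Variables (P : probability T R) (w : int -> T -> R).
Hypothesis hw : palm_version Q y P w.

Let my i : measurable_fun setT (y i). Proof. by case: hy. Qed.
Let incy s : increasing_enum (y ^~ s). Proof. by case: hy => _ /(_ s). Qed.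
Let incy1 s i : y i s < y (i + 1) s. Proof. by case: (incy s). Qed.
Let mw i : measurable_fun setT (w i). Proof. by case: hw. Qed.
Let mhc a b k := measurable_has_count hy a b k.

Let palm_itv (a b : R) (A : set (int -> R)) : a <= b -> measurable_seqs A ->
  (\int[Q]_s counting
      [set k | (a <= y k s < b)%R /\ A (fun i => y (k + i)%R s - y k s)%R]
   = (b - a)%:E * P [set e | A (w ^~ e)])%E.
Proof.
move=> ab mA; case: hw => _ _ /(_ `[a, b[%classic A (measurable_itv _) mA).
have -> : lebesgue_measure (`[a, b[%classic : set R) = (b - a)%:E.
  rewrite lebesgue_measure_itv /= lte_fin; case: ltP => // ba.
  by have -> : b - a = 0 by apply/eqP; rewrite subr_eq0 eq_le ab ba.
move=> ->; apply: eq_integral => s _; congr counting; apply/seteqP; split => k /=;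
  by rewrite in_itv.
Qed.

Let long (s : R) : set (int -> R) := [set x | s < x 1].

Let mlong s : measurable_seqs (long s).
Proof. by apply: (@measurable_lt _ (seq_space R)) => //; exact: measurable_coordinate. Qed.

Let long_intensity a b s : a <= b ->
  (\int[Q]_o counting [set k | (a <= y k o < b)%R /\ (s < y (k + 1) o - y k o)%R]
   = (b - a)%:E * P [set e | (s < w 1 e)%R])%E.
Proof. by move=> ab; rewrite -(palm_itv ab (mlong s)). Qed.

Let mlongw s : measurable [set e | s < w 1 e].
Proof. exact: measurable_lt. Qed.

Let last_before (o : S) (h : R) : exists k, y k o < h <= y (k + 1) o.
Proof.
have [inc /(_ h)[j hj] /(_ h)[i ih]] := incy o.
have ij : i < j by rewrite -(enum_ltE inc); exact: lt_trans hj.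
have ex : exists n : nat, h <= y (i + n%:Z) o.
  exists `|j - i|%N; have -> : i + `|j - i|%N%:Z = j by clear -ij; lia.
  exact: ltW.
have [[|n] hn nmin] := ex_minnP ex.
  by move: hn; rewrite addr0 leNgt ih.
exists (i + n%:Z); have -> : i + n%:Z + 1 = i + n.+1%:Z by clear; lia.
by rewrite hn andbT ltNge; apply/negP => /nmin; rewrite ltnn.
Qed.

Let void_diff a b c : a <= b -> b <= c ->
  Q (has_count y b c 0 `\` has_count y a c 0) =
  (expR (- (c - b)) - expR (- (c - a)))%:E.
Proof.
move=> ab bc; rewrite measureD; [|exact: mhc|exact: mhc|]; last first.
  by rewrite (le_lt_trans (probability_le1 _ _)) ?ltry//; exact: mhc.
rewrite setIidr; last first.
  move=> s /has_count0P h; apply/has_count0P => i /andP[bi ic].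
  by apply: (h i); rewrite ic andbT (le_trans ab).
rewrite -[LHS]/(Q (has_count y b c 0) - Q (has_count y a c 0))%E.
by rewrite !(has_count_prob hy)// ?poisson_mass0 ?EFinB//; exact: le_trans bc.
Qed.

Let p s := fine (P [set e | s < w 1 e]).
Let pE s : P [set e | s < w 1 e] = (p s)%:E.
Proof. by rewrite fineK// fin_num_measure. Qed.

(** For h <= s at most one atom of [0, h[ is followed by a gap longer than s, and then [h, s[ is
    empty while [0, s[ is not: the intensity is bounded by a difference of two void
    probabilities. *)
Let p_upper s h : 0 < h -> h <= s -> h * p s <= expR (- s) * (expR h - 1).
Proof.
move=> h0 hs; have := long_intensity s (ltW h0); rewrite subr0 pE -EFinM => E.
rewrite -lee_fin -E.
pose G := has_count y h s 0 `\` has_count y 0 s 0.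
have mG : measurable G by apply: measurableD; exact: mhc.
apply: le_trans (_ : \int[Q]_o (\1_G o)%:E <= _)%E; last first.
  rewrite integral_indic// setIT -[X in (X <= _)%E]/(Q G) void_diff ?(ltW h0)//.
  have -> : - (s - h) = - s + h by ring.
  by rewrite subr0 lee_fin expRD mulrBr mulr1.
apply: le_integral_nonneg => o; first exact: counting_ge0.
have [[k [/andP[k0 kh] ks]]|none] := pselect (exists k, (0 <= y k o < h) /\ s < y (k + 1) o - y k o).
  rewrite indicE mem_set; last first.
    split; last by move/has_count0P => /(_ k); rewrite k0 (lt_le_trans kh hs); apply.
    apply/has_count0P => i /andP[hi is'].
    have ki : k < i by rewrite -(enum_ltE (incy1 o)); exact: lt_le_trans hi.
    have : y (k + 1) o <= y i o by rewrite (enum_leE (incy1 o)); clear -ki; lia.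
    by move: ks k0 is'; lra.
  rewrite -[1%:E]/((size [:: k])%:R%:E) -counting_seq//; apply: counting_mono.
  move=> k' [/andP[k'0 k'h] k's] /=; rewrite inE; case: (ltgtP k' k) => // kk.
    have : y (k' + 1) o <= y k o by rewrite (enum_leE (incy1 o)); clear -kk; lia.
    by move: k's k'0 kh hs; lra.
  have : y (k + 1) o <= y k' o by rewrite (enum_leE (incy1 o)); clear -kk; lia.
  by move: ks k0 k'h hs; lra.
rewrite (_ : counting _ = 0%:R%:E) ?lee_fin//; apply/counting_eq0P => k hk.
by apply: none; exists k.
Qed.

(** Conversely, if [h, h + s[ is empty and [0, h + s[ is not, the last atom before h lies in [0, h[
    and is followed by a gap longer than s. *)
Let p_lower s h : 0 < h -> 0 <= s -> expR (- s) * (1 - expR (- h)) <= h * p s.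
Proof.
move=> h0 s0; have := long_intensity s (ltW h0); rewrite subr0 pE -EFinM => E.
rewrite -lee_fin -E.
pose G := has_count y h (h + s) 0 `\` has_count y 0 (h + s) 0.
have mG : measurable G by apply: measurableD; exact: mhc.
apply: le_trans (_ : \int[Q]_o (\1_G o)%:E <= _)%E.
  rewrite integral_indic// setIT -[X in (_ <= X)%E]/(Q G).
  rewrite void_diff ?(ltW h0) ?lerDl// subr0 [h + s]addrC addrK.
  by rewrite lee_fin opprD expRD mulrBr mulr1.
apply: le_integral_nonneg => o; first by rewrite lee_fin indicE.
have [Go|nG] := pselect (G o); last first.
  by rewrite indicE memNset// counting_ge0.
rewrite indicE mem_set//.
case: Go => /has_count0P v1 v2.
have [k /andP[kh hk]] := last_before o h.
have k0 : 0 <= y k o.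
  rewrite leNgt; apply/negP => k0; apply: v2; apply/has_count0P => i /andP[i0 ihs].
  have ki : k < i by rewrite -(enum_ltE (incy1 o)); exact: lt_le_trans i0.
  apply: (v1 i); rewrite ihs andbT (le_trans hk)// (enum_leE (incy1 o)).
  by clear -ki; lia.
apply: le_trans (counting_ge (s := [:: k]) R _ _) => //.
move=> k'; rewrite inE => /eqP -> /=; rewrite k0 kh; split => //.
rewrite ltrBrDr; apply: lt_le_trans (_ : h + s <= _).
  by rewrite addrC ltrD2r.
by rewrite leNgt; apply/negP => hs; apply: (v1 (k + 1)); rewrite hk.
Qed.

(** Let h tend to 0 in the two bounds: (exp h - 1) / h and (1 - exp (- h)) / h both tend to 1. The
    case s = 0 is separate because [p_upper] asks for h <= s. *)
Lemma gap_law s : 0 <= s -> P [set e | s < w 1 e] = (expR (- s))%:E.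
Proof.
rewrite le_eqVlt => /predU1P[<-|s0].
  rewrite oppr0 expR0 (_ : mkset _ = setT) ?probability_setT//.
  apply/seteqP; split => e //= _; case: hw => _ /(_ e)[[inc _ _] w0] _.
  by rewrite -w0; have := inc 0; rewrite add0r.
rewrite pE; congr EFin.
have p0 : 0 <= p s by rewrite fine_ge0.
have p1 : p s <= 1 by rewrite -lee_fin -pE probability_le1.
have e1 : expR (- s) <= 1 by rewrite -expR0 ler_expR oppr_le0 ltW.
have e0 : 0 <= expR (- s) by exact: expR_ge0.
apply/eqP; rewrite eq_le; apply/andP; split; apply/ler_addgt0Pr => e e_gt0.
  pose h := Num.min (Num.min s 2^-1) e.
  have h0 : 0 < h by rewrite !lt_min s0 e_gt0 invr_gt0 ltr0n.
  have hs : h <= s by rewrite !ge_min lexx.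
  have h2 : h <= 2^-1 by rewrite !ge_min lexx orbT.
  have he : h <= e by rewrite ge_min lexx orbT.
  have := p_upper h0 hs; rewrite -(ler_pM2l (x := 1 - h)); last by lra.
  have : (1 - h) * (expR h - 1) <= h.
    have : expR h * expR (- h) = 1 by rewrite -expRD subrr expR0.
    have : expR h * (1 - h) <= expR h * expR (- h).
      by rewrite ler_wpM2l ?expR_ge0//; exact: expR_ge1Dx.
    nra.
  move=> h3 h4; have : (1 - h) * (h * p s) <= h * expR (- s).
    by apply: le_trans h4 _; rewrite mulrCA mulrC ler_wpM2r.
  rewrite mulrCA ler_pM2l// => h5.
  have : h * p s <= e by rewrite -[leRHS]mulr1; apply: ler_pM => //; exact: ltW.
  by lra.
pose h := Num.min 1 e.
have h0 : 0 < h by rewrite !lt_min ltr01.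
have he : h <= e by rewrite ge_min lexx orbT.
have := p_lower h0 (ltW s0); rewrite -(ler_pM2l (x := 1 + h)); last by lra.
have : h <= (1 + h) * (1 - expR (- h)).
  have : expR h * expR (- h) = 1 by rewrite -expRD subrr expR0.
  have : (1 + h) * expR (- h) <= expR h * expR (- h).
    by rewrite ler_wpM2r ?expR_ge0//; exact: expR_ge1Dx.
  nra.
move=> h3 h4; have : h * expR (- s) <= (1 + h) * (h * p s).
  by apply: le_trans h4; rewrite [leRHS]mulrCA [leLHS]mulrC ler_wpM2l.
rewrite [leRHS]mulrCA ler_pM2l// => h5.
have : h * p s <= e by rewrite -[leRHS]mulr1; apply: ler_pM => //; exact: ltW.
by lra.
Qed.

Let mgap k : measurable_fun setT (fun o => y (k + 1) o - y k o).
Proof. by apply: measurable_funB; exact: my. Qed.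

Let measurable_at a b k : measurable [set o | a <= y k o < b].
Proof.
rewrite (_ : mkset _ = [set o | a <= y k o /\ y k o < b]).
  by apply: measurable_and; [exact: measurable_le|exact: measurable_lt].
by apply/seteqP; split => o /=; [move=> /andP|move=> [-> ->]].
Qed.

Lemma many_long_gaps a b s v : a <= b -> 0 <= s -> 0 < v ->
  (Q [set o | exists l : seq int, [/\ uniq l,
      forall j, j \in l -> (a <= y j o < b)%R /\ (s < y (j + 1) o - y j o)%R &
      (v <= (size l)%:R)%R]] <= ((b - a) * expR (- s) / v)%:E)%E.
Proof.
move=> ab s0 v0.
apply: (markov_inequality_ext (F := fun o =>
  counting [set k | (a <= y k o < b) /\ s < y (k + 1) o - y k o])) => //.
- apply: (measurable_seq_exists (I := int)
    (P := fun j o => (a <= y j o < b) /\ s < y (j + 1) o - y j o)) => j.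
  by apply: measurable_and => //; exact: measurable_lt.
- by move=> o; exact: counting_ge0.
- move=> o [l [ul lP vl]]; apply: le_trans (counting_ge R ul lP).
  by rewrite lee_fin.
by rewrite long_intensity// gap_law.
Qed.

Lemma some_long_gap a b s : a <= b -> 0 <= s ->
  (Q [set o | exists j, (a <= y j o < b)%R /\ (s < y (j + 1) o - y j o)%R]
    <= ((b - a) * expR (- s))%:E)%E.
Proof.
move=> ab s0; have := many_long_gaps ab s0 ltr01; rewrite divr1.
apply: le_trans; apply: le_measure; rewrite ?inE.
- apply: measurable_exists => j.
  by apply: measurable_and => //; exact: measurable_lt.
- apply: (measurable_seq_exists (I := int)
    (P := fun j o => (a <= y j o < b) /\ s < y (j + 1) o - y j o)) => j.
  by apply: measurable_and => //; exact: measurable_lt.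
move=> o [j jP]; exists [:: j]; split => //= i; by rewrite inE => /eqP ->.
Qed.

Lemma some_gap_between a b s1 s2 : a <= b -> 0 <= s1 -> s1 <= s2 ->
  (Q [set o | exists j, (a <= y j o < b)%R /\ (s1 < y (j + 1) o - y j o <= s2)%R]
    <= ((b - a) * (expR (- s1) - expR (- s2)))%:E)%E.
Proof.
move=> ab s10 s12; rewrite -[X in (_ <= X%:E)%E]divr1.
pose A : set (int -> R) := [set x | s1 < x 1 /\ ~ (s2 < x 1)].
have mA : measurable_seqs A.
  apply: (@measurable_and _ (seq_space R)); first exact: mlong.
  by apply: (@measurable_not _ (seq_space R)); exact: mlong.
apply: (markov_inequality_ext (F := fun o =>
  counting [set k | (a <= y k o < b) /\ A (fun i => y (k + i) o - y k o)])) => //.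
- apply: measurable_exists => j; apply: measurable_and => //.
  rewrite (_ : mkset _ = [set o | s1 < y (j + 1) o - y j o /\ y (j + 1) o - y j o <= s2]).
    by apply: measurable_and; [exact: measurable_lt|exact: measurable_le].
  by apply/seteqP; split => o /=; [move=> /andP|move=> [-> ->]].
- by move=> o; exact: counting_ge0.
- move=> o [j [jab /andP[j1 j2]]].
  apply: le_trans (counting_ge (s := [:: j]) R _ _) => // i.
  rewrite inE => /eqP ->; split => //; rewrite /A /=; split => //.
  by rewrite ltNge j2.
rewrite palm_itv//.
have -> : [set e | A (w ^~ e)] = [set e | s1 < w 1 e] `\` [set e | s2 < w 1 e] by [].
rewrite measureD//; last by rewrite (le_lt_trans (probability_le1 _ _)) ?ltry.
rewrite setIidr; last by move=> e /=; exact: le_lt_trans.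
rewrite -[X in (_ * X <= _)%E]/(P [set e | (s1 < w 1 e)%R] - P [set e | (s2 < w 1 e)%R])%E.
by rewrite !gap_law// ?(le_trans s10).
Qed.

(* The number N of atoms in [0, 1[ is integrable under Q, and the Palm formula
   on [0, 1[ gives P(A) <= E_Q[N; B]. *)
Lemma palm_absolute_continuity (e : R) : 0 < e -> exists2 eta : R, 0 < eta &
  forall (A : set (int -> R)) (B : set S), measurable_seqs A -> measurable B ->
    (Q B < eta%:E)%E ->
    (forall s k, 0 <= y k s < 1 -> A (fun i => y (k + i) s - y k s) -> B s) ->
    (P [set o | A (w ^~ o)] <= e%:E)%E.
Proof.
move=> e0; pose N s : R := fine (counting (atoms y 0 1 s)).
have NE s : (N s)%:E = counting (atoms y 0 1 s).
  have [k kE] : exists k : nat, counting (atoms y 0 1 s) = k%:R%:E :> \bar R :=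
    counting_finite R (finite_atoms hy s 0 1).
  by rewrite /N kE.
have N0 s : 0 <= N s by rewrite -lee_fin NE counting_ge0.
have mN : measurable_fun setT N.
  move=> _ B mB; rewrite setTI.
  rewrite (_ : _ @^-1` _ = [set s | exists k : nat, B k%:R /\ has_count y 0 1 k s]).
    apply: measurable_exists => k; apply: measurable_and; last exact: mhc.
    exact: measurable_constant.
  apply/seteqP; split => s /=.
    have [k kE] : exists k : nat, counting (atoms y 0 1 s) = k%:R%:E :> \bar R :=
      counting_finite R (finite_atoms hy s 0 1).
    by rewrite /N kE => Bk; exists k.
  by move=> [k [Bk]]; rewrite /has_count /= /N => ->.
have intN : (\int[Q]_s (N s)%:E = 1)%E.
  have := @palm_itv 0 1 setT ler01; rewrite subr0 mul1e probability_setT => <-.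
    apply: eq_integral => s _; rewrite NE; congr counting.
    by apply/seteqP; split => k /=; rewrite /atoms /= in_itv; [|move=> []].
  exact: (@measurableT _ (seq_space R)).
have iN : Q.-integrable setT (EFin \o N).
  apply/integrableP; split; first exact/measurable_EFinP.
  under eq_integral do rewrite /= ger0_norm//.
  by rewrite intN ltry.
have [eta [eta0 H]] := integral_normr_continuous iN e0.
exists eta => // A B mA mB QB AB.
have {}H := H B mB QB.
have := palm_itv ler01 mA; rewrite subr0 mul1e => <-.
apply: le_trans (_ : \int[Q]_s ((N s)%:E * (\1_B s)%:E) <= _)%E.
  apply: le_integral_nonneg => s; first exact: counting_ge0.
  rewrite indicE; case: (boolP (s \in B)) => sB.
    rewrite mule1 NE; apply: counting_mono => k [k01 _].
    by rewrite /atoms /= in_itv.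
  rewrite mule0 (_ : counting _ = 0%:R%:E)//; apply/counting_eq0P => k [k01 Ak].
  by move/negP: sB; apply; rewrite inE; exact: AB Ak.
under eq_integral do rewrite -EFinM.
rewrite (_ : (\int[Q]_s (N s * \1_B s)%:E)%E = (\int[Q]_(s in B) (N s)%:E)%E); last first.
  rewrite [RHS]integral_mkcond; apply: eq_integral => s _.
  by rewrite patchE indicE; case: ifPn; rewrite ?mulr1 ?mulr0.
have fN : (\int[Q]_(s in B) (N s)%:E)%E \is a fin_num.
  apply: integrable_fin_num => //; exact: integrableS iN.
rewrite -(fineK fN) lee_fin ltW//; apply: le_lt_trans H.
rewrite /Rintegral le_eqVlt; apply/orP; left; apply/eqP; congr fine.
by apply: eq_integral => s _; rewrite ger0_norm.
Qed.

End palm_calculus.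

Section environment_probability.
Variable R : realType.

(** All quantifiers range over integers, naturals and finite lists of integers, hence over countable
    types. *)
Lemma measurable_good_environment (l del M W eps V Z : R) (L D : nat) :
  measurable_seqs [set x : int -> R | good_environment l del M W eps V Z L D x].
Proof.
have mc := @measurable_coordinate R; have mg := @measurable_gap R.
pose x_ (i : int) (x : seq_space R) : R := (x : int -> R) i.
have mx i : measurable_fun setT (x_ i) by exact: mc.
have mle (f g : seq_space R -> R) : measurable_fun setT f -> measurable_fun setT g ->
  measurable [set x : seq_space R | f x <= g x] := @measurable_le _ _ R f g.
have mlt (f g : seq_space R -> R) : measurable_fun setT f -> measurable_fun setT g ->
  measurable [set x : seq_space R | f x < g x] := @measurable_lt _ _ R f g.
have mcst (c : R) : measurable_fun setT (fun _ : seq_space R => c) by [].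
have mand (F G : seq_space R -> Prop) : measurable [set x | F x] ->
  measurable [set x | G x] -> measurable [set x | F x /\ G x] := @measurable_and _ _ F G.
have mitv (a b : seq_space R -> bool) : measurable [set x | a x] ->
  measurable [set x | b x] -> measurable [set x | a x && b x].
  move=> ma mb; rewrite (_ : mkset _ = [set x | a x /\ b x]); first exact: mand.
  by apply/seteqP; split => x /=; [move=> /andP|move=> /andP].
have mnot (F : seq_space R -> Prop) : measurable [set x | F x] ->
  measurable [set x | ~ F x] := @measurable_not _ _ F.
have mimp (F G : seq_space R -> Prop) : measurable [set x | F x] ->
  measurable [set x | G x] -> measurable [set x | F x -> G x] := @measurable_imp _ _ F G.
have mcn (F : Prop) : measurable [set _ : seq_space R | F] := measurable_constant _ F.
have mabs i : measurable [set x | `|x_ i x| <= W].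
  by apply: (mle) => //; exact: measurableT_comp.
rewrite (_ : mkset _ = [set x : seq_space R |
  (exists i : nat, (i + L)%:R <= M /\ forall j, ~ (i%:R <= x_ j x <= (i + L)%:R)) /\
  (exists i : nat, (i + L)%:R <= M /\ forall j, ~ (- (i + L)%:R <= x_ j x <= - i%:R)) /\
  (forall j, `|x_ j x| <= W -> ~ (l - del < x_ (j + 1) x - x_ j x <= l + del)) /\
  (forall j, 0 <= x_ j x <= eps -> x_ (j + 1) x - x_ j x <= l) /\
  (forall (k : nat), (k <= L)%N -> forall s : seq int, uniq s ->
      (forall j, j \in s -> `|x_ j x| <= W /\ k%:R < x_ (j + 1) x - x_ j x) ->
      (size s)%:R <= V * expR (- k%:R)) /\
  (forall p (r : nat), `|x_ p x| <= W ->
      x_ p x + r%:R <= x_ (p + (r * D)%:Z) x /\ x_ (p - (r * D)%:Z) x <= x_ p x - r%:R) /\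
  (exists s : seq int, uniq s /\
      (forall j, j \in s -> 0 <= x_ j x <= eps /\ x_ (j + 1) x - x_ j x <= 1) /\
      Z <= (size s)%:R) /\
  (exists j, M <= x_ j x <= W) /\
  (exists j, - W <= x_ j x <= - M)]); last first.
  apply/seteqP; split => x /=.
    case=> h1 h2 h3 h4 h5 h6 [s [s1 s2 s3]] h8 h9; do 6 (split=> //).
    by split; first by exists s.
  move=> [h1 [h2 [h3 [h4 [h5 [h6 [[s [s1 [s2 s3]]] [h8 h9]]]]]]]].
  by split => //; exists s.
apply: (mand).
  apply: measurable_exists => i; apply: (mand) => //; apply: measurable_forall => j.
  by apply: (mnot); apply: (mitv); apply: (mle).
apply: (mand).
  apply: measurable_exists => i; apply: (mand) => //; apply: measurable_forall => j.
  by apply: (mnot); apply: (mitv); apply: (mle).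
apply: (mand).
  apply: measurable_forall => j; apply: (mimp) => //; apply: (mnot).
  by apply: (mitv); [apply: (mlt)|apply: (mle)] => //; exact: mg.
apply: (mand).
  apply: measurable_forall => j; apply: (mimp); first by apply: (mitv); apply: (mle).
  by apply: (mle) => //; exact: mg.
apply: (mand).
  apply: measurable_forall => k; apply: (mimp) => //; apply: measurable_forall => s.
  apply: (mimp) => //; apply: (mimp) => //; apply: measurable_forall => j.
  by apply: (mimp) => //; apply: (mand) => //; apply: (mlt) => //; exact: mg.
apply: (mand).
  apply: measurable_forall => p; apply: measurable_forall => r; apply: (mimp) => //.
  by apply: (mand); apply: (mle) => //; [exact: measurable_funD|exact: measurable_funB].
apply: (mand).
  apply: measurable_exists => s; apply: (mand) => //; apply: (mand) => //.
  apply: measurable_forall => j; apply: (mimp) => //; apply: (mand).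
    by apply: (mitv); apply: (mle).
  by apply: (mle) => //; exact: mg.
by apply: (mand); apply: measurable_exists => j; apply: (mitv); apply: (mle).
Qed.

Context dS (S : measurableType dS).
Variables (Q : probability S R) (y : int -> S -> R).
Hypothesis hy : unit_poisson_process Q y.
Context dT (T : measurableType dT).
Variables (P : probability T R) (w : int -> T -> R).
Hypothesis hw : palm_version Q y P w.

Let my i : measurable_fun setT (y i). Proof. by case: hy. Qed.
Let incy1 s i : y i s < y (i + 1) s. Proof. by case: hy => _ /(_ s)[] . Qed.
Let mhc a b k := measurable_has_count hy a b k.

Let measurable_window a b j : measurable [set s | a <= y j s < b].
Proof.
rewrite (_ : mkset _ = [set s | a <= y j s /\ y j s < b]).
  by apply: measurable_and; [exact: measurable_le|exact: measurable_lt].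
by apply/seteqP; split => s /=; [move=> /andP|move=> [-> ->]].
Qed.

(* F s k refers to the configuration seen from an atom y_k of [0, 1[; the
   exceptional event may not depend on k. *)
Definition likely (q : R) (F : S -> int -> Prop) := exists B : set S,
  [/\ measurable B, (Q B <= q%:E)%E & forall s k, 0 <= y k s < 1 -> ~ B s -> F s k].

Definition seen_from s k : int -> R := fun i => y (k + i) s - y k s.

Lemma likely_and q q' F F' : likely q F -> likely q' F' ->
  likely (q + q') (fun s k => F s k /\ F' s k).
Proof.
move=> [B [mB Bq BF]] [B' [mB' Bq' BF']]; exists (B `|` B'); split.
- exact: measurableU.
- by apply: le_trans (measureU2 _ mB mB') _; rewrite EFinD; exact: leeD.
by move=> s k k01 /not_orP[nB nB']; split; [exact: BF|exact: BF'].
Qed.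

Lemma likely_forall q (N : nat) (F : nat -> S -> int -> Prop) :
  (forall i, likely q (F i)) ->
  likely (N%:R * q) (fun s k => forall i, (i < N)%N -> F i s k).
Proof.
move=> hF; elim: N => [|N IH].
  by exists set0; split => //; rewrite measure0 mul0r.
have [B [mB Bq BF]] := likely_and IH (hF N).
exists B; split => //; first by rewrite -natr1 mulrDl mul1r.
move=> s k k01 nB i; rewrite ltnS leq_eqVlt => /predU1P[->|iN].
  by have [] := BF s k k01 nB.
by have [/(_ i iN)] := BF s k k01 nB.
Qed.

(** The runs have L + 1 empty units, so that an interval of length L with integer ends is empty as
    seen from every atom of [0, 1[. The unit cell holding one atom in front of the run raises the
    exponent to L + 2. *)
Let likely_run (a : R) (m L : nat) (F : S -> int -> Prop) : (0 < m)%N ->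
  (forall s k, 0 <= y k s < 1 -> forall i, (i < m)%N ->
    (forall j, ~ (a + i.+1%:R <= y j s < a + (i.+1 + L.+1)%:R)) -> F s k) ->
  likely (4 / (m%:R * expR (- L.+2%:R))) F.
Proof.
move=> m0 HF; exists [set s | forall i, (i < m)%N ->
  ~ has_count y (a + i.+1%:R) (a + (i.+1 + L.+1)%:R) 0 s]; split.
- apply: measurable_forall => i; apply: measurable_imp; first exact: measurable_constant.
  by apply: measurable_not; exact: mhc.
- exact: no_empty_run.
move=> s k k01; move=> /existsNP[i /not_implyP[im /contrapT/has_count0P v]].
exact: HF v.
Qed.

Lemma likely_run_right (m L : nat) : (0 < m)%N ->
  likely (4 / (m%:R * expR (- L.+2%:R))) (fun s k =>
    exists i : nat, (i + L)%:R <= (m + L)%:R :> R /\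
      forall j, ~ (i%:R <= seen_from s k j <= (i + L)%:R)).
Proof.
move=> m0; apply: (@likely_run 0) => // s k /andP[k0 k1] i im v.
exists i.+1; split; first by rewrite ler_nat leq_add2r.
move=> j; rewrite /seen_from => /andP[j1 j2]; apply: (v (k + j)).
by rewrite !add0r; move: j1 j2; rewrite !natrD -(natr1 L); lra.
Qed.

Lemma likely_run_left (m L : nat) : (0 < m)%N ->
  likely (4 / (m%:R * expR (- L.+2%:R))) (fun s k =>
    exists i : nat, (i + L)%:R <= (m + L)%:R :> R /\
      forall j, ~ (- (i + L)%:R <= seen_from s k j <= - i%:R)).
Proof.
move=> m0; apply: (@likely_run (- (m + L.+1)%:R)) => // s k /andP[k0 k1] i im v.
(* The runs are laid out from left to right, starting near - (m + L + 1), so run i ends about m - i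
   to the left of the atom. *)
exists (m - i)%N; split; first by rewrite ler_nat leq_add2r leq_subr.
move=> j; rewrite /seen_from => /andP[j1 j2]; apply: (v (k + j)).
move: j1 j2; rewrite !natrD natrB ?(ltnW im)// -(natr1 L) -(natr1 i); lra.
Qed.

(** An atom within W of a point of [0, 1[ lies in [- W, W + 1[, a window of length 2 W + 1 that does
    not depend on k. *)
Lemma likely_no_critical_gap (W : nat) (s1 s2 : R) : 0 <= s1 -> s1 <= s2 ->
  likely (W.*2.+1%:R * (expR (- s1) - expR (- s2))) (fun s k =>
    forall j, `|seen_from s k j| <= W%:R ->
      ~ (s1 < seen_from s k (j + 1) - seen_from s k j <= s2)).
Proof.
move=> s10 s12; exists [set s | exists j, (- W%:R <= y j s < W.+1%:R) /\
  (s1 < y (j + 1) s - y j s <= s2)]; split.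
- apply: measurable_exists => j; apply: measurable_and; first exact: measurable_window.
  have mgj : measurable_fun setT (fun o => y (j + 1) o - y j o) by exact: measurable_funB.
  rewrite (_ : mkset _ = [set o | s1 < y (j + 1) o - y j o /\ y (j + 1) o - y j o <= s2]).
    by apply: measurable_and; [exact: measurable_lt|exact: measurable_le].
  by apply/seteqP; split => o /=; [move=> /andP|move=> [-> ->]].
- have -> : W.*2.+1%:R = W.+1%:R - - W%:R :> R by rewrite -addnn -!natr1 natrD; ring.
  by apply: (some_gap_between hy hw) => //; rewrite lerNl (le_trans _ (ler0n _ _))// oppr_le0.
move=> s k /andP[k0 k1] nB j; rewrite /seen_from ler_norml => /andP[jW Wj] g; apply: nB.
exists (k + j); move: g; rewrite addrA (_ : _ - _ - _ = y (k + j + 1) s - y (k + j) s); last by ring.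
by split => //; move: jW Wj; rewrite -(natr1 W); lra.
Qed.

Lemma likely_no_early_gap (q : nat) (l : R) : 0 <= l ->
  likely (q.+1%:R * expR (- l)) (fun s k =>
    forall j, 0 <= seen_from s k j <= q%:R -> seen_from s k (j + 1) - seen_from s k j <= l).
Proof.
move=> l0; exists [set s | exists j, (0 <= y j s < q.+1%:R) /\ l < y (j + 1) s - y j s]; split.
- apply: measurable_exists => j; apply: measurable_and; first exact: measurable_window.
  by apply: measurable_lt => //; exact: measurable_funB.
- by have := some_long_gap hy hw (ler0n _ q.+1) l0; rewrite subr0.
move=> s k /andP[k0 k1] nB j; rewrite /seen_from => /andP[j0 jq].
rewrite leNgt; apply/negP => g; apply: nB; exists (k + j).
by move: j0 jq g; rewrite addrA -(natr1 q); lra.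
Qed.

Lemma likely_few_gaps (W L : nat) (V : R) : 0 < V ->
  likely (L.+1%:R * (W.*2.+1%:R / V)) (fun s k =>
    forall q : nat, (q < L.+1)%N -> forall r : seq int, uniq r ->
      (forall j, j \in r -> `|seen_from s k j| <= W%:R /\
         q%:R < seen_from s k (j + 1) - seen_from s k j) ->
      (size r)%:R <= V * expR (- q%:R)).
Proof.
move=> V0; apply: likely_forall => q.
have Vq : 0 < V * expR (- q%:R) by rewrite mulr_gt0// expR_gt0.
exists [set s | exists r : seq int, [/\ uniq r,
      forall j, j \in r -> (- W%:R <= y j s < W.+1%:R)%R /\ (q%:R < y (j + 1) s - y j s)%R &
      (V * expR (- q%:R) <= (size r)%:R)%R]]; split.
- apply: (measurable_seq_exists (I := int)
    (P := fun j o => (- W%:R <= y j o < W.+1%:R) /\ q%:R < y (j + 1) o - y j o)) => j.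
  apply: measurable_and; first exact: measurable_window.
  by apply: measurable_lt => //; exact: measurable_funB.
- have W0 : - W%:R <= W.+1%:R :> R by rewrite lerNl (le_trans _ (ler0n _ _))// oppr_le0.
  have := many_long_gaps hy hw W0 (ler0n _ q) Vq.
  have -> : W.+1%:R - - W%:R = W.*2.+1%:R :> R by rewrite -addnn -!natr1 natrD; ring.
  suff -> : W.*2.+1%:R * expR (- q%:R) / (V * expR (- q%:R)) = W.*2.+1%:R / V by [].
  by have := expR_gt0 (- q%:R : R) => e0; field; rewrite !gt_eqF.
move=> s k /andP[k0 k1] nB r ur rP; rewrite leNgt; apply/negP => Vr; apply: nB.
exists [seq k + j | j <- r]; split.
- by rewrite map_inj_uniq//; exact: addrI.
- move=> _ /mapP[j /rP[+ +] ->]; rewrite /seen_from ler_norml addrA => /andP[].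
  by rewrite -(natr1 W); lra.
by rewrite size_map ltW.
Qed.

Let crowd_free (a : nat -> R) (D : nat) : (6 < D)%N ->
  likely (4 * expR (6 - D%:R)) (fun s k => forall (r : nat) (p : int),
    a r <= y p s -> y (p + (r.+1 * D)%:Z) s < a r + r.+2%:R -> False).
Proof.
move=> D6; exists [set s | exists r : nat, ((r.+1 * D).+1%:R%:E <=
     counting (atoms y (a r) (a r + r.+2%:R) s) :> \bar R)%E]; split.
- by apply: measurable_exists => r; exact: measurable_counting_ge hy _ _ _.
- exact: clustered_prob.
move=> s k _ nB r p pa pD; apply: nB; exists r.
pose u := [seq p + i%:Z | i <- iota 0 (r.+1 * D).+1].
have -> : (r.+1 * D).+1 = size u by rewrite size_map size_iota.
apply: counting_ge; first by rewrite map_inj_uniq ?iota_uniq// => i j; clear; lia.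
move=> j /mapP[i]; rewrite mem_iota => /andP[_ iD] ->; rewrite /atoms /= in_itv /=.
apply/andP; split.
  by apply: le_trans pa _; rewrite (enum_leE (incy1 s)); clear; lia.
by apply: le_lt_trans pD; rewrite (enum_leE (incy1 s)); move: iD; clear; lia.
Qed.

(** Sparseness is wanted at all atoms of the window at once. The base atom falls into one of 2 W + 1
    unit cells, and the interval length r + 2 is the range r + 1 plus one unit for the position
    inside the cell. *)
Lemma likely_sparse (W D : nat) : (6 < D)%N ->
  likely (W.*2.+1%:R * (4 * expR (6 - D%:R) + 4 * expR (6 - D%:R))) (fun s k =>
    forall p (r : nat), `|seen_from s k p| <= W%:R ->
      seen_from s k p + r%:R <= seen_from s k (p + (r * D)%:Z) /\
      seen_from s k (p - (r * D)%:Z) <= seen_from s k p - r%:R).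
Proof.
move=> D6.
have [B [mB QB BF]] := likely_forall W.*2.+1 (fun i => likely_and
  (crowd_free (fun=> i%:R - W%:R) D6) (crowd_free (fun r => i%:R - W%:R - r.+1%:R) D6)).
exists B; split => // s k k01 nB p [|r] pW.
  by rewrite !mul0n !addr0 !subr0.
have {BF}BF := BF s k k01 nB.
move: pW k01; rewrite /seen_from ler_norml => /andP[pW Wp] /andP[k0 k1].
pose z := y (k + p) s + W%:R.
have z0 : 0 <= z by rewrite /z; move: pW; lra.
have /andP[iz zi] := truncn_itv z0.
have iW : (Num.trunc z < W.*2.+1)%N.
  rewrite truncn_lt_nat// /z -addnn -natr1 natrD; move: Wp; lra.
have [cr cl] := BF _ iW.
split; rewrite leNgt; apply/negP => h.
  apply: (cr r (k + p)); first by rewrite /z in iz; move: iz; lra.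
  rewrite -addrA; move: h zi; rewrite /z -(natr1 r.+1) -(natr1 (Num.trunc _)); lra.
apply: (cl r (k + (p - (r.+1 * D)%:Z))).
  by move: h iz; rewrite /z; lra.
rewrite -addrA subrK; move: zi; rewrite /z -(natr1 r.+1) -(natr1 (Num.trunc _)); lra.
Qed.

Lemma likely_short_gaps (q : nat) : (0 < q)%N ->
  likely (4 / (q%:R * (expR (-1) / 2))) (fun s k =>
    exists r : seq int, [/\ uniq r,
      forall j, j \in r -> 0 <= seen_from s k j <= q.+1%:R /\
        seen_from s k (j + 1) - seen_from s k j <= 1
      & q%:R * (expR (-1) / 2) / 2 <= (size r)%:R :> R]).
Proof.
move=> q0; exists [set s | crowded_cells y q s <= q%:R * (expR (-1) / 2) / 2]; split.
- apply: measurable_le => //; apply: measurable_sum => i; apply: measurable_indic; exact: mhc.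
- exact: few_crowded_cells.
move=> s k /andP[k0 k1] /negP; rewrite -ltNge => h.
have [r [ur rP rs]] := crowded_cells_gaps hy q s.
exists [seq j - k | j <- r]; split.
- by rewrite map_inj_uniq//; exact: addIr.
- move=> _ /mapP[j /rP[/andP[j1 jq] g] ->]; rewrite /seen_from.
  have -> : k + (j - k) = j by clear; lia.
  have -> : k + (j - k + 1) = j + 1 by clear; lia.
  by move: j1 jq g; lra.
by rewrite size_map (le_trans (ltW h)).
Qed.

Let likely_atom (a b : R) : a <= b ->
  likely (expR (- (b - a))) (fun s k => exists j, a <= y (k + j) s < b).
Proof.
move=> ab; exists [set s | forall i, ~ (a <= y i s < b)]; split.
- rewrite (_ : mkset _ = has_count y a b 0); first exact: mhc.
  by apply/seteqP; split => s /has_count0P.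
- by rewrite (void_prob hy).
move=> s k _ /existsNP[j /contrapT jab]; exists (j - k).
by have -> : k + (j - k) = j by clear; lia.
Qed.

Lemma likely_outer_right (M W : R) : M + 1 <= W ->
  likely (expR (- (W - (M + 1)))) (fun s k => exists j, M <= seen_from s k j <= W).
Proof.
move=> MW; have [B [mB QB BF]] := likely_atom MW.
exists B; split => // s k k01 /(BF s k k01)[j /andP[j1 j2]].
by exists j; rewrite /seen_from; move: k01 j1 j2 => /andP[]; lra.
Qed.

Lemma likely_outer_left (M W : R) : M + 1 <= W ->
  likely (expR (- (W - (M + 1)))) (fun s k => exists j, - W <= seen_from s k j <= - M).
Proof.
move=> MW; have MW' : 1 - W <= - M by lra.
have [B [mB QB BF]] := likely_atom MW'.
exists B; split => //; first by apply: le_trans QB _; rewrite lee_fin ler_expR; lra.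
move=> s k k01 /(BF s k k01)[j /andP[j1 j2]].
by exists j; rewrite /seen_from; move: k01 j1 j2 => /andP[]; lra.
Qed.

Lemma likely_palm (e : R) : 0 < e -> exists2 eta : R, 0 < eta &
  forall (q : R) (A : set (int -> R)), measurable_seqs A -> q < eta ->
    likely q (fun s k => A (seen_from s k)) -> (P [set o | ~ A (w ^~ o)] <= e%:E)%E.
Proof.
move=> e0; have [eta eta0 H] := palm_absolute_continuity hy hw e0.
exists eta => // q A mA qeta [B [mB QB BF]].
apply: (H [set x | ~ A x] B) => //.
- exact: (@measurable_not _ (seq_space R)).
- by apply: le_lt_trans QB _; rewrite lte_fin.
move=> s k k01 nA; apply: contrapT => nB; apply: nA; exact: BF.
Qed.

Lemma good_environment_likely (l del V : R) (m L W q D : nat) :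
  0 <= l - del -> 0 <= del -> (0 < m)%N -> 0 < V -> (6 < D)%N -> (0 < q)%N ->
  (m + L)%:R + 1 <= W%:R :> R ->
  likely (4 / (m%:R * expR (- L.+2%:R)) + (4 / (m%:R * expR (- L.+2%:R)) +
    (W.*2.+1%:R * (expR (- (l - del)) - expR (- (l + del))) +
    (q.+2%:R * expR (- l) + (L.+1%:R * (W.*2.+1%:R / V) +
    (W.*2.+1%:R * (4 * expR (6 - D%:R) + 4 * expR (6 - D%:R)) +
    (4 / (q%:R * (expR (-1) / 2)) +
    (expR (- (W%:R - ((m + L)%:R + 1))) + expR (- (W%:R - ((m + L)%:R + 1)))))))))))
    (fun s k => good_environment l del (m + L)%:R W%:R q.+1%:R V
       (q%:R * (expR (-1) / 2) / 2) L D (seen_from s k)).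
Proof.
move=> ld d0 m0 V0 D6 q0 MW.
have l0 : 0 <= l by lra.
have l12 : l - del <= l + del by lra.
have [B [mB QB BF]] := likely_and (likely_run_right L m0) (likely_and (likely_run_left L m0)
  (likely_and (likely_no_critical_gap W ld l12) (likely_and (likely_no_early_gap q.+1 l0)
  (likely_and (likely_few_gaps W L V0) (likely_and (likely_sparse W D6)
  (likely_and (likely_short_gaps q0) (likely_and (likely_outer_right MW)
  (likely_outer_left MW)))))))).
exists B; split => // s k k01 nB.
by have [h1 [h2 [h3 [h4 [h5 [h6 [h7 [h8 h9]]]]]]]] := BF s k k01 nB.
Qed.

End environment_probability.

(** * Asymptotics *)

Section scales.
Variable R : realType.

(** With y = l^g one has l <= y^p for p >= 1/g, and exp (del y) >= (del y / N)^N with N = p k + 1;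
    the surplus power of y beats the constants. *)
Lemma powers_le_exp (g del c e : R) (k : nat) : 0 < g -> 0 < del -> 0 < e ->
  exists l0, forall l, l0 <= l -> c * l ^+ k <= e * expR (del * l `^ g).
Proof.
move=> g0 d0 e0.
have gn0 : g != 0 by rewrite gt_eqF.
pose p := (Num.trunc g^-1).+1.
have gp : g^-1 <= p%:R by rewrite ltW// truncnS_gt// invr_ge0 ltW.
pose N := (p * k).+1.
have N0 : 0 < N%:R :> R by rewrite ltr0n.
pose c' := e * (del / N%:R) ^+ N.
have c'0 : 0 < c' by rewrite mulr_gt0// exprn_gt0// divr_gt0.
pose x0 := Num.max 1 (c / c').
have x01 : 1 <= x0 by rewrite le_max lexx.
exists (Num.max 1 (x0 `^ g^-1)) => l; rewrite ge_max => /andP[l1 lx].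
have l0 : 0 <= l by lra.
have [c0|c0] := leP c 0.
  apply: le_trans (_ : 0 <= _); first by rewrite mulr_le0_ge0// exprn_ge0.
  by rewrite mulr_ge0// ?expR_ge0// ltW.
pose y := l `^ g.
have xy : x0 <= y.
  rewrite /y -[leLHS]powRr1 ?(le_trans ler01)// -(mulVf gn0) powRrM.
  by apply: ge0_ler_powR; rewrite ?nnegrE ?powR_ge0// ltW.
have y1 : 1 <= y := le_trans x01 xy.
have ly : l <= y ^+ p.
  have -> : l = y `^ g^-1 by rewrite -powRrM mulfV// powRr1.
  by rewrite -powR_mulrn ?(le_trans ler01)//; exact: ler_powR.
apply: le_trans (_ : c * y ^+ (p * k) <= _).
  by rewrite ler_pM2l// exprM lerXn2r// nnegrE exprn_ge0// (le_trans ler01).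
apply: le_trans (_ : c' * y ^+ N <= _).
  rewrite exprSr mulrCA [leLHS]mulrC ler_wpM2l ?exprn_ge0 ?(le_trans ler01)//.
  by rewrite [leRHS]mulrC -ler_pdivrMr// (le_trans _ xy)// le_max lexx orbT.
rewrite /c' -mulrA -exprMn ler_pM2l//.
have -> : del * y = N%:R * (del / N%:R * y) by field; rewrite gt_eqF.
rewrite expRM_natl lerXn2r ?nnegrE ?expR_ge0//.
  by rewrite mulr_ge0 ?divr_ge0// ?ltW// (lt_le_trans ltr01).
by apply: le_trans (expR_ge1Dx _); rewrite lerDr.
Qed.

Variable t : R.
Hypothesis t0 : 0 < t.

Definition log_scale (n : nat) : R := ln (n%:R * t).

Lemma expR_log_scale n : (0 < n)%N -> expR (log_scale n) = n%:R * t.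
Proof. by move=> n0; rewrite /log_scale lnK// posrE mulr_gt0// ltr0n. Qed.

Lemma near_scale (c : R) : \forall n \near \oo,
  [/\ (0 < n)%N, c <= n%:R, c <= log_scale n & log_scale n + 3 <= n%:R].
Proof.
pose c1 := Num.max (Num.max c 3) (8 * t).
exists (Num.trunc (Num.max (Num.max c 1) (expR c1 / t))).+1 => // n /= nn.
have : Num.max (Num.max c 1) (expR c1 / t) <= n%:R.
  apply: ltW; apply: lt_le_trans (_ : (Num.trunc (Num.max (Num.max c 1) (expR c1 / t))).+1%:R <= _).
    by apply: truncnS_gt; rewrite !le_max ler01 orbT.
  by rewrite ler_nat.
rewrite !ge_max => /andP[/andP[cn n1] en].
have n0 : (0 < n)%N by rewrite -(ltr0n R) (lt_le_trans ltr01).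
have c1l : c1 <= log_scale n.
  by rewrite -ler_expR expR_log_scale// -ler_pdivrMr.
have [cl l3 lt8] : [/\ c <= log_scale n, 3 <= log_scale n & 8 * t <= log_scale n].
  by split; apply: le_trans c1l; rewrite /c1 !le_max lexx ?orbT.
split => //.
have nt := expR_log_scale n0.
(* exp l dominates (1 + l / 2)^2, and l >= 3, l >= 8 t make this at least (l + 3) t. *)
have : (1 + log_scale n / 2) ^+ 2 <= expR (log_scale n).
  have -> : expR (log_scale n) = expR (log_scale n / 2) ^+ 2.
    by rewrite -expRM_natl; congr expR; field.
  rewrite lerXn2r ?nnegrE ?expR_ge0 ?expR_ge1Dx//; move: l3; lra.
rewrite nt; move: l3 lt8; move: (log_scale n) (n%:R) => l N l3 lt8 h.
rewrite -(ler_pM2r t0); apply: le_trans h; nra.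
Qed.

Definition log_cells n := (Num.trunc (log_scale n)).+1.

Lemma log_cells_bounds n : 0 <= log_scale n ->
  log_scale n < (log_cells n)%:R <= log_scale n + 1.
Proof.
move=> l0; have /andP[h1 h2] := truncn_itv l0.
by rewrite /log_cells h2 -natr1 lerD2r.
Qed.

(** Chosen so that exp (6 - D) <= exp (- 2 l), of order n^(-2), which beats the order n cells of the
    union bound in [likely_sparse]. *)
Definition crowding n := ((log_cells n).*2 + 7)%N.

(** One factor L + 1 pays for the union over the L + 1 levels of [few_gaps], the other makes the
    resulting probability tend to 0. *)
Definition card_bound n : R := n%:R * (log_cells n).+1%:R ^+ 2.

Lemma expR_sub_le (del : R) : 0 <= del -> del <= 1 -> expR del - expR (- del) <= 8 * del.
Proof.
move=> d0 d1; have e4 : expR del <= 4 by apply: le_trans (expR1_le4 R); rewrite ler_expR.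
have : expR del * expR (- (2 * del)) = expR (- del) by rewrite -expRD; congr expR; ring.
have := expR_ge1Dx (- (2 * del)); have := expR_gt0 del.
move: (expR del) e4 (expR (- (2 * del))) (expR (- del)) => a a4 b c a0 b1 ab.
nra.
Qed.

Section environment.
Context dS (S : measurableType dS).
Variables (Q : probability S R) (y : int -> S -> R).
Hypothesis hy : unit_poisson_process Q y.
Context dT (T : measurableType dT).
Variables (P : probability T R) (w : int -> T -> R).
Hypothesis hw : palm_version Q y P w.

Lemma good_environment_near (e : R) : 0 < e -> exists (M : nat) (del r : R),
  [/\ (0 < M)%N, 0 < del, 0 < r & \forall n \near \oo,
   (P [set o | ~ good_environment (log_scale n) del (M * n + log_cells n)%:R
      (3 * M * n)%:R (Num.trunc (r * n%:R)).+1%:R (card_bound n)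
      ((Num.trunc (r * n%:R))%:R * (expR (-1) / 2) / 2) (log_cells n) (crowding n) (w ^~ o)]
    <= e%:E)%E].
Proof.
move=> e0; have [eta eta0 H] := likely_palm hy hw e0.
(* There are nine error terms; with x = eta / 10 for each, their sum stays strictly below eta. *)
pose x := eta / 10; have x0 : 0 < x by rewrite divr_gt0.
have sum9 (z1 z2 z3 z4 z5 z6 z7 : R) : z1 <= x -> z2 <= x -> z3 <= x -> z4 <= x ->
    z5 <= x -> z6 <= x -> z7 <= x ->
    z1 + (z1 + (z2 + (z3 + (z4 + (z5 + (z6 + (z7 + z7))))))) <= 9 * x by lra.
(* As L <= l + 1 and exp l = n t, the error for an empty run is at most 4 exp 3 t / M. *)
pose M := (Num.trunc (4 * expR 3 * t / x)).+1.
have MR : 4 * expR 3 * t / x <= M%:R.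
  by rewrite ltW// truncnS_gt// !mulr_ge0// ?expR_ge0// ?ltW// invr_gt0.
have M1 : 1 <= M%:R :> R by rewrite ler1n.
have M0 : (0 < M)%N by [].
clearbody M.
(* The expected number of critical gaps is at most 7 M n * exp (- l) * 8 del = 56 M del / t. *)
pose del := Num.min 1 (x * t / (56 * M%:R)).
have del0 : 0 < del by rewrite lt_min ltr01 !divr_gt0// !mulr_gt0// (lt_le_trans ltr01).
have del1 : del <= 1 by rewrite ge_min lexx.
have delx : 56 * M%:R * del <= x * t.
  by rewrite mulrC -ler_pdivlMr ?mulr_gt0// ?(lt_le_trans ltr01)// ge_min lexx orbT.
(* In [0, r n] about r n exp (- l) = x / 2 gaps longer than l are expected. *)
pose r := t * x / 2; have r0 : 0 < r by rewrite divr_gt0// mulr_gt0.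
exists M, del, r; split => //.
pose c0 := Num.max 1 (Num.max (4 / x) (Num.max (7 * M%:R / x) (Num.max (56 * M%:R / (t * x)) (Num.max ((1 + 32 / x) / r) (x^-1))))).
near=> n.
have [n0 cn cl ln3] : [/\ (0 < n)%N, c0 <= n%:R, c0 <= log_scale n & log_scale n + 3 <= n%:R].
  by near: n; exact: near_scale.
have bounds z : c0 <= z -> [/\ 1 <= z, 4 / x <= z, 7 * M%:R / x <= z, 56 * M%:R / (t * x) <= z
    & (1 + 32 / x) / r <= z /\ x^-1 <= z].
  by rewrite /c0 !ge_max => /andP[? /andP[? /andP[? /andP[? /andP[? ?]]]]].
have [l1 l2 l3 l4 [_ _]] := bounds _ cl.
have [n1 _ _ _ [n5 n6]] := bounds _ cn.
set l := log_scale n in cl ln3 l1 l2 l3 l4 *.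
have l0 : 0 <= l by lra.
have [lL Ll] : l < (log_cells n)%:R :> R /\ (log_cells n)%:R <= l + 1 :> R.
  by apply/andP; exact: log_cells_bounds.
rewrite /card_bound /crowding.
set L := log_cells n in lL Ll *; clearbody L.
pose V : R := n%:R * L.+1%:R ^+ 2; pose D := (L.*2 + 7)%N.
rewrite -/V -/D.
have el : expR l = n%:R * t := expR_log_scale n0.
have nR : 0 < n%:R :> R by rewrite ltr0n.
have eml : expR (- l) = (n%:R * t)^-1 by rewrite expRN el.
have ell : l <= n%:R * t by rewrite -el (le_trans _ (expR_ge1Dx l))// lerDr.
pose q := Num.trunc (r * n%:R).
have rn : 1 + 32 / x <= r * n%:R by rewrite [leRHS]mulrC -ler_pdivrMr.
have /andP[q1 q2] : q%:R <= r * n%:R < q.+1%:R by apply: truncn_itv; rewrite mulr_ge0// ltW.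
have qx : 32 / x <= q%:R by move: rn q2; rewrite -natr1; lra.
have qR : 0 < q%:R :> R by apply: lt_le_trans qx; rewrite divr_gt0.
have q0 : (0 < q)%N by rewrite -(ltr0n R).
have m0 : (0 < M * n)%N by rewrite muln_gt0 M0.
have V0 : 0 < V by rewrite mulr_gt0// exprn_gt0// ltr0n.
have D6 : (6 < D)%N by rewrite /D addnC.
have Mn : n%:R <= M%:R * n%:R :> R by rewrite ler_peMl// ltW.
have MW : (M * n + L)%:R + 1 <= (3 * M * n)%:R - n%:R :> R.
  have arith (a b c z : R) : a <= b -> c <= z + 1 -> z + 3 <= a -> b + c + 1 <= 3 * b - a by lra.
  by rewrite natrD !natrM -mulrA; exact: arith Mn Ll ln3.
have MW' : (M * n + L)%:R + 1 <= (3 * M * n)%:R :> R by move: MW nR; lra.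
have ld : 0 <= l - del by move: l1 del1; lra.
have W7 : (3 * M * n).*2.+1%:R <= 7 * M%:R * n%:R :> R.
  by rewrite -natr1 -addnn natrD !natrM; move: Mn n1; lra.
have := good_environment_likely hy hw ld (ltW del0) m0 V0 D6 q0 MW'.
apply: H; first exact: measurable_good_environment.
have T1 : 4 / ((M * n)%:R * expR (- L.+2%:R)) <= x.
  apply: le_trans (_ : 4 / (M%:R * n%:R * expR (- (l + 3))) <= _).
    rewrite natrM ler_pM2l// lef_pV2 ?posrE ?mulr_gt0 ?expR_gt0// ?(lt_le_trans ltr01)//.
    rewrite ler_pM2l ?mulr_gt0// ?(lt_le_trans ltr01)// ler_expR lerN2 -!natr1; move: Ll; lra.
  have -> : 4 / (M%:R * n%:R * expR (- (l + 3))) = 4 * expR 3 * t / M%:R.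
    rewrite expRN expRD el; have := expR_gt0 (3 : R) => e3.
    by field; rewrite !gt_eqF// (lt_le_trans ltr01).
  by rewrite ler_pdivrMr ?(lt_le_trans ltr01)// [leRHS]mulrC -ler_pdivrMr.
have T3 : (3 * M * n).*2.+1%:R * (expR (- (l - del)) - expR (- (l + del))) <= x.
  have -> : expR (- (l - del)) - expR (- (l + del)) = expR (- l) * (expR del - expR (- del)).
    by rewrite mulrBr -!expRD; congr (expR _ - expR _); ring.
  have d8 := expR_sub_le (ltW del0) del1.
  have dd : 0 <= expR del - expR (- del) by rewrite subr_ge0 ler_expR; lra.
  apply: le_trans (_ : 7 * M%:R * n%:R * (expR (- l) * (8 * del)) <= _).
    by apply: ler_pM => //; [rewrite mulr_ge0// expR_ge0|rewrite ler_wpM2l ?expR_ge0].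
  have -> : 7 * M%:R * n%:R * (expR (- l) * (8 * del)) = 56 * M%:R * del / t.
    by rewrite eml; field; rewrite !gt_eqF.
  by rewrite ler_pdivrMr.
have T4 : q.+2%:R * expR (- l) <= x.
  rewrite eml ler_pdivrMr ?mulr_gt0// -!natr1.
  have : 4 <= x * (n%:R * t) by rewrite [leRHS]mulrC -ler_pdivrMr// (le_trans l2).
  by move: q1; rewrite /r; lra.
have LR : 0 < L.+1%:R :> R by [].
have T5 : L.+1%:R * ((3 * M * n).*2.+1%:R / V) <= x.
  apply: le_trans (_ : L.+1%:R * (7 * M%:R * n%:R / V) <= _).
    by rewrite ler_pM2l// ler_pM2r ?invr_gt0.
  have -> : L.+1%:R * (7 * M%:R * n%:R / V) = 7 * M%:R / L.+1%:R.
    rewrite /V; move: LR nR; move: L.+1%:R n%:R => Lr nr Lr0 nr0.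
    by field; rewrite !gt_eqF.
  rewrite ler_pdivrMr// [leRHS]mulrC -ler_pdivrMr// (le_trans l3)// ltW// (lt_trans lL)//.
  by rewrite ltr_nat.
have T6 : (3 * M * n).*2.+1%:R * (4 * expR (6 - (D)%:R) + 4 * expR (6 - (D)%:R)) <= x.
  have De : expR (6 - (D)%:R) <= expR (- l) * expR (- l).
    by rewrite -expRD ler_expR /D natrD -addnn natrD; move: lL; lra.
  apply: le_trans (_ : 7 * M%:R * n%:R * (8 * (expR (- l) * expR (- l))) <= _).
    by apply: ler_pM => //; move: De; lra.
  have -> : 7 * M%:R * n%:R * (8 * (expR (- l) * expR (- l))) = 56 * M%:R / (t * (n%:R * t)).
    by rewrite eml; field; rewrite !gt_eqF.
  rewrite ler_pdivrMr ?mulr_gt0//.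
  have -> : x * (t * (n%:R * t)) = n%:R * t * (t * x) by ring.
  by rewrite -ler_pdivrMr ?mulr_gt0//; exact: le_trans l4 ell.
have T7 : 4 / (q%:R * (expR (-1) / 2)) <= x.
  have e1 : 4^-1 <= expR (-1) :> R by rewrite expRN lef_pV2 ?posrE ?expR_gt0// expR1_le4.
  apply: le_trans (_ : 4 / (q%:R * 8^-1) <= _).
    rewrite ler_pM2l// lef_pV2 ?posrE ?mulr_gt0 ?divr_gt0 ?expR_gt0//.
    by rewrite ler_pM2l//; move: e1; lra.
  have -> : 4 / (q%:R * 8^-1) = 32 / q%:R :> R by field; rewrite gt_eqF.
  by rewrite ler_pdivrMr// [leRHS]mulrC -ler_pdivrMr.
have T8 : expR (- ((3 * M * n)%:R - ((M * n + L)%:R + 1))) <= x.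
  apply: le_trans (_ : expR (- n%:R) <= _); first by rewrite ler_expR lerN2; move: MW; lra.
  rewrite expRN -[leRHS]invrK lef_pV2 ?posrE ?expR_gt0 ?invr_gt0//.
  by apply: le_trans n6 _; rewrite (le_trans _ (expR_ge1Dx _))// lerDr.
have : 9 * x < eta by rewrite /x; move: eta0; lra.
apply: le_lt_trans; rewrite -/q.
exact: sum9.
Unshelve. all: by end_near. Qed.

End environment.
End scales.

Section trap_scales.
Variable R : realType.

(** [EU] stands for exp (l^alpha), [E] for exp (del l^(alpha-1)) and [q] for a power of l above
    l^alpha. The constant is 3^5 for [Lr]^5, times 11 for [D], times the 6 in front of [q]. *)
Lemma fast_scale (C1 C2 t EU E Lr N D l e q K : R) :
  0 < C1 -> 0 < C2 -> 0 < t -> 0 < EU -> 0 < E -> 0 < N -> 0 < q -> 0 < e ->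
  0 <= Lr <= 3 * l -> 0 <= D <= 11 * l ->
  C1 * C2 / t * (243 * 66) * (l ^+ 6 * q) <= e * E -> N * EU / (6 * q) <= K ->
  (C1 / t * Lr ^+ 3 * EU / E) * (N * Lr ^+ 2 * (C2 * D)) <= e * K.
Proof.
move=> C10 C20 t0 EU0 E0 N0 q0 e0 /andP[L0 Ll] /andP[D0 Dl] h hK.
have l0 : 0 <= l by lra.
apply: le_trans (_ : e * (N * EU / (6 * q)) <= _); last by rewrite ler_pM2l.
have -> : (C1 / t * Lr ^+ 3 * EU / E) * (N * Lr ^+ 2 * (C2 * D)) =
  (N * EU / E) * (C1 * C2 / t * (Lr ^+ 5 * D)) by field; rewrite !gt_eqF.
have -> : e * (N * EU / (6 * q)) = (N * EU / E) * (e * E / (6 * q)).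
  by field; rewrite !gt_eqF.
rewrite ler_pM2l ?divr_gt0 ?mulr_gt0//.
rewrite ler_pdivlMr ?mulr_gt0//; apply: le_trans h.
have -> : C1 * C2 / t * (243 * 66) * (l ^+ 6 * q) =
  C1 * C2 / t * ((3 * l) ^+ 5 * (11 * l)) * (6 * q).
  by rewrite exprMn; ring.
rewrite ler_pM2r ?mulr_gt0// ler_pM2l ?divr_gt0 ?mulr_gt0//.
by apply: ler_pM => //; [exact: exprn_ge0|rewrite lerXn2r// nnegrE mulr_ge0].
Qed.

(** The constant collects 4 * 8 = 32 from 4 K, 8 * 11^2 = 968 from 8 D^2, and 32 from the lower
    bound on Z. *)
Lemma tight_scale (C3 c r EU E N D l e K Z : R) :
  0 < C3 -> 0 < c -> 0 < EU -> 0 < E -> 0 < N -> 0 < e -> 0 < l ->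
  0 <= D <= 11 * l -> 0 <= K <= 8 * (N * EU) -> r * N / 32 <= Z ->
  C3 / c * (968 * 32 * 32) * l ^+ 2 <= e * E * r ->
  4 * K * (8 * D ^+ 2 * (C3 / (EU * E))) <= e * (c * Z).
Proof.
move=> C30 c0 EU0 E0 N0 e0 l0 /andP[D0 Dl] /andP[K0 KT] hZ h.
apply: le_trans (_ : 4 * (8 * (N * EU)) * (8 * (11 * l) ^+ 2 * (C3 / (EU * E))) <= _).
  apply: ler_pM => //.
  - by rewrite mulr_ge0.
  - by rewrite !mulr_ge0 ?exprn_ge0 ?invr_ge0// ?ltW// !mulr_gt0.
  - by rewrite ler_pM2l.
  rewrite ler_pM2r ?divr_gt0 ?mulr_gt0// ler_pM2l//.
  by rewrite lerXn2r// nnegrE// mulr_ge0// ltW.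
apply: le_trans (_ : e * (c * (r * N / 32)) <= _); last by rewrite !ler_pM2l.
have -> : 4 * (8 * (N * EU)) * (8 * (11 * l) ^+ 2 * (C3 / (EU * E))) =
  N * c / (32 * E) * (C3 / c * (968 * 32 * 32) * l ^+ 2).
  by rewrite exprMn; field; rewrite !gt_eqF.
have -> : e * (c * (r * N / 32)) = N * c / (32 * E) * (e * E * r).
  by field; rewrite gt_eqF.
by rewrite ler_pM2l ?divr_gt0 ?mulr_gt0.
Qed.

Variables (alpha A t e del r : R) (M : nat).
Hypothesis alpha1 : 1 < alpha.
Hypothesis A0 : 0 <= A.
Hypothesis t0 : 0 < t.
Hypothesis e0 : 0 < e.
Hypothesis e2 : e <= 2^-1.
Hypothesis del0 : 0 < del.
Hypothesis r0 : 0 < r.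
Hypothesis M0 : (0 < M)%N.

(** The bias is at most A / n on a window of size 3 M n, so this bounds the tilt uniformly in n. *)
Let B := 3 * M%:R * A.

Lemma Linv_log_scale n : 0 <= log_scale t n -> (0 < n)%N ->
  Linv alpha (n%:R * t) = expR (log_scale t n `^ alpha).
Proof.
move=> l0 n0; rewrite /Linv ifT// -(expR_log_scale t0 n0).
by rewrite -expR0 ler_expR.
Qed.

Lemma trap_scales_near : \forall n \near \oo,
  let l := log_scale t n in
  let T := n%:R * Linv alpha (n%:R * t) in
  let Rb := expR (2 * B + l `^ alpha - del * (l `^ (alpha - 1) - 1) - l) *
    (expR 1 * (log_cells t n).+1%:R * card_bound t n) in
  let Pu := card_bound t n * site_bound alpha A B (crowding t n) in
  let Z := (Num.trunc (r * n%:R))%:R * (expR (-1) / 2) / 2 in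
  let Kp := 8 * (crowding t n)%:R ^+ 2 *
    expR (3 * B - l `^ alpha - del * l `^ (alpha - 1)) in
  [/\ (0 < n)%N, 0 <= l, l + del <= 3 * M%:R * n%:R, 1 + A <= l `^ (alpha - 1) & 0 < Z] /\
  exists (K1 K2 : nat) (u : R),
  [/\ (0 < K1)%N, (K1 <= K2)%N, Rb * Pu <= e * K1%:R, 2 * (Rb * Pu) <= K2%:R &
      4 * K2%:R * Kp <= e * (expR (- 2 * B - 1) * Z)] /\
  [/\ 0 <= T, 0 <= u, K1%:R * u <= T, T <= K2.+1%:R * expR (- 1) / 2 &
      K1%:R * expR (- u) + 4 / (K2.+1%:R * expR (- 1)) <= 2 * e].
Proof.
pose C1 : R := expR (2 * B + del + 1).
pose C2 : R := 4 * expR (2 * B + (1 + A) * (1 + A) `^ (alpha - 1)^-1).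
pose C3 : R := expR (3 * B); pose c4 : R := expR (- 2 * B - 1).
pose p := (Num.trunc alpha).+1.
have a1 (x z : R) : x <= z -> z + - (3 * z) <= - x + - x by lra.
have a2 : 2 * e <= 1 by rewrite -ler_pdivlMl ?mulr1.
have a3 (x : R) : 0 < x -> x <= 8 * x * 4^-1 / 2 by lra.
have a4 (x z : R) : x < z + 1 -> 2 <= x -> x / 2 <= z by lra.
have a5 (x z : R) : z <= x -> 0 < x -> z <= 8 * x by lra.
have a6 (x : R) : 1 <= x -> 1 <= 3 * x by lra.
have a7 (x z : R) : 6 <= x -> 1 <= z -> 2 * (3 * z) <= x * (1 + z) by nra.
have a8 (x z v d : R) : 0 < v -> x + 3 <= v -> d <= v -> v <= z -> x + d <= 3 * z by lra.
have a9 (x z : R) : x < z + 1 -> 2 <= x -> x / 32 <= z / 16 by lra.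
have g0 : 0 < alpha - 1 by rewrite subr_gt0.
(* Five powers of l come from [Lr], one from the crowding bound, and p from l^alpha <= l^p. *)
have [lf Hf] := powers_le_exp (C1 * C2 / t * (243 * 66)) (6 + p) g0 del0 e0.
have [lt Ht] := powers_le_exp (C3 / c4 * (968 * 32 * 32) / r) 2 g0 del0 e0.
pose c0 := Num.max 6 (Num.max ((1 + A) `^ (alpha - 1)^-1) (Num.max del (Num.max lf
  (Num.max lt (Num.max (2 / r) (Num.max (t * e)^-1 (2 / e))))))).
near=> n; move=> l T Rb Pu Z Kp.
have [n0 cn cl ln3] : [/\ (0 < n)%N, c0 <= n%:R, c0 <= log_scale t n & log_scale t n + 3 <= n%:R].
  by near: n; exact: near_scale.
move: cn cl; rewrite /c0 !ge_max -/l.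
move=> /andP[n6 /andP[_ /andP[nd /andP[_ /andP[_ /andP[nr /andP[_ ne]]]]]]].
move=> /andP[l6 /andP[lA /andP[_ /andP[llf /andP[llt /andP[_ /andP[lte _]]]]]]].
have nR : 0 < n%:R :> R by rewrite ltr0n.
have l0 : 0 < l by exact: lt_le_trans l6.
have l1 : 1 <= l by apply: le_trans l6; rewrite ler1n.
have M1 : 1 <= M%:R :> R by rewrite ler1n.
pose N : R := n%:R.
pose U := l `^ alpha; pose G := l `^ (alpha - 1); pose E := expR (del * G).
pose EU := expR U.
have E0 : 0 < E := expR_gt0 _.
have EU0 : 0 < EU := expR_gt0 _.
have TE : T = N * EU by rewrite /T Linv_log_scale// ltW.
have el : expR l = N * t := expR_log_scale t0 n0.
have lU : l <= U.
  by rewrite -[leLHS]powRr1 ?(ltW l0)//; apply: ler_powR => //; exact: ltW.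
have Up : U <= l ^+ p.
  rewrite -powR_mulrn ?(ltW l0)//; apply: ler_powR => //.
  by rewrite ltW// truncnS_gt// (le_trans ler01)// ltW.
have U1 : 1 <= U := le_trans l1 lU.
have U0 : 0 < U := lt_le_trans l0 lU.
have GA : 1 + A <= G.
  have -> : 1 + A = ((1 + A) `^ (alpha - 1)^-1) `^ (alpha - 1).
    by rewrite -powRrM mulVf ?gt_eqF// powRr1// addr_ge0.
  by apply: ge0_ler_powR; rewrite ?nnegrE ?powR_ge0// ltW.
have [lL Ll] : l < (log_cells t n)%:R :> R /\ (log_cells t n)%:R <= l + 1 :> R.
  by apply/andP; apply: log_cells_bounds; exact: ltW.
pose Lr : R := (log_cells t n).+1%:R; pose D : R := (crowding t n)%:R.
have Lr3 : 0 <= Lr <= 3 * l.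
  rewrite ler0n /= /Lr -natr1; move: ((log_cells t n)%:R) Ll l6 => z; lra.
have D11 : 0 <= D <= 11 * l.
  rewrite ler0n /= /D /crowding natrD -addnn natrD.
  by move: ((log_cells t n)%:R) Ll l6 => z; lra.
pose q := Num.trunc (r * n%:R).
have rn0 : 0 <= r * N by rewrite mulr_ge0// ltW.
have q1 : r * N < q%:R + 1 by rewrite natr1; have /andP[] := truncn_itv rn0.
have e41 : 4^-1 <= expR (-1) :> R by rewrite expRN lef_pV2 ?posrE ?expR_gt0// expR1_le4.
have rn2 : 2 <= r * N by rewrite mulrC -ler_pdivrMr.
have Zr : r * N / 32 <= Z.
  apply: le_trans (_ : q%:R / 16 <= _); first exact: a9.
  rewrite /Z -/q -!mulrA ler_wpM2l//; move: e41; lra.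
have ZO : 0 < Z by apply: lt_le_trans Zr; rewrite !mulr_gt0.
split.
  split => //; first exact: ltW.
  have : n%:R <= M%:R * n%:R :> R by rewrite ler_peMl// ltW.
  by rewrite -mulrA; exact: a8.
have NU : N * (1 + U) <= N * EU by rewrite ler_pM2l// expR_ge1Dx.
(* The factor 3 makes T exp (- u) equal to n exp (- 2 l^alpha), at most n exp (- 2 l), which tends
   to 0. *)
pose u := 3 * U; have u0 : 0 < u by rewrite mulr_gt0// (lt_le_trans ltr01).
have T2u : 2 * u <= T.
  by rewrite TE (le_trans _ NU)//; exact: a7.
have T0 : 0 < T by rewrite TE mulr_gt0.
have NT : N <= T by rewrite TE (le_trans _ NU)// ler_peMr// ?lerDl// ?(le_trans ler01)// ltW.
(* Since exp (-1) >= 1/4, the factor 8 gives (K2 + 1) exp (-1) / 2 >= T. *)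
pose K1 := Num.trunc (T / u); pose K2 := Num.trunc (8 * T).
have /andP[K1l K1u] : K1%:R <= T / u < K1.+1%:R by apply: truncn_itv; rewrite divr_ge0// ltW.
have /andP[K2l K2u] : K2%:R <= 8 * T < K2.+1%:R by apply: truncn_itv; rewrite mulr_ge0// ltW.
have Tu : 2 <= T / u by rewrite ler_pdivlMr.
have K10 : (0 < K1)%N by rewrite truncn_gt0 (le_trans _ Tu)// ler1n.
have u1 : 1 <= u by exact: a6.
have TuT : T / u <= T by rewrite ler_pdivrMr// ler_peMr// ltW.
have K12 : (K1 <= K2)%N by apply: le_truncn; exact: a5.
have K1T : N * EU / (6 * l ^+ p) <= K1%:R.
  apply: le_trans (_ : T / (2 * u) <= _).
    rewrite -TE ler_pM2l// lef_pV2 ?posrE ?mulr_gt0 ?exprn_gt0// /u.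
    have -> : 2 * (3 * U) = 6 * U by ring.
    by rewrite ler_pM2l.
  have -> : T / (2 * u) = (T / u) / 2 by field; rewrite gt_eqF.
  by apply: a4 => //; rewrite natr1.
have RbE : Rb = C1 / t * Lr ^+ 3 * EU / E.
  rewrite /Rb /card_bound -/Lr -/N -/U -/G.
  have -> : 2 * B + U - del * (G - 1) - l = (2 * B + del) + U - del * G - l by ring.
  rewrite [expR (_ - l)]expRD [expR (_ - _)]expRD [expR (_ + U)]expRD !expRN el -/E -/EU.
  rewrite /C1 [expR (_ + 1)]expRD; field; rewrite !gt_eqF//.
have PuE : Pu = N * Lr ^+ 2 * (C2 * D) by [].
have fast : Rb * Pu <= e * K1%:R.
  rewrite RbE PuE; apply: (@fast_scale C1 C2 t EU E Lr N D l e (l ^+ p)) => //.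
  - exact: expR_gt0.
  - by rewrite mulr_gt0// expR_gt0.
  - exact: exprn_gt0.
  by rewrite -exprD; exact: Hf.
have K1e : 2 * (e * K1%:R) <= K1%:R by rewrite mulrA ler_piMl.
have KpE : Kp = 8 * D ^+ 2 * (C3 / (EU * E)).
  by rewrite /Kp -/D -/U -/G -addrA expRD -opprD expRN expRD.
exists K1, K2, u; split; split => //.
- apply: le_trans (_ : K1%:R <= _); last by rewrite ler_nat.
  by apply: le_trans K1e; rewrite ler_pM2l.
- rewrite KpE -/c4; apply: (@tight_scale C3 c4 r EU E N D l) => //; try exact: expR_gt0.
    by rewrite ler0n /= -TE.
  have := Ht l llt; rewrite -(ler_pM2r r0) => /(le_trans _); apply.
  by rewrite le_eqVlt; apply/orP; left; apply/eqP; field; rewrite gt_eqF// gt_eqF ?expR_gt0.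
- exact: ltW.
- exact: ltW.
- by rewrite -ler_pdivlMr.
- apply: le_trans (_ : (8 * T) * 4^-1 / 2 <= _); first exact: a3.
  by rewrite ler_pM2r ?invr_gt0//; apply: ler_pM => //; [rewrite mulr_ge0// ltW|exact: ltW].
have h1 : K1%:R * expR (- u) <= e.
  apply: le_trans (_ : T * expR (- u) <= _).
    by rewrite ler_wpM2r ?expR_ge0// (le_trans K1l).
  rewrite TE -mulrA -expRD.
  apply: le_trans (_ : N * (expR (- l) * expR (- l)) <= _).
    by rewrite ler_pM2l// -expRD ler_expR; exact: a1.
  have -> : N * (expR (- l) * expR (- l)) = (t * (N * t))^-1.
    by rewrite expRN el; field; rewrite !gt_eqF.
  rewrite -[leRHS]invrK lef_pV2 ?posrE ?invr_gt0 ?mulr_gt0//.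
  have -> : e^-1 = t * (t * e)^-1 by field; rewrite !gt_eqF.
  rewrite ler_pM2l// (le_trans lte)// -el (le_trans _ (expR_ge1Dx l))// lerDr//.
have h2 : 4 / (K2.+1%:R * expR (- 1)) <= e.
  apply: le_trans (_ : 4 / (8 * N * 4^-1) <= _).
    rewrite ler_pM2l// lef_pV2 ?posrE ?mulr_gt0 ?expR_gt0//.
    by apply: ler_pM => //; [rewrite mulr_ge0// ltW|rewrite (le_trans _ (ltW K2u))// ler_pM2l].
  have -> : 4 / (8 * N * 4^-1) = 2 / N by field; rewrite gt_eqF.
  by rewrite ler_pdivrMr// [leRHS]mulrC -ler_pdivrMr.
have -> : 2 * e = e + e by ring.
exact: lerD.
Unshelve. all: by end_near. Qed.

End trap_scales.

(** * The quenched limit, uniformly over good environments *)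

Section escape.
Variables (R : realType) (alpha lambda t : R).
Hypothesis alpha1 : 1 < alpha.
Hypothesis t0 : 0 < t.

Definition endpoint_event (O : Type) (X : R -> O -> R) (x : int -> R) (n : nat) : set O :=
  [set o | (n%:R^-1 * running_inf (X ^~ o) (n%:R * Linv alpha (n%:R * t)),
            n%:R^-1 * running_sup (X ^~ o) (n%:R * Linv alpha (n%:R * t))) =
           (m_minus_inv alpha x n t, m_plus_inv alpha x n t)].

(** The environment and the law are quantified after n: the threshold on n is the same for all good
    environments, which is what allows integration over them. *)
Lemma endpoint_event_near (e del r : R) (M : nat) : 0 < e -> 0 < del -> 0 < r ->
  (0 < M)%N -> \forall n \near \oo,
  forall dO (O : measurableType dO) (mu : probability O R) (X : R -> O -> R) (x : int -> R),
  (forall t, 0 <= t -> measurable_fun setT (X t)) ->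
  (forall o, cadlag (X ^~ o)) ->
  increasing_enum x -> x 0 = 0 ->
  markov_chain mu X (range x) (mott_generator alpha (lambda / n%:R) x) 0 ->
  good_environment (log_scale t n) del (M * n + log_cells t n)%:R
      (3 * M * n)%:R (Num.trunc (r * n%:R)).+1%:R (card_bound t n)
      ((Num.trunc (r * n%:R))%:R * (expR (-1) / 2) / 2) (log_cells t n) (crowding t n) x ->
  ((1 - e)%:E <= mu (endpoint_event X x n))%E.
Proof.
(* 13 is 11 from [trapped_walk] plus 2 from its remaining error terms; e1 <= 1/2 makes [mixing] a
   consequence of [fast]. *)
move=> e0 d0 r0 M0; pose e1 := Num.min (e / 13) 2^-1.
have e10 : 0 < e1 by rewrite lt_min divr_gt0//= invr_gt0.
have e12 : e1 <= 2^-1 by rewrite ge_min lexx orbT.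
have e13 : 13 * e1 <= e by rewrite mulrC -ler_pdivlMr// ge_min lexx.
have budget (p q : R) : p + q <= 2 * e1 -> 1 - e <= 1 - 11 * e1 - p - q by move: e13; lra.
apply: filterS (trap_scales_near alpha1 (normr_ge0 lambda) t0 e10 e12 d0 r0 M0) => n.
cbv zeta => -[[n0 l0 lW lA Z0] [K1 [K2 [u [[K10 K12 fast mixing tight] [T0 u0 K1u TK2 err]]]]]].
move=> dO O mu X x mX cX incx x0 chain good.
have /andP[lL _] := log_cells_bounds l0.
have inc i : x i < x (i + 1) by case: incx.
have d0' := ltW d0.
have nR : 0 < n%:R :> R by rewrite ltr0n.
have MW : (M * n + log_cells t n)%:R <= (3 * M * n)%:R :> R.
  have [j /andP[j1 j2]] := outer_right good; exact: le_trans j1 j2.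
have [b [b0 gb bM smallb]] := first_big_gap_right incx x0 good lL.
have [a [a0 ga aM smalla]] := first_big_gap_left incx x0 good lL.
have [s [us sP sZ]] := trap_short_gaps incx x0 good a0 b0 gb.
have lamn : `|lambda / n%:R| = `|lambda| / n%:R.
  by rewrite normrM normfV [`|n%:R|]ger0_norm// ltW.
have lamA : `|lambda / n%:R| <= `|lambda|.
  by rewrite lamn ler_pdivrMr// ler_peMr// ler1n.
have lamW : `|lambda / n%:R| * (3 * M * n)%:R <= 3 * M%:R * `|lambda|.
  by rewrite lamn !natrM le_eqVlt; apply/orP; left; apply/eqP; field; rewrite gt_eqF.
have lamB : `|lambda / n%:R| * (log_scale t n + del) <= 3 * M%:R * `|lambda|.
  apply: le_trans lamW; rewrite ler_wpM2l// !natrM.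
  exact: lW.
have D0 : (0 < crowding t n)%N by rewrite /crowding addnC.
have := @trapped_walk _ O R mu X alpha _ x mX cX alpha1 inc x0 chain
  _ `|lambda| _ _ del _ _ _ e1 _ u _ K1 K2 a b D0 (normr_ge0 _) lamA lamW a0 b0
  (trap_window incx good aM bM) (fun p r h => (sparse good r h).1)
  (fun p r h => (sparse good r h).2) l0 d0' lA lamB
  (trap_gap_left incx good d0' a0 b0 ga aM bM) (trap_gap_right incx good d0' a0 b0 gb aM bM)
  (trap_gap_small incx good d0' aM bM smalla smallb)
  (trap_sum_exp incx good lL a0 b0 aM bM smalla smallb) (trap_card incx good a0 b0 aM bM)
  s us sP sZ Z0 K10 K12 e10 fast mixing tight T0 u0 K1u TK2.
have -> : endpoint_event X x n = [set o |
    running_inf (X ^~ o) (n%:R * Linv alpha (n%:R * t)) = x a /\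
    running_sup (X ^~ o) (n%:R * Linv alpha (n%:R * t)) = x b].
  rewrite /endpoint_event (m_plus_invE alpha1 incx x0 n0 t0 b0 gb smallb).
  rewrite (m_minus_invE alpha1 incx x0 n0 t0 a0 ga smalla).
  have ninj : injective ( *%R (n%:R^-1 : R)) by apply: mulfI; rewrite invr_neq0// gt_eqF.
  by apply/seteqP; split => o /= => [[/ninj-> /ninj->]//|[-> ->]].
apply: le_trans; rewrite lee_fin; exact: budget.
Qed.

End escape.

(** A kernel yields bare measures, whereas the quenched estimates are stated for bundled
    probabilities; this bundles the same measure. *)
Lemma measure_probability d (O : measurableType d) (R : realType)
  (mu : {measure set O -> \bar R}) : mu setT = 1%E ->
  exists nu : probability O R, (nu : {measure set O -> \bar R}) = mu.
Proof.
case: mu => m c /= h.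
pose mu : {measure set O -> \bar R} := Measure.Pack c.
pose i := @Measure_isProbability.Build _ _ _ mu h.
by exists (HB.pack_for (probability O R) (Measure.sort mu) i : probability O R).
Qed.

(** * Integration over the environment *)

Section annealed_limit.
Context (R : realType) (alpha lambda : R) (alpha1 : 1 < alpha)
  (dS : measure_display) (S : measurableType dS) (Q : probability S R)
  (y : int -> S -> R) (hy : unit_poisson_process Q y)
  (dT : measure_display) (T : measurableType dT) (P : probability T R)
  (w : int -> T -> R) (hw : palm_version Q y P w)
  (dO : measure_display) (O : measurableType dO) (X : R -> O -> R)
  (mX : forall t, 0 <= t -> measurable_fun setT (X t))
  (cX : forall o, cadlag (X ^~ o))
  (K : R -> R.-pker T ~> O)
  (hK : forall l : R, quenched_law P w X alpha l (K l))
  (t : R) (t0 : 0 < t).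

Let prob_chain n e : exists nu : probability O R,
  (nu : {measure set O -> \bar R}) = K (lambda / n%:R) e.
Proof. exact/measure_probability/prob_kernel. Qed.

Let time_ge0 (n : nat) : 0 <= n%:R * Linv alpha (n%:R * t).
Proof.
rewrite mulr_ge0// /Linv; case: ifP => _; first exact: expR_ge0.
by rewrite mulr_ge0// ltW.
Qed.

Let measurable_endpoint_event (x : int -> R) n : (0 < n)%N ->
  measurable (endpoint_event alpha t X x n).
Proof.
move=> n0; have nR : 0 < n%:R :> R by rewrite ltr0n.
have ninj : injective ( *%R (n%:R^-1 : R)) by apply: mulfI; rewrite invr_neq0// gt_eqF.
rewrite (_ : endpoint_event _ _ _ _ _ = [set o |
    running_inf (X ^~ o) (n%:R * Linv alpha (n%:R * t)) = n%:R * m_minus_inv alpha x n t /\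
    running_sup (X ^~ o) (n%:R * Linv alpha (n%:R * t)) = n%:R * m_plus_inv alpha x n t]).
  have rcX o s : 0 <= s -> X z o @[z --> s^'+] --> X s o by case: (cX o) => + _; apply.
  apply: measurable_and; first exact: measurable_running_inf_eq.
  exact: measurable_running_sup_eq.
apply/seteqP; split => o /=.
  by rewrite /endpoint_event /= => -[<- <-]; rewrite !mulrA mulfV ?gt_eqF// !mul1r.
by rewrite /endpoint_event /= => -[-> ->]; rewrite !mulrA mulVf ?gt_eqF// !mul1r.
Qed.

Let measurable_env (A : set (int -> R)) : measurable_seqs A ->
  measurable [set e | A (w ^~ e)].
Proof.
move=> mA; rewrite -[mkset _]setTI.
have mw : measurable_fun setT (fun e => (w ^~ e : seq_space R)).
  apply: (@measurability _ _ T (seq_space R) setT _ (@seq_generators R)) => //.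
  move=> _ [B [i [C [mC ->]]] <-]; rewrite setTI.
  by case: hw => mw _ _; rewrite -[X in measurable X]setTI; exact: mw.
exact: mw.
Qed.

Let F n : \bar R := (\int[P]_e K (lambda / n%:R) e (endpoint_event alpha t X (w ^~ e) n))%E.

Let F_ge0 n : (0 <= F n)%E. Proof. exact: integral_ge0. Qed.

Let F_le1 n : (0 < n)%N -> (F n <= 1)%E.
Proof.
move=> n0; apply: le_trans (_ : \int[P]_e 1 <= _)%E; last first.
  by rewrite integral_cst// mul1e -[X in (X <= _)%E]/(P setT) probability_setT.
apply: le_integral_nonneg => e //; have [nu <-] := prob_chain n e.
exact/probability_le1/measurable_endpoint_event.
Qed.

Let F_near (d : R) : 0 < d -> \forall n \near \oo, ((1 - d)%:E <= F n)%E.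
Proof.
(* The error e is spent twice, on the environment and on the walk, and (1 - e)^2 >= 1 - 2 e >= 1 -
   d. *)
move=> d0; pose e := Num.min (d / 2) 1.
have e0 : 0 < e by rewrite lt_min ltr01 divr_gt0.
have e1 : e <= 1 by rewrite ge_min lexx orbT.
have ed : 1 - d <= (1 - e) * (1 - e).
  have : e <= d / 2 by rewrite ge_min lexx.
  nra.
have [M [del [r [M0 del0 r0 env]]]] := good_environment_near t0 hy hw e0.
apply: filterS2 env (endpoint_event_near lambda alpha1 t0 e0 del0 r0 M0) => n.
set good := good_environment _ _ _ _ _ _ _ _ _ => badP walk.
have [N [mN PN NP]] := hK (lambda / n%:R).
have mG : measurable [set o | good (w ^~ o)].
  exact: measurable_env (measurable_good_environment _ _ _ _ _ _ _ _ _).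
pose G := [set o | good (w ^~ o)] `\` N.
have mGN : measurable G by exact: measurableD.
have PG : ((1 - e)%:E <= P G)%E.
  have : (1 <= P G + (P [set o | ~ good (w ^~ o)] + P N))%E.
    rewrite -(@probability_setT _ _ _ P).
    apply: le_trans (_ : P (G `|` ([set o | ~ good (w ^~ o)] `|` N)) <= _)%E.
      apply: le_measure; rewrite ?inE//.
        by apply: measurableU => //; apply: measurableU => //; exact: measurable_not.
      move=> o _; have [No|nNo] := pselect (N o); first by right; right.
      by have [go|ngo] := pselect (good (w ^~ o)); [left|right; left].
    apply: le_trans (measureU2 _ _ _) _ => //.
      by apply: measurableU => //; exact: measurable_not.
    rewrite leeD2l//; apply: measureU2 => //; exact: measurable_not.
  rewrite PN adde0 => h; have h2 := le_trans h (leeD2l (P G) badP).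
  rewrite EFinB leeBlDr//.
(* The simple function (1 - e) 1_G lies below the quenched probability, and [le_integral_nonneg]
   compares the integrals without any measurability of the latter in the environment. *)
apply: le_trans (_ : \int[P]_o ((1 - e) * \1_G o)%:E <= _)%E.
  under eq_integral do rewrite EFinM.
  rewrite ge0_integralZl//.
  - rewrite integral_indic// setIT -[X in (_ * X)%E]/(P G).
    apply: le_trans (_ : (1 - e)%:E * (1 - e)%:E <= _)%E; first by rewrite -EFinM lee_fin.
    by rewrite lee_wpmul2l// lee_fin subr_ge0.
  - by apply/measurable_EFinP; exact: measurable_indic.
  - by rewrite lee_fin subr_ge0.
apply: le_integral_nonneg => o.
  by rewrite lee_fin mulr_ge0// subr_ge0.
rewrite indicE; case: (boolP (o \in G)) => oG; last by rewrite mulr0.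
rewrite mulr1; move: oG; rewrite inE => -[go nNo].
case: hw => _ /(_ o)[incw w0] _.
have chain : markov_chain (K (lambda / n%:R) o) X (range (w ^~ o))
    (mott_generator alpha (lambda / n%:R) (w ^~ o)) 0.
  by apply: contrapT => nc; apply: nNo; exact: NP.
have [nu nuE] := prob_chain n o; rewrite -nuE; apply: walk => //.
by rewrite nuE.
Qed.

Lemma annealed_endpoint_cvg : F n @[n --> \oo] --> 1%E.
Proof.
have fin : \forall n \near \oo, F n \is a fin_num.
  near=> n; rewrite ge0_fin_numE//; apply: le_lt_trans (ltry 1); apply: F_le1.
  by near: n; exact: nbhs_infty_gt.
apply/fine_cvgP; split => //.
apply/cvgrPdist_le => d d0; near=> n.
have n0 : (0 < n)%N by near: n; exact: nbhs_infty_gt.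
have fn : F n \is a fin_num by near: n.
have h1 : fine (F n) <= 1 by rewrite -lee_fin fineK// F_le1.
have h2 : 1 - d <= fine (F n) by rewrite -lee_fin fineK//; near: n; exact: F_near.
by rewrite ger0_norm ?subr_ge0// lerBlDl -lerBlDr.
Unshelve. all: by end_near. Qed.

End annealed_limit.

Unset Implicit Arguments.
Set Strict Implicit.

Theorem mainTheorem2 (R : realType) (alpha lambda : R) (halpha : 1 < alpha)
  (dS : measure_display) (S : measurableType dS) (Q : probability S R)
  (y : int -> S -> R) (hy : unit_poisson_process Q y)
  (dT : measure_display) (T : measurableType dT) (P : probability T R)
  (w : int -> T -> R) (hw : palm_version Q y P w)
  (dO : measure_display) (O : measurableType dO) (X : R -> O -> R)
  (mX : forall t, 0 <= t -> measurable_fun setT (X t))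
  (cX : forall o, cadlag (X ^~ o))
  (K : R -> R.-pker T ~> O)
  (hK : forall l : R, quenched_law P w X alpha l (K l))
  (t : R) (ht : 0 < t) :
  annealed P (K (lambda / n%:R))
    [set eo : T * O |
       let tn := n%:R * Linv alpha (n%:R * t) in
       (n%:R^-1 * running_inf (X ^~ eo.2) tn,
        n%:R^-1 * running_sup (X ^~ eo.2) tn) =
       (m_minus_inv alpha (w ^~ eo.1) n t, m_plus_inv alpha (w ^~ eo.1) n t)]
    @[n --> \oo] --> 1%E.
Proof. exact: (annealed_endpoint_cvg lambda halpha hy hw mX cX hK ht). Qed.
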